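(* Let $\mathbf{w}$ be a $k$-automatic word, and let $\gamma_\mathbf{w}(n)$ be the size of the smallest string attractor of $\mathbf{w}[0..n-1]$. Then: (i) $\gamma_\mathbf{w}(n)$ is either $\Theta(1)$ or $\Theta(\log n)$; (ii) it is decidable (given an automaton for $\mathbf{w}$) which of these two cases holds; (iii) if $\gamma_\mathbf{w}(n)=\Theta(1)$, then the sequence $\gamma_\mathbf{w}(1)\gamma_\mathbf{w}(2)\cdots$ is $k$-automatic and an automaton generating it can be computed.
   Context: $k\ge2$. An infinite word $\mathbf{w}$ over a finite alphabet is $k$-automatic if there is a finite automaton that, on input the base-$k$ representation of $n$, outputs $\mathbf{w}[n]$; words are indexed from $0$. A string attractor of a finite word $x=x[0..n-1]$ is a set $S\subseteq\{0,\ldots,n-1\}$ such that every nonempty factor of $x$ has an occurrence $x[p..q]$ with $p\le i\le q$ for some $i\in S$. *)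

(* Defs.v *)
From Stdlib Require Import Reals.
From mathcomp Require Import all_boot.

Set Implicit Arguments.
Unset Strict Implicit.
Unset Printing Implicit Defensive.

(* An infinite word over a finite alphabet is modelled as w : nat -> nat
   (the alphabet is embedded in nat; finiteness comes from automaticity). *)

Definition attractor (w : nat -> nat) (n : nat) (S : {set 'I_n}) : bool :=
  [forall p : 'I_n, forall q : 'I_n, (p <= q) ==>
    [exists p' : 'I_n,
      [&& p' + (q - p) < n,
          [forall j : 'I_n, (j <= q - p) ==> (w (p + j) == w (p' + j))] &
          [exists i in S, (p' <= i) && (i <= p' + (q - p))]]]].
Arguments attractor w n S : clear implicits.

(* gamma_w(n): size of a smallest string attractor of w[0..n-1]
   (the full position set is always an attractor, so the arg min is
   taken over a nonempty family). *)
Definition gamma (w : nat -> nat) (n : nat) : nat :=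
  #|[arg min_(S < [set: 'I_n] | attractor w n S) #|S|]|.

Definition BigTheta (f : nat -> nat) (g : nat -> R) : Prop :=
  exists (c C : R) (N : nat), Rlt 0 c /\
    forall n, N <= n -> Rle (c * g n) (INR (f n)) /\ Rle (INR (f n)) (C * g n).

Definition Theta1 (f : nat -> nat) : Prop := BigTheta f (fun _ => R1).
Definition ThetaLog (f : nat -> nat) : Prop :=
  BigTheta f (fun n => ln (INR n)).

(* A DFAO with states in nat, start state 0, transition table [trans]
   (row q, column = digit d) and output table [outp]; missing entries
   default to 0.  Every such pair of finite tables describes a genuine
   finite-state machine (only finitely many states are reachable). *)
Record DFAO := MkDFAO { trans : seq (seq nat); outp : seq nat }.

Definition delta (A : DFAO) (q d : nat) : nat := nth 0 (nth [::] (trans A) q) d.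
Definition tau (A : DFAO) (q : nat) : nat := nth 0 (outp A) q.

(* least-significant-digit-first base-k digits of n (fuel = n suffices
   for k >= 2); canonical: no leading zeros, empty for n = 0 *)
Fixpoint digits_aux (fuel k n : nat) : seq nat :=
  match fuel with
  | 0 => [::]
  | f.+1 => if n == 0 then [::] else (n %% k) :: digits_aux f k (n %/ k)
  end.

Definition rep (k n : nat) : seq nat := rev (digits_aux n k n).

Definition aut_word (k : nat) (A : DFAO) (n : nat) : nat :=
  tau A (foldl (delta A) 0 (rep k n)).

Definition automatic (k : nat) (w : nat -> nat) : Prop :=
  exists A : DFAO, forall n, w n = aut_word k A n.

(* Goedel code of an automaton (CodeSeq.code : seq nat -> nat is a bijection) *)
Definition codeA (A : DFAO) : nat :=
  CodeSeq.code [:: CodeSeq.code (map CodeSeq.code (trans A));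
                   CodeSeq.code (outp A)].

Inductive prog : Type :=
| PZero : prog
| PSucc : prog
| PProj : nat -> prog
| PComp : prog -> seq prog -> prog
| PRec : prog -> prog -> prog
| PMu : prog -> prog.

Inductive evalp : prog -> seq nat -> nat -> Prop :=
| ev_zero v : evalp PZero v 0
| ev_succ v : evalp PSucc v (head 0 v).+1
| ev_proj i v : evalp (PProj i) v (nth 0 v i)
| ev_comp f gs v ws y : evals gs v ws -> evalp f ws y -> evalp (PComp f gs) v y
| ev_rec0 f g v y : evalp f v y -> evalp (PRec f g) (0 :: v) y
| ev_recS f g n v y z : evalp (PRec f g) (n :: v) y ->
    evalp g (n :: y :: v) z -> evalp (PRec f g) (n.+1 :: v) z
| ev_mu f v n : evalp f (n :: v) 0 ->
    (forall m, m < n -> exists y, evalp f (m :: v) y.+1) ->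
    evalp (PMu f) v n
with evals : seq prog -> seq nat -> seq nat -> Prop :=
| evs_nil v : evals [::] v [::]
| evs_cons g gs v y ys : evalp g v y -> evals gs v ys -> evals (g :: gs) v (y :: ys).

(* Main.v *)
(* Let w be automatic. For a factor f, let H(f) be the set of positions hit by
   some occurrence of f; a string attractor has to meet every H(f). At scale
   u = k^i, every H(f) contains one of boundedly many such sets: the set of
   occurrences of w[s..e) changes only at critical values of s and e, two critical
   values seen in blocks with the same automaton states coincide unless the factor
   is periodic with a short period, and a periodic factor is covered by copies of
   a shorter one with the same period. Hence, up to a constant,
   gamma(n) is the number of points needed to meet D requirements R_j(k^i, x) at
   each of the log n scales, and each R_j is recognized by an automaton.

   Fix j and a residue class of scales. If one point meets R_j at many of these
   scales, then it can be pumped into a point that meets R_j at all of them;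
   otherwise every point serves boundedly many scales and gamma(n) >= c log n.
   This gives (i), with a computable constant in the bounded case. A regular
   predicate that holds for all n < k^(number of states) holds for every n, and
   all numbers of states are computable, so (ii) and (iii) only require finitely
   many values of gamma. *)
Require Import Defs.
From Stdlib Require Import Reals Lra.
From mathcomp Require Import all_boot.
From mathcomp Require Import boolp zify.

Set Implicit Arguments.
Unset Strict Implicit.
Unset Printing Implicit Defensive.

(** Why periods matter: factors whose first and last blocks are given share a common core. Two
    occurrences of the core that start in the same block are less than u apart, so they coincide
    unless the core has a period below u. Only without such a period does the block type determine
    the critical values, and this forces the separate treatment of runs. The requirements must be
    numbered by a first-order rule: covering families chosen independently at each scale would not
    be recognized by one automaton for all scales. Hence the minimal hit sets, the lexicographically
    first factor for each, and ranks among these. No automaton is ever computed from a formula.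
    Closure of recognizability under connectives and quantifiers comes with computable bounds on the
    number of states, so classical choice may be used freely and only the bounds enter the programs.
    The automaton in (iii) is shown to exist and then found by unbounded search, each candidate
    being verified on a finite range for every threshold up to the bound of gamma. *)

(** * Base-k digits and automaton states *)

Lemma digits_aux_fuel k f n : 1 < k -> n <= f ->
  digits_aux f k n = digits_aux n k n.
Proof.
move=> k1; elim/ltn_ind: n f => n IH [|f] nf; first by case: n nf {IH}.
case: n IH nf => [|n] IH nf //=.
have dn : n.+1 %/ k < n.+1 by apply: ltn_Pdiv.
by rewrite (IH _ dn f) ?(IH _ dn n) //; lia.
Qed.

Lemma rep_rec k n : 1 < k -> 0 < n -> rep k n = rcons (rep k (n %/ k)) (n %% k).
Proof.
case: n => // n k1 _; rewrite /rep /= rev_cons digits_aux_fuel //.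
by have := ltn_Pdiv k1 (ltn0Sn n); lia.
Qed.

Definition state k A n := foldl (delta A) 0 (rep k n).

Lemma state_rec k A n : 1 < k -> 0 < n ->
  state k A n = delta A (state k A (n %/ k)) (n %% k).
Proof. by move=> k1 n0; rewrite /state rep_rec // foldl_rcons. Qed.

Lemma state_shift k A n d : 1 < k -> d < k ->
  state k A (k * n + d) =
  if (n == 0) && (d == 0) then 0 else delta A (state k A n) d.
Proof.
move=> k1 dk; case: ifP => [/andP[/eqP-> /eqP->]|h]; first by rewrite muln0.
rewrite state_rec //; last by lia.
by rewrite mulnC divnMDl ?modnMDl ?(divn_small dk) ?addn0 ?modn_small //; lia.
Qed.

Lemma leq_code_mem (s : seq nat) x : x \in s -> x < CodeSeq.code s.
Proof.
elim: s => // y s IH /=; rewrite inE => /orP[/eqP->|/IH h].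
  rewrite (leq_trans (ltn_expl y (ltnSn 1))) // leq_pmulr //.
by rewrite (leq_trans h) // -[X in X <= _]mul1n leq_mul ?expn_gt0 //; lia.
Qed.

Lemma nth_code_le (s : seq nat) i : nth 0 s i <= CodeSeq.code s.
Proof.
case: (ltnP i (size s)) => h; last by rewrite nth_default.
by apply/ltnW/leq_code_mem/mem_nth.
Qed.

Lemma delta_le_code A q d : delta A q d <= codeA A.
Proof.
rewrite /delta (leq_trans (nth_code_le _ _)) // /codeA.
apply: (@leq_trans (CodeSeq.code (map CodeSeq.code (trans A)))); last first.
  by apply/ltnW/leq_code_mem; rewrite inE eqxx.
have -> : CodeSeq.code (nth [::] (trans A) q) = nth 0 (map CodeSeq.code (trans A)) q.
  case: (ltnP q (size (trans A))) => h; first by rewrite (nth_map [::]).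
  by rewrite !nth_default ?size_map.
exact: nth_code_le.
Qed.

Lemma state_le_code k A n : 1 < k -> state k A n <= codeA A.
Proof.
case: n => // n k1; rewrite state_rec //; exact: delta_le_code.
Qed.

(* The flag [n == 0] accounts for leading zeros: they are never read. *)
Definition qstate k A n : 'I_(codeA A).+1 * bool := (inord (state k A n), n == 0).

Definition qstep A (q : 'I_(codeA A).+1 * bool) d : 'I_(codeA A).+1 * bool :=
  if q.2 && (d == 0) then (ord0, true) else (inord (delta A q.1 d), false).

Lemma qstate_shift k A n d : 1 < k -> d < k ->
  qstate k A (k * n + d) = qstep (qstate k A n) d.
Proof.
move=> k1 dk; rewrite /qstate /qstep /= state_shift // inordK ?ltnS ?state_le_code //.
case: ifP => [/andP[/eqP-> /eqP->]|h].
  by rewrite muln0 addn0; congr pair; apply/val_inj; rewrite /= inordK.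
congr pair; lia.
Qed.

Lemma aut_word_qstate k A n : 1 < k -> aut_word k A n = tau A (qstate k A n).1.
Proof. by move=> k1; rewrite /qstate /= inordK // ltnS state_le_code. Qed.

Section Shift.
Variables (k : nat) (k1 : 1 < k).

Lemma expk_gt0 i : 0 < k ^ i. Proof. by rewrite expn_gt0; lia. Qed.

Lemma shift_expS x i o : x * k ^ i.+1 + o = k * (x * k ^ i + o %/ k) + o %% k.
Proof. by rewrite {1}(divn_eq o k) expnS; lia. Qed.

Lemma ltn_divk i o : o < k ^ i.+1 -> o %/ k < k ^ i.
Proof. by move=> oi; rewrite ltn_divLR ?expnSr -?expnSr //; apply: ltnW. Qed.

Lemma aut_suffix T (f : nat -> T) (g : T -> nat -> T) :
  (forall x d, d < k -> f (k * x + d) = g (f x) d) ->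
  forall i o x y, o < k ^ i -> f x = f y -> f (x * k ^ i + o) = f (y * k ^ i + o).
Proof.
move=> fg i; elim: i => [|i IH] o x y oi fxy.
  by move: oi; rewrite expn0 ltnS leqn0 => /eqP->; rewrite !addn0 !muln1.
have k0 := ltnW k1; rewrite !shift_expS !fg ?ltn_mod //.
congr g; apply: IH => //.
exact: ltn_divk.
Qed.

(** Two of the prefixes [x %/ k ^ j] reach the same class; cutting out the digits between them gives
    a smaller number with the same class. Every finite check below rests on this. *)
Lemma aut_small_witness (T : finType) (f : nat -> T) (g : T -> nat -> T) :
  (forall x d, d < k -> f (k * x + d) = g (f x) d) ->
  forall x, exists2 y, y < k ^ #|T| & f y = f x.
Proof.
move=> fg x; elim/ltn_ind: x => x IH.
case: (ltnP x (k ^ #|T|)) => xk; first by exists x.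
pose h (j : 'I_#|T|.+1) := f (x %/ k ^ j).
have ninj : ~~ injectiveb h.
  by apply/negP => /injectiveP /leq_card; rewrite card_ord ltnn.
have [i [j [ij hij]]] : exists i j : 'I_#|T|.+1, i < j /\ h i = h j.
  case/injectivePn: ninj => i [j ij hij].
  case: (ltngtP i j) => [l|l|/val_inj e]; [by exists i, j|by exists j, i|].
  by rewrite e eqxx in ij.
pose x' := x %/ k ^ j * k ^ i + x %% k ^ i.
have xi : f x = f x'.
  rewrite [in LHS](divn_eq x (k ^ i)); apply: aut_suffix fg _ _ _ _ _ hij.
  by rewrite ltn_mod expk_gt0.
have x'x : x' < x.
  rewrite [X in _ < X](divn_eq x (k ^ i)) ltn_add2r ltn_mul2r expk_gt0 /=.
  have -> : k ^ j = k ^ i * k ^ (j - i) by rewrite -expnD subnKC // ltnW.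
  rewrite divnMA ltn_Pdiv //.
    by apply: (@leq_trans (k ^ 1)); rewrite ?leq_exp2l ?expn1 // subn_gt0.
  rewrite divn_gt0 ?expk_gt0 // (leq_trans _ xk) // leq_exp2l //.
  by rewrite -ltnS.
by have [y yk fy] := IH _ x'x; exists y; rewrite ?fy.
Qed.
End Shift.

(** A block of length [k ^ i] is determined by the state at its index; the finiteness of block types
    comes from here. *)
Lemma aut_block k A i o a b : 1 < k -> o < k ^ i ->
  qstate k A a = qstate k A b ->
  aut_word k A (a * k ^ i + o) = aut_word k A (b * k ^ i + o).
Proof.
move=> k1 oi e; rewrite !aut_word_qstate //.
suff -> : qstate k A (a * k ^ i + o) = qstate k A (b * k ^ i + o) by [].
by apply: (aut_suffix k1 (g := @qstep A)) => // x d dk; exact: qstate_shift.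
Qed.

(** * Recognizable relations *)

Definition env := nat -> nat.
Definition scons (y : nat) (e : env) : env := fun i => if i is j.+1 then e j else y.
Definition shift k (e d : env) : env := fun i => k * e i + d i.

(* [reg k F P]: a finite automaton with at most [F] states, reading the base-[k]
   digits of all variables in parallel (most significant first), recognizes [P].
   Variables are de Bruijn indices, so quantifiers act by [scons]. *)
Definition reg k F (P : env -> Prop) : Prop :=
  exists (T : finType) (cls : env -> T) (step : T -> env -> T) (acc : T -> bool),
    [/\ #|T| <= F,
        forall e d, (forall i, d i < k) -> cls (shift k e d) = step (cls e) d &
        forall e, P e <-> acc (cls e)].

Lemma reg_ext k F P Q : (forall e, P e <-> Q e) -> reg k F P -> reg k F Q.
Proof.
move=> PQ [T [cls [step [acc [TF cs ac]]]]]; exists T, cls, step, acc; split=> // e.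
by rewrite -PQ.
Qed.

Lemma reg_le k F F' P : F <= F' -> reg k F P -> reg k F' P.
Proof.
move=> FF' [T [cls [step [acc [TF cs ac]]]]]; exists T, cls, step, acc; split=> //.
exact: leq_trans FF'.
Qed.

Lemma reg_const k (P : Prop) : reg k 1 (fun _ => P).
Proof.
exists unit, (fun _ => tt), (fun _ _ => tt), (fun _ => `[< P >]); split=> //.
  by rewrite card_unit.
by move=> _; split=> /asboolP.
Qed.

Lemma reg_not k F P : reg k F P -> reg k F (fun e => ~ P e).
Proof.
move=> [T [cls [step [acc [TF cs ac]]]]].
exists T, cls, step, (fun c => ~~ acc c); split=> // e.
by rewrite ac; split=> /negP.
Qed.

Lemma reg_and k F G P Q : reg k F P -> reg k G Q ->
  reg k (F * G) (fun e => P e /\ Q e).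
Proof.
move=> [T [cls [step [acc [TF cs ac]]]]] [T' [cls' [step' [acc' [TF' cs' ac']]]]].
exists (T * T')%type, (fun e => (cls e, cls' e)), (fun c d => (step c.1 d, step' c.2 d)),
  (fun c => acc c.1 && acc' c.2); split.
- by rewrite card_prod leq_mul.
- by move=> e d dk; rewrite cs // cs'.
- by move=> e; rewrite ac ac' /=; split=> /andP.
Qed.

Lemma reg_or k F G P Q : reg k F P -> reg k G Q ->
  reg k (F * G) (fun e => P e \/ Q e).
Proof.
move=> rP rQ; apply: reg_ext (reg_not (reg_and (reg_not rP) (reg_not rQ))) => e.
by split=> [/not_andP[]/contrapT|[]]; tauto.
Qed.

Lemma reg_imp k F G P Q : reg k F P -> reg k G Q ->
  reg k (F * G) (fun e => P e -> Q e).
Proof.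
move=> rP rQ; apply: reg_ext (reg_or (reg_not rP) rQ) => e.
by case: (EM (P e)); tauto.
Qed.

(** Subset construction: the state is the set of classes over all values of the bound variable. As
    [cls] takes numbers and not digit strings, that variable may be longer than the free ones. *)
Lemma reg_ex k F P : 0 < k -> reg k F P ->
  reg k (2 ^ F) (fun e => exists y, P (scons y e)).
Proof.
move=> k0 [T [cls [step [acc [TF cs ac]]]]].
exists {set T}, (fun e => [set c | `[< exists y, cls (scons y e) = c >]]),
  (fun (Z : {set T}) d => [set step p.1 (scons (val p.2) d) | p : T * 'I_k & p.1 \in Z]),
  (fun Z : {set T} => [exists c in Z, acc c]); split.
- by rewrite -(cardsT {set T}) -powersetT card_powerset cardsT leq_exp2l.
- move=> e d dk.
  have shE y (a : 'I_k) : scons (k * y + a) (shift k e d) = shift k (scons y e) (scons a d).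
    by apply/funext => -[].
  have sk (a : 'I_k) i : scons a d i < k by case: i => /=.
  apply/setP => c; rewrite inE; apply/asboolP/imsetP => [[y <-]|[[c' a]]].
    have ak : y %% k < k by rewrite ltn_mod.
    exists (cls (scons (y %/ k) e), Ordinal ak); first by rewrite !inE; apply/asboolP; exists (y %/ k).
    rewrite /= -cs; last exact: (sk (Ordinal ak)).
    by rewrite -(shE _ (Ordinal ak)) /= {1}(divn_eq y k) mulnC.
  rewrite !inE /= => /asboolP[y <-] ->; exists (k * y + a).
  by rewrite -cs ?shE //.
- move=> e; split=> [[y /ac h]|/existsP[c /andP[]]].
    by apply/existsP; exists (cls (scons y e)); rewrite h inE andbT; apply/asboolP; exists y.
  by rewrite inE => /asboolP[y <-] /ac h; exists y.
Qed.

Lemma reg_all k F P : 0 < k -> reg k F P ->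
  reg k (2 ^ F) (fun e => forall y, P (scons y e)).
Proof.
move=> k0 rP; apply: reg_ext (reg_not (reg_ex k0 (reg_not rP))) => e.
split=> [/forallNP h y|h [y]]; last by apply.
by apply: contrapT; apply: h.
Qed.

Lemma reg_leq k i j : reg k 3 (fun e => e i <= e j).
Proof.
pose c (x y : nat) : 'I_3 := if x < y then inord 0 else if x == y then inord 1 else inord 2.
exists 'I_3, (fun e => c (e i) (e j)),
  (fun t d => if t == inord 1 then c (d i) (d j) else t), (fun t => t != inord 2).
have nE a b : a < 3 -> b < 3 -> ((inord a : 'I_3) == inord b) = (a == b).
  by move=> a3 b3; rewrite -val_eqE /= !inordK.
split=> [|e d dk|e]; first by rewrite card_ord.
  rewrite /shift /c; move: (dk i) (dk j).
  move: (d i) (d j) (e i) (e j) => a b x y ak bk.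
  case: (ltngtP x y) => h; rewrite nE //=.
  - suff -> : k * x + a < k * y + b by [].
    have : k * x.+1 <= k * y by rewrite leq_mul2l h orbT.
    by lia.
  - have hh : k * y.+1 <= k * x by rewrite leq_mul2l h orbT.
    have -> : (k * x + a < k * y + b) = false by lia.
    by have -> : (k * x + a == k * y + b) = false by lia.
  - by rewrite h ltn_add2l eqn_add2l.
rewrite /c; case: ltngtP => _; rewrite nE //.
Qed.

Lemma reg_ltn k i j : reg k 3 (fun e => e i < e j).
Proof.
by apply: reg_ext (reg_not (reg_leq k j i)) => e; rewrite ltnNge; split=> /negP.
Qed.

Lemma reg_eq k i j : reg k 9 (fun e => e i = e j).
Proof.
apply: reg_ext (reg_and (reg_leq k i j) (reg_leq k j i)) => e.
by split=> [[h1 h2]|->//]; apply/eqP; rewrite eqn_leq h1 h2.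
Qed.

(* The classes of [z - (x + y)] are [<0], [0], [1] and [>1]: only [0] and [1]
   can still become [0] when one more digit is read. *)
Lemma reg_add k i j l : reg k 4 (fun e => e i + e j = e l).
Proof.
pose c (s z : nat) : 'I_4 :=
  if z < s then inord 2 else if z == s then inord 0 else if z == s.+1 then inord 1 else inord 3.
exists 'I_4, (fun e => c (e i + e j) (e l)),
  (fun t d => if t == inord 0 then c (d i + d j) (d l) else
              if t == inord 1 then c (d i + d j) (k + d l) else t), (fun t => t == inord 0).
have nE a b : a < 4 -> b < 4 -> ((inord a : 'I_4) == inord b) = (a == b).
  by move=> a3 b3; rewrite -val_eqE /= !inordK.
split=> [|e d dk|e]; first by rewrite card_ord.
  rewrite /shift; move: (dk i) (dk j) (dk l).
  move: (d i) (d j) (d l) (e i) (e j) (e l) => a b t x y z ak bk tk.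
  have -> : k * x + a + (k * y + b) = k * (x + y) + (a + b) by rewrite mulnDr; lia.
  have rk : (a + b).+2 <= k + k by lia.
  move: (x + y) (a + b) rk => s r rk.
  rewrite /c; case: (ltngtP z s) => h; rewrite ?nE //=.
  - have hh : k * z.+1 <= k * s by rewrite leq_mul2l h orbT.
    by have -> : k * z + t < k * s + r by lia.
  - case: (ltngtP z s.+1) h => // h _; rewrite ?nE //=.
      have hh : k * s.+2 <= k * z by rewrite leq_mul2l h orbT.
      have -> : (k * z + t < k * s + r) = false by lia.
      have -> : (k * z + t == k * s + r) = false by lia.
      by have -> : (k * z + t == (k * s + r).+1) = false by lia.
    rewrite h mulnS.
    have -> : (k + k * s + t < k * s + r) = (k + t < r) by lia.
    have -> : (k + k * s + t == k * s + r) = (k + t == r) by lia.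
    by have -> : (k + k * s + t == (k * s + r).+1) = (k + t == r.+1) by lia.
  - rewrite h ltn_add2l eqn_add2l.
    by have -> : (k * s + t == (k * s + r).+1) = (t == r.+1) by lia.
rewrite /c; case: (ltngtP (e l) (e i + e j)) => h; rewrite ?nE //=; try by split=> //; lia.
by case: ifP => _; rewrite nE //=; split=> //; lia.
Qed.

Lemma reg_word k A i j : 1 < k ->
  reg k (((codeA A).+1 * 2) * ((codeA A).+1 * 2))
    (fun e => aut_word k A (e i) = aut_word k A (e j)).
Proof.
move=> k1; pose Q : finType := ('I_(codeA A).+1 * bool)%type.
exists (Q * Q)%type, (fun e => (qstate k A (e i), qstate k A (e j))),
  (fun (c : Q * Q) d => (qstep c.1 (d i), qstep c.2 (d j))),
  (fun c : Q * Q => tau A (val c.1.1) == tau A (val c.2.1)); split.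
- by rewrite !card_prod card_ord card_bool.
- by move=> e d dk; rewrite /shift !qstate_shift.
- by move=> e; rewrite !aut_word_qstate //; split=> [->|/eqP].
Qed.

(* Reading [s], [a] and [u] in parallel, [a] copies [s] up to the only nonzero
   digit of [u] and is zero afterwards. *)
Definition is_floor k u s a := exists2 i, u = k ^ i & a = s %/ u * u.

Lemma reg_floor k i j l : 1 < k -> reg k 3 (fun e => is_floor k (e i) (e j) (e l)).
Proof.
move=> k1.
pose c (u s a : nat) : 'I_3 :=
  if (u == 0) && (a == s) then inord 0 else
  if `[< is_floor k u s a >] then inord 1 else inord 2.
exists 'I_3, (fun e => c (e i) (e j) (e l)),
  (fun t d => if t == inord 0 then
                if d j == d l then if d i == 0 then inord 0 else
                                   if d i == 1 then inord 1 else inord 2 else inord 2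
              else if t == inord 1 then
                if (d i == 0) && (d l == 0) then inord 1 else inord 2 else t),
  (fun t => t == inord 1).
have nE a b : a < 3 -> b < 3 -> ((inord a : 'I_3) == inord b) = (a == b).
  by move=> a3 b3; rewrite -val_eqE /= !inordK.
have k0 := ltnW k1.
have fl_pos u s a : is_floor k u s a -> 0 < u.
  by move=> [m -> _]; rewrite expk_gt0.
split=> [|e d dk|e]; first by rewrite card_ord.
  rewrite /shift; move: (dk i) (dk j) (dk l).
  move: (d i) (d j) (d l) (e i) (e j) (e l) => du ds da u s a duk dsk dak.
  (* A new digit either extends a floor by zeros in [u] and [a], or creates one: [u] becomes 1 while
     [a] still copies [s]. *)
  have flS : is_floor k (k * u + du) (k * s + ds) (k * a + da) <->
    (is_floor k u s a /\ du = 0 /\ da = 0) \/ (u = 0 /\ a = s /\ du = 1 /\ ds = da).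
    split.
      case=> -[|m] um am.
        right; move: am; rewrite um expn0 divn1 muln1 => am.
        have u0 : u = 0 by move: um; rewrite expn0; case: u => // u; rewrite mulnS; lia.
        rewrite u0 muln0 expn0 in um.
        have : (k * a + da) %% k = (k * s + ds) %% k by rewrite am.
        rewrite !(mulnC k) !modnMDl !modn_small // => dd.
        split=> //; split; last by split.
        have : (k * a + da) %/ k = (k * s + ds) %/ k by rewrite am.
        by rewrite !(mulnC k) !divnMDl // !divn_small // !addn0.
      left; move: (um); rewrite expnS => um'.
      have d0 : du = 0.
        have : (k * u + du) %% k = 0 by rewrite um' modnMr.
        by rewrite mulnC modnMDl modn_small.
      have ue : u = k ^ m.
        move/eqP: um'; rewrite d0 addn0 eqn_mul2l; lia.
      have qs : (k * s + ds) %/ k = s by rewrite mulnC divnMDl // divn_small // addn0.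
      rewrite um' divnMA qs mulnCA in am.
      have d0' : da = 0.
        have : (k * a + da) %% k = 0 by rewrite am modnMr.
        by rewrite mulnC modnMDl modn_small.
      split=> //; exists m => //; rewrite ue.
      by apply/eqP; rewrite -(eqn_pmul2l k0) -am d0' addn0.
    case=> [[[m um am] [-> ->]]|[-> [-> [-> ->]]]].
      exists m.+1; first by rewrite um expnS addn0.
      by rewrite !addn0 divnMA [k * s]mulnC divnMDl // (divn_small dsk) addn0 {1}am mulnCA.
    by exists 0; rewrite ?muln0 ?expn0 // divn1 muln1.
  rewrite {1}/c; case: (boolP ((u == 0) && (a == s))) => [/andP[/eqP u0 /eqP as_]|h0].
    subst u a; rewrite muln0 add0n in flS *.
    have nf : ~ is_floor k 0 s s by move/fl_pos.
    rewrite eqn_add2l [da == ds]eq_sym /c !eqxx /= ?nE //=.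
    case: (eqVneq ds da) => [e1|/eqP e1]; last first.
      by rewrite andbF; case: asboolP => // /flS[[/nf]|[_ [_ [_ /e1]]]].
    subst da; rewrite andbT; case: (eqVneq du 0) => [//|d0].
    case: (eqVneq du 1) => [d1|/eqP d1].
      by case: asboolP => // -[]; apply/flS; right.
    by case: asboolP => //; move=> /flS[[/nf]|[_ [_ [/d1]]]].
  rewrite {1}/c [in RHS]/c (negbTE h0).
  have -> : (k * u + du == 0) && (k * a + da == k * s + ds) =
     [&& u == 0, du == 0, a == s & da == ds].
    apply/andP/and4P => [[h1 /eqP h2]|[/eqP-> /eqP-> /eqP-> /eqP->]]; last by rewrite muln0.
    move: h1; rewrite addn_eq0 muln_eq0 (gtn_eqF k0) /= => /andP[-> ->].
    split=> //; apply/eqP.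
      have : (k * a + da) %/ k = (k * s + ds) %/ k by rewrite h2.
      by rewrite !(mulnC k) !divnMDl // !divn_small // !addn0.
    have : (k * a + da) %% k = (k * s + ds) %% k by rewrite h2.
    by rewrite !(mulnC k) !modnMDl !modn_small.
  case: ifP => [/and4P[u0 _ as_ _]|_]; first by rewrite u0 as_ in h0.
  case: (asboolP (is_floor k u s a)) => hf.
    rewrite !nE //=; case: asboolP => [/flS|nf].
      case=> [[_ [-> ->]]//|[u0 [as_ _]]]; by rewrite u0 as_ !eqxx in h0.
    case: ifP => // /andP[/eqP d0 /eqP d0']; case: nf; apply/flS; by left.
  rewrite !nE //=; case: asboolP => // /flS[[]//|[u0 [as_ _]]].
  by rewrite u0 as_ !eqxx in h0.
rewrite /c; split=> [/[dup] /fl_pos|].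
  by rewrite lt0n => /negbTE-> /= h; rewrite ifT //; apply/asboolP.
case: ifP => _; first by rewrite nE.
by case: asboolP => // _; rewrite nE.
Qed.

Lemma reg_rename k F P (rho : nat -> nat) : reg k F P -> reg k F (fun e => P (fun i => e (rho i))).
Proof.
move=> [T [cls [step [acc [TF cs ac]]]]].
exists T, (fun e => cls (fun i => e (rho i))), (fun c d => step c (fun i => d (rho i))), acc.
by split=> // e d dk; rewrite -cs.
Qed.

(* The state is [v - k * u] as long as it can still become [0]. *)
Lemma reg_mulk k i j : 1 < k -> reg k k.+1 (fun e => e j = k * e i).
Proof.
move=> k1; have k0 := ltnW k1.
pose c (u v : nat) : 'I_k.+1 := if k * u <= v then inord (minn (v - k * u) k) else ord_max.
exists 'I_k.+1, (fun e => c (e i) (e j)),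
  (fun (t : 'I_k.+1) d => if (val t < k) && (val t == d i) then inord (d j) else ord_max),
  (fun t : 'I_k.+1 => val t == 0).
have cE u v : c u v = (if k * u <= v then minn (v - k * u) k else k) :> nat.
  by rewrite /c; case: ifP => // _; rewrite inordK // ltnS geq_minr.
split=> [|e d dk|e]; first by rewrite card_ord.
  rewrite /shift; move: (dk i) (dk j) => ak bk; apply/val_inj.
  move: (d i) (d j) (e i) (e j) ak bk => a b u v ak bk.
  rewrite /= cE cE; case: (leqP (k * u) v) => h; last first.
    have : k * v.+1 <= k * (k * u) by rewrite leq_mul2l h orbT.
    rewrite mulnS mulnDr => hh; have -> : (k * (k * u) + k * a <= k * v + b) = false.
      by clear -hh bk; lia.
    by rewrite ltnn.
  have [r vE] : exists r, v = k * u + r by exists (v - k * u); clear -h; lia.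
  rewrite {h}vE addKn.
  have -> : k * (k * u + r) + b = k * (k * u) + (k * r + b) by rewrite mulnDr addnA.
  rewrite mulnDr leq_add2l subnDl.
  case: (ltngtP r k) => rk; last 2 first.
  - rewrite ltnn /=.
    have : k * k.+1 <= k * r by rewrite leq_mul2l rk orbT.
    have : k * a.+1 <= k * k by rewrite leq_mul2l ak orbT.
    rewrite !mulnS => h1 h2; have h3 : k * a + k <= k * r + b by clear -h1 h2; lia.
    by case: ifP => // _; clear -h3; lia.
  - rewrite rk ?minnn ltnn /=.
    have : k * a.+1 <= k * k by rewrite leq_mul2l ak orbT.
    rewrite !mulnS => h1; have h3 : k * a + k <= k * k + b by clear -h1; lia.
    by case: ifP => // _; clear -h3; lia.
  rewrite ?rk /=; case: (ltngtP r a) => h.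
  - have : k * r.+1 <= k * a by rewrite leq_mul2l h orbT.
    rewrite mulnS => h1; have -> // : (k * a <= k * r + b) = false.
    by clear -h1 bk; lia.
  - have : k * a.+1 <= k * r by rewrite leq_mul2l h orbT.
    rewrite mulnS => h1; have h3 : k * a + k <= k * r + b by clear -h1; lia.
    by rewrite /=; case: ifP => // _; clear -h3; lia.
  - rewrite h leq_addr addKn inordK ?ltnS ?(ltnW bk) //; exact/minn_idPl/ltnW.
rewrite /= cE; case: (leqP (k * e i) (e j)) => h; last by split=> //; clear -h k0; lia.
by split=> [->|]; [rewrite subnn min0n|clear -h k0; lia].
Qed.

(** * Critical starts and ends of factors *)

Lemma size_le_card (T : eqType) (K : finType) (s : seq T) (f : T -> K) :
  uniq s -> {in s &, injective f} -> size s <= #|K|.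
Proof.
move=> us fi; rewrite -(size_map f).
have u : uniq (map f s) by rewrite map_inj_in_uniq.
by rewrite -(card_uniqP u) max_card.
Qed.

Section Occurrences.
Variable w : nat -> nat.

Definition occ s e p := forall j, j < e - s -> w (p + j) = w (s + j).
Definition hit s e x := exists p, [/\ p <= x, x < p + (e - s) & occ s e p].
Definition hit_sub s e s' e' := forall x, hit s e x -> hit s' e' x.

(* For a core [c0, c1) occurring at [q], [lmatch q y] says that this occurrence
   agrees with the original one at the earlier position [y < c0]. A start [s] is
   critical when some occurrence of the core extends to the left exactly down to
   [s + 1]; between two critical starts the set of occurrences does not change. *)
Section Core.
Variables c0 c1 : nat.

Definition lmatch q y := c0 <= q + y /\ w (q + y - c0) = w y.
Definition lcrit q s :=
  [/\ occ c0 c1 q, forall y, s < y < c0 -> lmatch q y & ~ lmatch q s].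
Definition rcrit q z :=
  [/\ occ c0 c1 q, forall y, c1 <= y < z -> w (q + y - c0) = w y &
      w (q + z - c0) <> w z].

(** Extend the occurrence to the left letter by letter: the first mismatch would be at a critical
    start. *)
Lemma shrink_left s s' e : s <= s' <= c0 -> c1 <= e -> c0 <= c1 ->
  (forall y q, s <= y < s' -> ~ lcrit q y) -> hit_sub s' e s e.
Proof.
move=> /andP[ss' s'c] c1e c01 nl x [p [px xp op]].
pose q := p + (c0 - s').
have oq : occ c0 c1 q.
  move=> j jc; have := op (c0 - s' + j).
  by rewrite /q -addnA => -> ; [congr w|]; lia.
have lm y : s <= y < c0 -> lmatch q y.
  move=> /andP[sy yc]; have [n cn] : exists n, c0 = y + n by exists (c0 - y); lia.
  elim/ltn_ind: n y cn sy yc => n IH y cn sy yc.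
  case: (leqP s' y) => ys'.
    split; first by rewrite /q; lia.
    have -> : q + y - c0 = p + (y - s') by rewrite /q; lia.
    by rewrite op; [congr w|]; lia.
  apply: contrapT => nm; apply: (nl y q); first by lia.
  split=> // y' /andP[yy' y'c]; apply: (IH (c0 - y')); lia.
have [sc|sc] := ltnP s c0; last first.
  have -> : s = s' by lia.
  by exists p.
have [cq _] := lm s (ltac:(lia)).
exists (q + s - c0); split; try by rewrite /q in cq *; lia.
move=> j js; case: (ltnP (s + j) c0) => sj.
  have [h1 h2] := lm (s + j) (ltac:(lia)).
  by rewrite -h2; congr w; lia.
have -> : q + s - c0 + j = p + (s + j - s') by rewrite /q; lia.
by rewrite op; [congr w|]; lia.
Qed.

Lemma shrink_right s e e' : s <= c0 -> c1 <= e' <= e -> c0 <= c1 ->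
  (forall z q, e' <= z < e -> ~ rcrit q z) -> hit_sub s e' s e.
Proof.
move=> sc /andP[ce' e'e] c01 nr x [p [px xp op]]; exists p; split=> //; first by lia.
pose q := p + (c0 - s).
have oq : occ c0 c1 q.
  move=> j jc; have := op (c0 - s + j).
  by rewrite /q -addnA => -> ; [congr w|]; lia.
have rm z : c1 <= z < e -> w (q + z - c0) = w z.
  elim/ltn_ind: z => z IH /andP[cz ze].
  case: (ltnP z e') => ze'.
    have -> : q + z - c0 = p + (z - s) by rewrite /q; lia.
    by rewrite op; [congr w|]; lia.
  apply: contrapT => nm; apply: (nr z q); first by lia.
  by split=> // y /andP[cy yz]; apply: IH; lia.
move=> j js; case: (ltnP (s + j) c1) => sj.
  by apply: op; lia.
rewrite -(rm (s + j)); first by congr w; rewrite /q; lia.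
lia.
Qed.

End Core.

Variables (u J : nat) (K : finType) (ty : nat -> K).
Hypothesis u0 : 0 < u.
Hypothesis tyP : forall a b o, ty a = ty b -> o < J * u -> w (a * u + o) = w (b * u + o).

(** At most [u] letters left of the core are read, so a critical start depends only on the type of
    the block preceding that of [q]. The boolean separates the occurrences in block 0, which have no
    block before them. *)
Lemma lcrit_count c0 c1 lo hi : lo <= hi <= c0 -> c0 <= c1 -> c0 <= lo + u ->
  c1 + 2 * u <= c0 + J * u ->
  (forall q q' s s', q %/ u = q' %/ u -> lo <= s < hi -> lo <= s' < hi ->
     lcrit c0 c1 q s -> lcrit c0 c1 q' s' -> s = s') ->
  exists l : seq nat, [/\ size l <= 2 * #|K|, forall y, y \in l -> lo <= y < hi &
    forall y q, lo <= y < hi -> lcrit c0 c1 q y -> y \in l].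
Proof.
move=> /andP[lohi hic] c01 clo cJ un.
pose P y q := lcrit c0 c1 q y.
pose l := [seq y <- iota lo (hi - lo) | `[< exists q, P y q >]].
have lP y : y \in l -> exists q, P y q.
  by rewrite mem_filter => /andP[/asboolP].
have lr y : y \in l -> lo <= y < hi.
  rewrite mem_filter mem_iota => /andP[_]; lia.
exists l; split=> //; last first.
  move=> y q yr h; rewrite mem_filter mem_iota; apply/andP; split; last by lia.
  by apply/asboolP; exists q.
have [qf qP] : {qf & forall y, y \in l -> P y (qf y)}.
  apply: (@choice _ _ (fun y q => y \in l -> P y q)) => y.
  by case: (boolP (y \in l)) => [/lP[q h]|]; [exists q|exists 0].
pose key y : bool * K := (qf y < u, ty (qf y %/ u).-1).
have -> : 2 * #|K| = #|{: bool * K}| by rewrite card_prod card_bool.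
apply: (@size_le_card _ _ _ key); first by rewrite filter_uniq ?iota_uniq.
move=> s s' sl s'l [k1 k2]; have := qP _ s'l; have := qP _ sl.
move: (lr _ sl) (lr _ s'l) k1 k2; move: (qf s) (qf s') => q q' sr s'r k1 k2 h h'.
case: (ltnP q u) k1 => [qu /esym q'u|uq /esym uq'].
  by apply: (un q q') => //; rewrite !divn_small.
have uq1 : 0 < q %/ u by rewrite divn_gt0.
have uq1' : 0 < q' %/ u by rewrite divn_gt0 // leqNgt uq'.
pose a := (q %/ u).-1; pose b := (q' %/ u).-1; pose r := q' %% u.
have ru : r < u by rewrite ltn_mod.
have q'E : q' = b * u + (u + r).
  by rewrite {1}(divn_eq q' u) /b -{1}(prednK uq1') mulSn /r; lia.
(* The occurrence at [q'] is copied to the same offset in the block of [q]; the preceding blocks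
   have equal types, so the mismatch is copied too. *)
pose q'' := a * u + (u + r).
have q''u : q %/ u = q'' %/ u.
  by rewrite /q'' addnA -mulSnr divnMDl // (divn_small ru) addn0 prednK.
have tr y : c0 <= y + u -> y < c1 -> w (q'' + y - c0) = w (q' + y - c0).
  move=> cy yc; rewrite q'E /q''.
  have -> : a * u + (u + r) + y - c0 = a * u + (u + r + y - c0) by lia.
  have -> : b * u + (u + r) + y - c0 = b * u + (u + r + y - c0) by lia.
  by apply: tyP => //; lia.
apply: (un q q'') => //; case: h' => oq' lq' nq'; split.
- move=> j jc; rewrite -oq' //; have := tr (c0 + j).
  have -> : q'' + (c0 + j) - c0 = q'' + j by lia.
  have -> : q' + (c0 + j) - c0 = q' + j by lia.
  apply; lia.
- move=> y yr; have [_ hm] := lq' y yr; split; first by rewrite /q''; lia.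
  by rewrite tr //; lia.
- case=> _ e; apply: nq'; split; first by lia.
  by rewrite -e tr //; lia.
Qed.

(** Only letters from the core on are read, so the type of the block of [q] is the key. *)
Lemma rcrit_count c0 c1 lo hi : c0 <= c1 <= lo -> hi + u <= c0 + J * u ->
  (forall q q' z z', q %/ u = q' %/ u -> lo <= z < hi -> lo <= z' < hi ->
     rcrit c0 c1 q z -> rcrit c0 c1 q' z' -> z = z') ->
  exists l : seq nat, [/\ size l <= #|K|, forall y, y \in l -> lo <= y < hi &
    forall y q, lo <= y < hi -> rcrit c0 c1 q y -> y \in l].
Proof.
move=> /andP[c01 c1lo] hJ un.
pose P y q := rcrit c0 c1 q y.
pose l := [seq y <- iota lo (hi - lo) | `[< exists q, P y q >]].
have lP y : y \in l -> exists q, P y q.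
  by rewrite mem_filter => /andP[/asboolP].
have lr y : y \in l -> lo <= y < hi.
  rewrite mem_filter mem_iota => /andP[_]; lia.
exists l; split=> //; last first.
  move=> y q yr h; rewrite mem_filter mem_iota; apply/andP; split; last by lia.
  by apply/asboolP; exists q.
have [qf qP] : {qf & forall y, y \in l -> P y (qf y)}.
  apply: (@choice _ _ (fun y q => y \in l -> P y q)) => y.
  by case: (boolP (y \in l)) => [/lP[q h]|]; [exists q|exists 0].
apply: (@size_le_card _ _ _ (fun y => ty (qf y %/ u))); first by rewrite filter_uniq ?iota_uniq.
move=> s s' sl s'l k2; have := qP _ s'l; have := qP _ sl.
move: (lr _ sl) (lr _ s'l) k2; move: (qf s) (qf s') => q q' sr s'r k2 h h'.
pose r := q' %% u; have ru : r < u by rewrite ltn_mod.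
pose q'' := q %/ u * u + r.
have q''u : q %/ u = q'' %/ u by rewrite /q'' divnMDl // (divn_small ru) addn0.
have tr y : c0 <= y -> y < hi -> w (q'' + y - c0) = w (q' + y - c0).
  move=> cy yc; rewrite (divn_eq q' u) /q'' -/r.
  have -> : q %/ u * u + r + y - c0 = q %/ u * u + (r + y - c0) by lia.
  have -> : q' %/ u * u + r + y - c0 = q' %/ u * u + (r + y - c0) by lia.
  by apply: tyP => //; lia.
apply: (un q q'') => //; case: h' => oq' lq' nq'; split.
- move=> j jc; rewrite -oq' //; have := tr (c0 + j).
  have -> : q'' + (c0 + j) - c0 = q'' + j by lia.
  have -> : q' + (c0 + j) - c0 = q' + j by lia.
  apply; lia.
- by move=> y yr; rewrite tr ?lq' //; lia.
- by rewrite tr //; lia.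
Qed.

(** Rounding [s] up to the next critical start, and [e] down to just after the last critical end,
    only shrinks the set of hit positions. The extra candidates [hi] and [lo'] serve when there is
    no critical value. *)
Lemma critical_family c0 c1 lo hi lo' hi' :
  lo <= hi <= c0 -> c0 <= c1 <= lo' -> lo' <= hi' ->
  c0 <= lo + u -> hi' + 2 * u <= c0 + J * u ->
  (forall q q' s s', q %/ u = q' %/ u -> lo <= s < hi -> lo <= s' < hi ->
     lcrit c0 c1 q s -> lcrit c0 c1 q' s' -> s = s') ->
  (forall q q' z z', q %/ u = q' %/ u -> lo' <= z < hi' -> lo' <= z' < hi' ->
     rcrit c0 c1 q z -> rcrit c0 c1 q' z' -> z = z') ->
  exists l : seq (nat * nat), [/\ size l <= (2 * #|K|).+1 * #|K|.+1,
    forall g, g \in l -> lo <= g.1 <= hi /\ lo' <= g.2 <= hi' &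
    forall s e, lo <= s <= hi -> lo' <= e <= hi' ->
      exists2 g, g \in l & hit_sub g.1 g.2 s e].
Proof.
move=> lohi /andP[c01 c1lo] lohi' clo hJ unl unr.
have [ll [sll rll cll]] := @lcrit_count c0 c1 lo hi lohi c01 clo (ltac:(lia)) unl.
have c01l : c0 <= c1 <= lo' by lia.
have [lr [slr rlr clr]] := @rcrit_count c0 c1 lo' hi' c01l (ltac:(lia)) unr.
exists [seq (x, y) | x <- hi :: ll, y <- lo' :: map S lr]; split.
- by rewrite size_allpairs /= size_map leq_mul.
- move=> g /allpairsP[[x y] [/= xl yl ->]] /=; split.
    by move: xl; rewrite inE => /orP[/eqP->|/rll]; lia.
  move: yl; rewrite inE => /orP[/eqP->|/mapP[z /rlr zl ->]]; lia.
- move=> s e sr er.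
  have [s' [s'l ss' ns']] : exists s', [/\ s' \in hi :: ll, s <= s' <= hi &
      forall y q, s <= y < s' -> ~ lcrit c0 c1 q y].
    case: (EM (exists y, (y \in ll) && (s <= y))) => [ex|nex].
      case: (ex_minnP ex) => s' /andP[s'l ss'] min.
      exists s'; split; first by rewrite inE s'l orbT.
        by have := rll _ s'l; lia.
      move=> y q yr h; have := min y; rewrite (cll y q) //; last by have := rll _ s'l; lia.
      by move=> /(_ (ltac:(lia))); lia.
    exists hi; split; [by rewrite inE eqxx|by lia|].
    move=> y q yr h; apply: nex; exists y; rewrite (cll y q) //; lia.
  have [e' [e'l ee' ne']] : exists e', [/\ e' \in lo' :: map S lr, lo' <= e' <= e &
      forall z q, e' <= z < e -> ~ rcrit c0 c1 q z].
    case: (EM (exists y, (y \in lr) && (y < e))) => [ex|nex].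
      have ub y : (y \in lr) && (y < e) -> y <= e by lia.
      case: (ex_maxnP ex ub) => z /andP[zl ze] max.
      (* A critical end [z] is a mismatch at the letter [z], so the factor must include that
         letter. *)
      exists z.+1; split; first by rewrite inE map_f ?orbT.
        by have := rlr _ zl; lia.
      move=> y q yr h; have := max y; rewrite (clr y q) //; last by have := rlr _ zl; lia.
      by move=> /(_ (ltac:(lia))); lia.
    exists lo'; split; [by rewrite inE eqxx|by lia|].
    move=> y q yr h; apply: nex; exists y; rewrite (clr y q) //; lia.
  exists (s', e'); first by apply/allpairsP; exists (s', e').
  move=> x /= h.
  apply: (@shrink_left c0 c1 s s' e) => //; try by lia.
  apply: (@shrink_right c0 c1 s' e e') => //; lia.
Qed.

End Occurrences.

(** * Factors with given first and last block *)

Section Cells.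
Variables (w : nat -> nat) (u J : nat) (K : finType) (ty : nat -> K).
Hypothesis u0 : 0 < u.
Hypothesis tyP : forall a b o, ty a = ty b -> o < J * u -> w (a * u + o) = w (b * u + o).

Definition periodic a b d := forall y, a <= y -> y + d < b -> w y = w (y + d).

Lemma same_block q q' : q %/ u = q' %/ u -> q < q' + u.
Proof.
move=> e; have := ltn_mod q u; have := leq_trunc_div q' u.
rewrite {2}(divn_eq q u) e u0; lia.
Qed.

Lemma lcrit_match c0 c1 q s y : lcrit w c0 c1 q s -> s < y < c1 ->
  c0 <= q + y /\ w (q + y - c0) = w y.
Proof.
move=> [oq lm _] yr; case: (ltnP y c0) => yc; first by apply: lm; lia.
split; first by lia.
have -> : q + y - c0 = q + (y - c0) by lia.
by rewrite oq; [congr w|]; lia.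
Qed.

Lemma rcrit_match c0 c1 q z y : rcrit w c0 c1 q z -> c0 <= y < z ->
  w (q + y - c0) = w y.
Proof.
move=> [oq rm _] yr; case: (ltnP y c1) => yc; last by apply: rm; lia.
have -> : q + y - c0 = q + (y - c0) by lia.
by rewrite oq; [congr w|]; lia.
Qed.

Lemma occ_periodic c0 c1 q q' : q <= q' -> occ w c0 c1 q -> occ w c0 c1 q' ->
  periodic c0 c1 (q' - q).
Proof.
move=> qq oq oq' y cy yc; have := oq (y + (q' - q) - c0) (ltac:(lia)).
have := oq' (y - c0) (ltac:(lia)).
have -> : c0 + (y - c0) = y by lia.
have -> : c0 + (y + (q' - q) - c0) = y + (q' - q) by lia.
have -> : q + (y + (q' - q) - c0) = q' + (y - c0) by lia.
by move=> -> ->.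
Qed.

(** Two occurrences starting in one block are less than [u] apart, and their distance is a period of
    the core. *)
Lemma aperiodic_occ c0 c1 q q' : (forall d, 0 < d < u -> ~ periodic c0 c1 d) ->
  q %/ u = q' %/ u -> occ w c0 c1 q -> occ w c0 c1 q' -> q = q'.
Proof.
move=> np e oq oq'; have := same_block e; have := same_block (esym e) => h1 h2.
case: (ltngtP q q') => // l.
  by case: (np (q' - q) (ltac:(lia))); apply: occ_periodic => //; apply: ltnW.
by case: (np (q - q') (ltac:(lia))); apply: occ_periodic => //; apply: ltnW.
Qed.

Let M := (2 * #|K|).+1 * #|K|.+1.

Lemma aperiodic_family c0 c1 lo hi lo' hi' :
  lo <= hi <= c0 -> c0 <= c1 <= lo' -> lo' <= hi' ->
  c0 <= lo + u -> hi' + 2 * u <= c0 + J * u ->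
  (forall d, 0 < d < u -> ~ periodic c0 c1 d) ->
  exists l : seq (nat * nat), [/\ size l <= M,
    forall g, g \in l -> lo <= g.1 <= hi /\ lo' <= g.2 <= hi' &
    forall s e, lo <= s <= hi -> lo' <= e <= hi' ->
      exists2 g, g \in l & hit_sub w g.1 g.2 s e].
Proof.
move=> h1 h2 h3 h4 h5 np.
apply: (critical_family u0 tyP h1 h2 h3 h4 h5) => q q' s s' qq sr sr' [oq m n] [oq' m' n'].
- have e := aperiodic_occ np qq oq oq'; rewrite -e in m' n'.
  case: (ltngtP s s') => // l.
    by case: n'; apply: m; lia.
  by case: n; apply: m'; lia.
- have e := aperiodic_occ np qq oq oq'; rewrite -e in m' n'.
  case: (ltngtP s s') => // l.
    by case: n; apply: m'; lia.
  by case: n'; apply: m; lia.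
Qed.

(** The run of period [p] through the occurrence at [q] breaks off on the left at [q + s - c0], or
    at the start of the word. Were the second break further right, the first occurrence would match
    there, and comparison with the letter [p] further on would remove the break. *)
Lemma lcrit_order A B p c0 c1 q1 q2 s1 s2 :
  periodic A B p -> 0 < p < u -> c1 <= B -> c0 + 2 * u <= c1 ->
  lcrit w c0 c1 q1 s1 -> lcrit w c0 c1 q2 s2 ->
  A <= s1 < c0 -> A <= s2 < c0 -> q2 < q1 + u -> q2 + s2 <= q1 + s1.
Proof.
move=> per /andP[p0 pu] cB c01 l1 l2 /andP[As1 s1c] /andP[As2 s2c] qu.
rewrite leqNgt; apply/negP => lt.
have m1 y : s1 < y -> y < c1 -> c0 <= q1 + y /\ w (q1 + y - c0) = w y.
  by move=> h h'; apply: (lcrit_match l1); rewrite h h'.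
have m2 y : s2 < y -> y < c1 -> c0 <= q2 + y /\ w (q2 + y - c0) = w y.
  by move=> h h'; apply: (lcrit_match l2); rewrite h h'.
(* [s3] in the first occurrence and [s2] in the second are the same position of the word. *)
have [s3 s3E] : exists s3, q1 + s3 = q2 + s2 by exists (q2 + s2 - q1); lia.
have s13 : s1 < s3 by clear -s3E lt; lia.
have s3c : s3 + p < c1 by clear -s3E qu s2c c01 pu; lia.
have s2p : s2 + p < c1 by clear -s2c c01 pu; lia.
have [b1 _] := m1 s1.+1 (ltnSn _) (ltac:(clear -s1c c01 pu p0; lia)).
case: l2 => _ _; apply; split; first by clear -b1 lt; lia.
have [_ e1] := m1 s3 s13 (leq_ltn_trans (leq_addr _ _) s3c).
have [_ e2] := m1 (s3 + p) (leq_trans s13 (leq_addr _ _)) s3c.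
have [_ e3] := m2 (s2 + p) (ltac:(clear -p0; lia)) s2p.
rewrite -s3E e1 (per _ _ (leq_trans s3c cB)); last exact: ltnW (leq_ltn_trans As1 s13).
by rewrite -e2 (per s2 As2 (leq_trans s2p cB)) -e3 !addnA s3E.
Qed.

(** Mirror image of [lcrit_order]: the letter at the break is compared with the one [p] before
    it. *)
Lemma rcrit_order A B p c0 c1 q1 q2 z1 z2 :
  periodic A B p -> 0 < p < u -> A <= c0 -> c1 <= B -> c0 + 2 * u <= c1 ->
  rcrit w c0 c1 q1 z1 -> rcrit w c0 c1 q2 z2 ->
  c1 <= z1 < B -> c1 <= z2 < B -> q2 < q1 + u -> q1 < q2 + u ->
  q2 + z2 <= q1 + z1.
Proof.
move=> per /andP[p0 pu] Ac cB c01 l1 l2 /andP[cz1 z1B] /andP[cz2 z2B] qu qu'.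
rewrite leqNgt; apply/negP => lt.
have m1 y : c0 <= y -> y < z1 -> w (q1 + y - c0) = w y.
  by move=> h h'; apply: (rcrit_match l1); rewrite h h'.
have m2 y : c0 <= y -> y < z2 -> w (q2 + y - c0) = w y.
  by move=> h h'; apply: (rcrit_match l2); rewrite h h'.
case: l1 => _ _; apply.
have [t tE] : exists t, z1 = t + p by exists (z1 - p); clear -pu c01 cz1; lia.
have [z3 z3E] : exists z3, q2 + (z3 + p) = q1 + z1.
  by exists (z1 + q1 - q2 - p); clear -pu c01 cz1 qu; lia.
have h1 : c0 <= t by clear -tE pu c01 cz1; lia.
have h2 : c0 <= z3 by clear -z3E pu c01 cz1 qu; lia.
have h3 : z3 + p < z2 by clear -z3E lt; lia.
have eqt : q2 + z3 = q1 + t by clear -z3E tE; lia.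
have -> : w z1 = w t.
  by rewrite tE -per // -?tE // (leq_trans Ac).
have tz : t < z1 by clear -tE p0; lia.
rewrite -(m1 t h1 tz) -eqt -z3E (m2 _ h2 (leq_ltn_trans (leq_addr _ _) h3)).
rewrite (m2 _ (leq_trans h2 (leq_addr _ _)) h3) [RHS]per //; first exact: leq_trans h2.
exact: ltn_trans h3 z2B.
Qed.

(* With [p] the least period of the core and [A, B) the run of period [p]
   around it, critical starts within one period of [A] are determined by
   where the run in the other occurrence begins. *)
Lemma run_family A B p c0 c1 : 0 < p < u -> A < c0 -> c0 <= A + u ->
  c0 + 3 * u <= c1 -> c1 <= B -> B + 2 * u <= c0 + J * u ->
  periodic A B p -> (forall d, 0 < d < p -> ~ periodic c0 c1 d) ->
  exists l : seq (nat * nat), [/\ size l <= M,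
    forall g, g \in l -> A <= g.1 < c0 /\ c1 <= g.2 <= B &
    forall s e, A <= s < c0 -> s < A + p -> c1 <= e <= B -> B < e + p ->
      exists2 g, g \in l & hit_sub w g.1 g.2 s e].
Proof.
move=> pr Ac cA c01 cB BJ per pmin; have /andP[p0 pu] := pr.
have [hi [hA hc hAp hmax]] : exists hi, [/\ A <= hi, hi < c0, hi < A + p &
    forall s, s < c0 -> s < A + p -> s <= hi].
  exists (minn (A + p) c0 - 1); split; clear -Ac p0; lia.
have [lo [lc lB lmax]] : exists lo, [/\ c1 <= lo, B < lo + p &
    forall e, c1 <= e -> B < e + p -> lo <= e].
  by exists (maxn (B - p).+1 c1); split; clear -p0 pu c01; lia.
case: (leqP lo B) => loB; last first.
  exists [::]; split=> // s e _ _ /andP[h1 h2] h3.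
  by have := lmax e h1 h3; clear -loB h2; lia.
have c012 : c0 + 2 * u <= c1 by clear -c01; lia.
case: (@critical_family w u J K ty u0 tyP c0 c1 A hi lo B) => //.
- by rewrite hA ltnW.
- by rewrite lc andbT; clear -c01; lia.
- move=> q q' s s' qq /andP[sA sh] /andP[s'A s'h] h h'.
  have qa := same_block qq; have qb := same_block (esym qq).
  have sr : A <= s < c0 by rewrite sA (ltn_trans sh hc).
  have sr' : A <= s' < c0 by rewrite s'A (ltn_trans s'h hc).
  have sum : q + s = q' + s'.
    apply/eqP; rewrite eqn_leq (lcrit_order per pr cB c012 h' h) //.
    by rewrite (lcrit_order per pr cB c012 h h').
  (* Equal sums with distinct [s] and [s'] would give two occurrences of the core less than [p]
     apart, hence a period smaller than [p]. *)
  case: h => oq _ _; case: h' => oq' _ _.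
  case: (ltngtP s s') => // l.
    have l' : q' <= q by clear -sum l; lia.
    by case: (pmin (q - q') _ (occ_periodic l' oq' oq)); clear -sum l sA s'h hAp; lia.
  have l' : q <= q' by clear -sum l; lia.
  by case: (pmin (q' - q) _ (occ_periodic l' oq oq')); clear -sum l s'A sh hAp; lia.
- move=> q q' z z' qq /andP[zl zB] /andP[z'l z'B] h h'.
  have qa := same_block qq; have qb := same_block (esym qq).
  have zr : c1 <= z < B by rewrite zB (leq_trans lc zl).
  have zr' : c1 <= z' < B by rewrite z'B (leq_trans lc z'l).
  have sum : q + z = q' + z'.
    apply/eqP; rewrite eqn_leq (rcrit_order per pr (ltnW Ac) cB c012 h' h) //.
    by rewrite (rcrit_order per pr (ltnW Ac) cB c012 h h').
  case: h => oq _ _; case: h' => oq' _ _.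
  case: (ltngtP z z') => // l.
    have l' : q' <= q by clear -sum l; lia.
    by case: (pmin (q - q') _ (occ_periodic l' oq' oq)); clear -sum l zl z'B lB; lia.
  have l' : q <= q' by clear -sum l; lia.
  by case: (pmin (q' - q) _ (occ_periodic l' oq oq')); clear -sum l z'l zB lB; lia.
move=> l [sl rl fl]; exists l; split=> //.
  by move=> g /rl; clear -hc lc; lia.
move=> s e /andP[s1 s2] s3 /andP[e1 e2] e3; apply: fl; rewrite ?s1 ?e2 ?andbT.
  exact: hmax.
exact: lmax.
Qed.

Lemma periodic_mul A B p t y : periodic A B p -> A <= y -> y + t * p < B ->
  w y = w (y + t * p).
Proof.
move=> per; elim: t y => [|t IH] y Ay yB; first by rewrite mul0n addn0.
rewrite mulSn addnA in yB *; rewrite (per y Ay) ?(IH (y + p)) //.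
  exact: leq_trans Ay (leq_addr _ _).
exact: leq_ltn_trans (leq_addr _ _) yB.
Qed.

(* A longer factor with the same period is covered by overlapping copies. *)
Lemma run_cover A B p s l a b : 0 < p <= l -> periodic A B p -> A <= s ->
  s + a * p + l + b * p <= B ->
  hit_sub w s (s + a * p + l + b * p) (s + a * p) (s + a * p + l).
Proof.
move=> /andP[p0 pl] per As sB x [P [Px xP oP]].
have abp := mulnDl a b p.
rewrite (_ : s + a * p + l + b * p - s = l + (a + b) * p) in xP oP; last first.
  by clear -abp; lia.
have [t [tab tx xt]] : exists t, [/\ t <= a + b, P + t * p <= x & x < P + t * p + l].
  have [y xE] : exists y, x = P + y by exists (x - P); clear -Px; lia.
  rewrite {x Px}xE in xP *; have {}xP : y < l + (a + b) * p by clear -xP; lia.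
  have dy := divn_eq y p; have my := ltn_pmod y p0.
  case: (leqP (y %/ p) (a + b)) => h.
    by exists (y %/ p); split=> //; move: dy my h; clear -pl;
       move: (y %/ p) (y %% p) => c d; lia.
  exists (a + b); split=> //; last by clear -xP; lia.
  have : (a + b) * p <= y %/ p * p by rewrite leq_mul2r (ltnW h) orbT.
  by move: dy; clear; move: (y %/ p) (y %% p) => c d; lia.
have tp : t * p <= (a + b) * p by rewrite leq_mul2r tab orbT.
exists (P + t * p); rewrite addKn; split=> // j jl.
rewrite -addnA oP; last by clear -tp jl; lia.
rewrite (_ : s + (t * p + j) = s + j + t * p); last by clear; lia.
rewrite -(periodic_mul per (leq_trans As (leq_addr _ _))); last first.
  by clear -sB tp jl abp; lia.
rewrite (periodic_mul (t := a) per (leq_trans As (leq_addr _ _))); last first.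
  by clear -sB jl; lia.
by congr w; clear; lia.
Qed.

(** Moving [s] left and [e] right by whole periods reaches the first and the last period of the run;
    [run_cover] compares the hit sets. *)
Lemma run_extend A B p s e : 0 < p -> periodic A B p -> A <= s -> e <= B ->
  s + p <= e ->
  exists s' e', [/\ A <= s' <= s, s' < A + p, e <= e' <= B, B < e' + p &
                    hit_sub w s' e' s e].
Proof.
move=> p0 per As eB spe.
have [a [d [sE dp]]] : exists a d, s = A + d + a * p /\ d < p.
  exists ((s - A) %/ p), ((s - A) %% p); rewrite ltn_mod p0; split=> //.
  have := divn_eq (s - A) p; move: (_ %/ _) (_ %% _) => a d.
  by clear -As; lia.
have [b [f [eE fp]]] : exists b f, B = e + f + b * p /\ f < p.
  exists ((B - e) %/ p), ((B - e) %% p); rewrite ltn_mod p0; split=> //.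
  have := divn_eq (B - e) p; move: (_ %/ _) (_ %% _) => a' d'.
  by clear -eB; lia.
have [l el] : exists l, e = s + l by exists (e - s); clear -spe; lia.
exists (A + d), (e + b * p); split; try by clear -sE dp eE fp; lia.
rewrite el sE; apply: (@run_cover A B) => //.
- by rewrite p0; clear -el spe; lia.
- exact: leq_addr.
- by rewrite -sE -el eE; clear; lia.
Qed.

(** The core lies between the two blocks. If it has a period below [u], take the least one, [p], and
    its run [[A, B)]. A core enlarged by a letter that breaks the run has no period below [u], which
    handles [s < A] and [B < e]; factors inside the run go through [run_extend]. Hence three
    families. *)
Lemma cell_family b1 b2 : b1 + 4 <= b2 -> b2 + 4 <= b1 + J ->
  exists l : seq (nat * nat), [/\ size l <= 3 * M,
    forall g, g \in l -> g.1 %/ u = b1 /\ g.2 %/ u = b2 &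
    forall s e, s %/ u = b1 -> e %/ u = b2 ->
      exists2 g, g \in l & hit_sub w g.1 g.2 s e].
Proof.
move=> b12 bJ.
have blk x b : x %/ u = b <-> b * u <= x < b * u + u.
  split=> [<-|h]; first by have := divn_eq x u; have := ltn_mod x u; lia.
  by apply/eqP; rewrite eqn_leq leq_divRL // -ltnS ltn_divLR // mulSn; lia.
have h12 : b1 * u + 4 * u <= b2 * u by rewrite -mulnDl leq_mul2r b12 orbT.
have hJ : b2 * u + 4 * u <= b1 * u + J * u by rewrite -!mulnDl leq_mul2r bJ orbT.
set x1 := b1 * u in h12 hJ *; set x2 := b2 * u in h12 hJ *.
have blk1 x : x %/ u = b1 <-> x1 <= x < x1 + u by exact: blk.
have blk2 x : x %/ u = b2 <-> x2 <= x < x2 + u by exact: blk.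
clearbody x1 x2; clear blk b12 bJ.
have [c0 c0E] : exists c0, c0 = x1 + u by exists (x1 + u).
have M3 a : a <= M -> a <= 3 * M by lia.
case: (EM (exists d, `[< 0 < d < u /\ periodic c0 x2 d >])) => [ex|nex]; last first.
  case: (@aperiodic_family c0 x2 x1 (c0 - 1) x2 (x2 + u - 1)); try by lia.
    by move=> d d0 per; apply: nex; exists d; apply/asboolP.
  move=> l [sl rl fl]; exists l; split; first exact: M3.
    by move=> g /rl; rewrite blk1 blk2; lia.
  by move=> s e /blk1 s1 /blk2 e1; apply: fl; lia.
case: (ex_minnP ex) => p /asboolP[/andP[p0 pu] per] pmin.
have {}pmin d : 0 < d < p -> ~ periodic c0 x2 d.
  move=> dp pd; have du : 0 < d < u by clear -dp pu; lia.
  by have := pmin d (asboolT (conj du pd)); clear -dp; lia.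
have exA : exists a, `[< x1 <= a /\ periodic a x2 p >].
  by exists c0; apply/asboolP; split=> //; lia.
case: (ex_minnP exA) => A /asboolP[xA perA] Amin.
have Ac : A <= c0 by apply: Amin; apply/asboolP; split=> //; lia.
have exB : exists b, (b < x2 + u) && `[< periodic c0 b p >].
  by exists x2; apply/andP; split; [lia|apply/asboolP].
have ubB b : (b < x2 + u) && `[< periodic c0 b p >] -> b <= x2 + u by lia.
case: (ex_maxnP exB ubB) => B /andP[Bx /asboolP perB] Bmax.
have xB : x2 <= B by apply: Bmax; apply/andP; split; [lia|apply/asboolP].
have perAB : periodic A B p.
  move=> y Ay yB; case: (ltnP (y + p) x2) => h; first exact: perA.
  by apply: perB => //; lia.
have breakA : x1 < A -> w (A - 1) <> w (A - 1 + p).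
  move=> xA' e; suff : A <= A - 1 by lia.
  apply: Amin; apply/asboolP; split; first by lia.
  move=> y Ay yx; case: (ltngtP y (A - 1)) => // h; [lia|apply: perA => //; lia|].
  by rewrite h.
have breakB : B + 1 < x2 + u -> w (B - p) <> w B.
  move=> Bx' e; suff : B.+1 <= B by lia.
  apply: Bmax; apply/andP; split; first by lia.
  apply/asboolP => y cy yB; case: (ltngtP (y + p) B) => // h; [apply: perB => //|lia|].
  by rewrite h -e; congr w; lia.
have [l1 [s1 r1 f1]] : exists l : seq (nat * nat), [/\ size l <= M,
    forall g, g \in l -> g.1 %/ u = b1 /\ g.2 %/ u = b2 &
    forall s e, s %/ u = b1 -> e %/ u = b2 -> s < A ->
      exists2 g, g \in l & hit_sub w g.1 g.2 s e].
  case: (ltnP x1 A) => xA'; last first.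
    by exists [::]; split=> // s e /blk1; lia.
  case: (@aperiodic_family (A - 1) x2 x1 (A - 1) x2 (x2 + u - 1)); try by lia.
    (* A period [d] of the core from [A - 1] would give [w (A - 1) = w (A - 1 + d) = w (A - 1 + d +
       p) = w (A - 1 + p)]. *)
    move=> d d0 pd; apply: (breakA xA').
    rewrite pd; try by lia.
    rewrite [RHS]pd; try by lia.
    by rewrite perA; [congr w| |]; lia.
  move=> l [sl rl fl]; exists l; split=> //.
    by move=> g /rl; rewrite blk1 blk2; lia.
  by move=> s e /blk1 hs /blk2 he sA; apply: fl; lia.
have [l2 [s2 r2 f2]] : exists l : seq (nat * nat), [/\ size l <= M,
    forall g, g \in l -> g.1 %/ u = b1 /\ g.2 %/ u = b2 &
    forall s e, s %/ u = b1 -> e %/ u = b2 -> B < e ->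
      exists2 g, g \in l & hit_sub w g.1 g.2 s e].
  case: (ltnP (B + 1) (x2 + u)) => xB'; last first.
    by exists [::]; split=> // s e _ /blk2; lia.
  case: (@aperiodic_family c0 (B + 1) x1 (c0 - 1) (B + 1) (x2 + u - 1)); try by lia.
    move=> d d0 pd; apply: (breakB xB').
    have e1 := pd (B - d) (ltac:(lia)) (ltac:(lia)).
    have e2 := pd (B - p - d) (ltac:(lia)) (ltac:(lia)).
    have e3 := perB (B - d - p) (ltac:(lia)) (ltac:(lia)).
    have -> : w B = w (B - d) by rewrite e1; congr w; lia.
    have -> : w (B - p) = w (B - p - d) by rewrite e2; congr w; lia.
    have -> : B - p - d = B - d - p by lia.
    by rewrite e3; congr w; lia.
  move=> l [sl rl fl]; exists l; split=> //.
    by move=> g /rl; rewrite blk1 blk2; lia.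
  by move=> s e /blk1 hs /blk2 he sA; apply: fl; lia.
have [l3 [s3 r3 f3]] : exists l : seq (nat * nat), [/\ size l <= M,
    forall g, g \in l -> g.1 %/ u = b1 /\ g.2 %/ u = b2 &
    forall s e, s %/ u = b1 -> e %/ u = b2 -> A <= s -> e <= B ->
      exists2 g, g \in l & hit_sub w g.1 g.2 s e].
  case: (ltnP A c0) => Ac'; last first.
    by exists [::]; split=> // s e /blk1; lia.
  case: (@run_family A B p c0 x2); try by lia.
  - exact: perAB.
  - exact: pmin.
  move=> l [sl rl fl]; exists l; split=> //.
    by move=> g /rl; rewrite blk1 blk2; lia.
  move=> s e /blk1 hs /blk2 he As eB.
  have spe : s + p <= e by clear -hs he pu h12; lia.
  have [s' [e' [h1 h2 h3 h4 h5]]] := run_extend p0 perAB As eB spe.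
  have [g gl gs] : exists2 g, g \in l & hit_sub w g.1 g.2 s' e'.
    by apply: fl => //; clear -h1 h2 h3 h4 hs he xB c0E; lia.
  by exists g => // x /gs /h5.
exists (l1 ++ l2 ++ l3); split; first by rewrite !size_cat; lia.
  by move=> g; rewrite !mem_cat => /or3P[/r1|/r2|/r3].
move=> s e hs he; case: (ltnP s A) => sA.
  by have [g gl h] := f1 s e hs he sA; exists g; rewrite // mem_cat gl.
case: (ltnP B e) => eB.
  by have [g gl h] := f2 s e hs he eB; exists g; rewrite // !mem_cat gl orbT.
by have [g gl h] := f3 s e hs he sA eB; exists g; rewrite // !mem_cat gl !orbT.
Qed.

End Cells.

(** * Minimal factors of a level *)

Lemma count_lt (T : eqType) (a b : pred T) (l : seq T) z :
  subpred a b -> z \in l -> b z -> ~~ a z -> count a l < count b l.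
Proof.
move=> ab zl bz az; elim: l zl => //= y l IH; rewrite inE => /orP[/eqP<-|/IH lt].
  by rewrite bz (negbTE az) add0n add1n ltnS sub_count.
rewrite -addnS leq_add //; case: (boolP (a y)) => // /ab -> //.
Qed.

Section Level.
Variables (w : nat -> nat) (u c : nat).

(** The distance 4 leaves a core of at least three blocks, as [run_family] requires. *)
Definition level_factor s e := s %/ u + 4 <= e %/ u <= s %/ u + c.

Definition minimal_factor s e := level_factor s e /\
  forall s' e', level_factor s' e' -> hit_sub w s' e' s e -> hit_sub w s e s' e'.

Definition lexlt s' e' s e := s' < s \/ s' = s /\ e' < e.

(** Distinct factors may have the same hit set; picking the lexicographically first one lets ranks
    count hit sets. *)
Definition canonical_factor s e := minimal_factor s e /\ forall s' e', minimal_factor s' e' ->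
  hit_sub w s' e' s e -> hit_sub w s e s' e' -> ~ lexlt s' e' s e.

(* [(s, e)] has at least [j] canonical predecessors. This recursion stays
   first-order, so ranks are recognized by automata. *)
Fixpoint rank_ge j s e : Prop :=
  if j is j'.+1 then
    rank_ge j' s e /\ exists s' e', lexlt s' e' s e /\ rank_ge j' s' e'
  else canonical_factor s e.

(* Hitting the canonical factors suffices for all factors of the level; the
   requirement [j] concerns the [j]-th one, and is void if there is none. *)
Definition requirement j x :=
  forall s e, rank_ge j s e -> ~ rank_ge j.+1 s e -> hit w s e x.

Section Family.
Variables (K : finType) (ty : nat -> K).
Hypothesis u0 : 0 < u.
Hypothesis tyP : forall a b o,
  ty a = ty b -> o < (c + 4) * u -> w (a * u + o) = w (b * u + o).

(** Pairs of a block type and a block distance, times the size of a family from [cell_family]. *)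
Definition family_bound k := k * c.+1 * (3 * ((2 * k).+1 * k.+1)).

(** Which positions are hit depends only on the letters of the factor, so one representative cell
    for each block type and block distance suffices; [s'] below moves a factor there. *)
Lemma level_family : exists l : seq (nat * nat), [/\ size l <= family_bound #|K|,
  forall g, g \in l -> level_factor g.1 g.2 &
  forall s e, level_factor s e -> exists2 g, g \in l & hit_sub w g.1 g.2 s e].
Proof.
pose kind := (K * 'I_c.+1)%type; pose B := 3 * ((2 * #|K|).+1 * #|K|.+1).
have [F FP] : {F : kind -> seq (nat * nat) & forall t, [/\ size (F t) <= B,
    forall g, g \in F t -> level_factor g.1 g.2 &
    forall s e, level_factor s e -> ty (s %/ u) = t.1 -> e %/ u = s %/ u + t.2 ->
      exists2 g, g \in F t & hit_sub w g.1 g.2 s e]}.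
  apply: (@choice _ _ (fun (t : kind) (l : seq (nat * nat)) => [/\ size l <= B,
    forall g, g \in l -> level_factor g.1 g.2 &
    forall s e, level_factor s e -> ty (s %/ u) = t.1 -> e %/ u = s %/ u + t.2 ->
      exists2 g, g \in l & hit_sub w g.1 g.2 s e])) => -[t m] /=.
  case: (EM (exists b, ty b = t /\ 4 <= m)) => [[b [bt m4]]|nb]; last first.
    exists [::]; split=> // s e fse st em; exfalso; apply: nb.
    by exists (s %/ u); split=> //; move: fse; rewrite /level_factor em leq_add2l => /andP[].
  have mc := ltn_ord m.
  have [] := @cell_family w u (c + 4) K ty u0 tyP b (b + m); try by lia.
  move=> l [sl rl fl]; exists l; split=> //.
    by move=> g /rl[g1 g2]; rewrite /level_factor g1 g2; lia.
  move=> s e fse st em; pose s' := b * u + s %% u.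
  have su := ltn_pmod s u0; have sE := divn_eq s u; have eE := divn_eq e u.
  have eu := ltn_pmod e u0.
  have se : s <= e.
    rewrite sE eE em mulnDl -addnA leq_add2l; apply: leq_trans (leq_addr _ _).
    by rewrite ltnW // (leq_trans su) // leq_pmull //; lia.
  have word j : j < e - s -> w (s + j) = w (s' + j).
    move=> je; rewrite {1}sE /s' -!addnA; apply: tyP; first by rewrite st.
    have : e < (s %/ u + m).+1 * u by rewrite eE em mulSn; lia.
    rewrite mulSn mulnDl => eb; have : m * u <= c * u by rewrite leq_mul2r; lia.
    by rewrite mulnDl; lia.
  have s'b : s' %/ u = b by rewrite /s' divnMDl // (divn_small su) addn0.
  have e'b : (s' + (e - s)) %/ u = b + m.
    have -> : s' + (e - s) = (b + m) * u + e %% u.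
      by rewrite /s' {1}eE {2}sE em !mulnDl; lia.
    by rewrite divnMDl // (divn_small eu) addn0.
  have [g gl gs] := fl _ _ s'b e'b; exists g => // x /gs [p [p1 p2 p3]].
  exists p; split=> //; first by rewrite addKn in p2.
  move=> j je; rewrite word //; apply: p3; rewrite addKn //.
exists (flatten [seq F t | t <- enum {: kind}]); split.
- rewrite /family_bound -/B; have -> : #|K| * c.+1 = #|{: kind}|.
    by rewrite card_prod card_ord.
  rewrite cardE; elim: (enum _) => //= t l IH; rewrite size_cat mulSn leq_add //.
  by case: (FP t).
- by move=> g /flattenP[l /mapP[t _ ->]]; case: (FP t) => _ h _; exact: h.
- move=> s e fse.
  have m : e %/ u - s %/ u < c.+1 by move: fse; rewrite /level_factor; lia.
  have [_ _ h] := FP (ty (s %/ u), Ordinal m).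
  have [|g gF gs] := h s e fse (erefl _); first by move: fse; rewrite /= /level_factor; lia.
  exists g => //; apply/flattenP; exists (F (ty (s %/ u), Ordinal m)) => //.
  by apply: map_f; rewrite mem_enum.
Qed.

Lemma lexlt_trans s1 e1 s2 e2 s3 e3 :
  lexlt s1 e1 s2 e2 -> lexlt s2 e2 s3 e3 -> lexlt s1 e1 s3 e3.
Proof.
move=> [l1|[-> l1]] [l2|[<- l2]]; [left|by left|by left|right].
  exact: ltn_trans l1 l2.
by split=> //; apply: ltn_trans l1 l2.
Qed.

Lemma lexlt_total s1 e1 s2 e2 : ~ lexlt s1 e1 s2 e2 -> ~ lexlt s2 e2 s1 e1 ->
  s1 = s2 /\ e1 = e2.
Proof.
move=> n1 n2; case: (ltngtP s1 s2) => [h|h|E]; [by case: n1; left|by case: n2; left|].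
by case: (ltngtP e1 e2) => [h|h|//]; [case: n1|case: n2]; right.
Qed.

Lemma rank_geS j s e : rank_ge j.+1 s e -> rank_ge j s e.
Proof. by move=> [h _]. Qed.

Lemma rank_canonical j s e : rank_ge j s e -> canonical_factor s e.
Proof. by elim: j => // j IH /rank_geS. Qed.

Lemma canonical_inj s e s' e' : canonical_factor s e -> canonical_factor s' e' ->
  hit_sub w s e s' e' -> hit_sub w s' e' s e -> (s, e) = (s', e').
Proof.
move=> [m n] [m' n'] h h'.
have n1 := n s' e' m' h' h; have n2 := n' s e m h h'.
by case: (lexlt_total n2 n1) => -> ->.
Qed.

(** A factor of rank [j] ends a chain of [j + 1] canonical factors, and distinct canonical factors
    share their hit sets with distinct members of the finite family. *)
Lemma rank_bounded s e : ~ rank_ge (family_bound #|K|) s e.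
Proof.
have [l [sl rl fl]] := level_family; set D := family_bound _ in sl *.
have chain j s0 e0 : rank_ge j s0 e0 -> exists L : seq (nat * nat),
    [/\ size L = j.+1, uniq L, forall g, g \in L -> canonical_factor g.1 g.2 &
        forall g, g \in L -> g = (s0, e0) \/ lexlt g.1 g.2 s0 e0].
  elim: j s0 e0 => [|j IH] s0 e0 /=.
    move=> h; exists [:: (s0, e0)]; split=> // g; rewrite inE => /eqP-> //; by left.
  move=> [h [s1 [e1 [l1 /IH[L [L1 L2 L3 L4]]]]]].
  exists ((s0, e0) :: L); split; rewrite /= ?L1 ?L2 ?andbT //.
  - apply/negP => /L4[[se ee]|l2]; first by move: l1; rewrite se ee => -[|[_]]; rewrite ltnn.
    by case: (lexlt_trans l1 l2) => [|[_]]; rewrite ltnn.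
  - by move=> g; rewrite inE => /orP[/eqP->|/L3//]; exact: rank_canonical h.
  - move=> g; rewrite inE => /orP[/eqP->|/L4[->|gl]]; [by left|by right|right].
    exact: lexlt_trans gl l1.
move/chain => [L [L1 L2 L3 _]].
have [F FP] : {F : nat * nat -> nat * nat & forall g, g \in L -> F g \in l /\
    hit_sub w (F g).1 (F g).2 g.1 g.2 /\ hit_sub w g.1 g.2 (F g).1 (F g).2}.
  apply: (@choice _ _ (fun g h => g \in L -> h \in l /\
    hit_sub w h.1 h.2 g.1 g.2 /\ hit_sub w g.1 g.2 h.1 h.2)) => g.
  case: (boolP (g \in L)) => [gL|]; last by exists (0, 0).
  have [[gf gm] _] := L3 _ gL; have [h hl hs] := fl _ _ gf.
  exists h => _; split=> //; split=> //; apply: gm => //.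
  exact: rl.
have inj : {in L &, injective F}.
  move=> [s1 e1] [s2 e2] g1 g2 FF.
  have [_ [a1 b1]] := FP _ g1; have [_ [a2 b2]] := FP _ g2; rewrite FF in a1 b1.
  apply: canonical_inj; [exact: (L3 _ g1)|exact: (L3 _ g2)| |].
    by move=> x /b1 /a2.
  by move=> x /b2 /a1.
have sub : {subset map F L <= l} by move=> g /mapP[g' /FP[h _] ->].
have := uniq_leq_size (etrans (map_inj_in_uniq inj) L2) sub.
by rewrite size_map L1 => /leq_trans /(_ sl); rewrite ltnn.
Qed.

(** Among the members of the finite family below [(s, e)], one with the fewest members below it is
    minimal. The lexicographically first minimal factor with its hit set is canonical. *)
Lemma canonical_below s e : level_factor s e ->
  exists s' e', canonical_factor s' e' /\ hit_sub w s' e' s e.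
Proof.
have [l [_ rl fl]] := level_family => fse.
pose cnt g := size [seq h <- l | `[< hit_sub w h.1 h.2 g.1 g.2 >]].
have ex : exists n, `[< exists g, [/\ g \in l, hit_sub w g.1 g.2 s e & cnt g = n] >].
  have [g gl gs] := fl _ _ fse; exists (cnt g); apply/asboolP; by exists g.
case: (ex_minnP ex) => n /asboolP[g [gl gs cg]] nmin.
have gmin : minimal_factor g.1 g.2.
  split=> [|s' e' f' h']; first exact: rl.
  have [h hl hs] := fl _ _ f'.
  have hg x : hit w h.1 h.2 x -> hit w g.1 g.2 x by move=> /hs /h'.
  have le : n <= cnt h.
    by apply: nmin; apply/asboolP; exists h; split=> // x /hg /gs.
  suff : hit_sub w g.1 g.2 h.1 h.2 by move=> gh x /gh /hs.
  apply: contrapT => ngh; move: le; rewrite -cg leqNgt => /negP; apply.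
  rewrite /cnt !size_filter; apply: (@count_lt _ _ _ _ g) => //.
  - by move=> z /asboolP zh; apply/asboolP => x /zh /hg.
  - exact/asboolP.
  - exact/asboolP.
have exs : exists s0, `[< exists e0, [/\ minimal_factor s0 e0, hit_sub w s0 e0 g.1 g.2 &
    hit_sub w g.1 g.2 s0 e0] >].
  by exists g.1; apply/asboolP; exists g.2; split=> // x.
case: (ex_minnP exs) => s0 /asboolP exe0 smin.
have exe : exists e0, `[< [/\ minimal_factor s0 e0, hit_sub w s0 e0 g.1 g.2 &
    hit_sub w g.1 g.2 s0 e0] >].
  by case: exe0 => e0 h; exists e0; apply/asboolP.
case: (ex_minnP exe) => e0 /asboolP[m0 h0 h0'] emin.
exists s0, e0; split; last by move=> x /h0 /gs.
split=> // s' e' m' h1 h2 [lt|[E lt]].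
  have : s0 <= s'; last by lia.
  by apply: smin; apply/asboolP; exists e'; split=> // x => [/h1/h0|/h0'/h2].
have : e0 <= e'; last by lia.
by apply: emin; apply/asboolP; rewrite -E; split=> // x => [/h1/h0|/h0'/h2].
Qed.

(** The index is the exact rank of a canonical factor below [(s, e)]. *)
Lemma requirement_sufficient s e : level_factor s e ->
  exists2 j, j < family_bound #|K| & forall x, requirement j x -> hit w s e x.
Proof.
move=> /canonical_below[s0 [e0 [c0 h0]]].
have ex : exists j, `[< rank_ge j s0 e0 >] by exists 0; apply/asboolP.
have ub j : `[< rank_ge j s0 e0 >] -> j <= family_bound #|K|.
  move=> /asboolP h; rewrite leqNgt; apply/negP => lt.
  apply: (@rank_bounded s0 e0); elim: j h lt => // j IH h lt.
  by move: lt; rewrite ltnS leq_eqVlt => /orP[/eqP->|/IH]; [exact: rank_geS|apply; exact: rank_geS].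
case: (ex_maxnP ex ub) => j /asboolP hj jmax; exists j.
  by rewrite ltn_neqAle ub ?andbT; [|exact/asboolP]; apply/eqP => jE;
     apply: (@rank_bounded s0 e0); rewrite -jE.
move=> x /(_ s0 e0 hj) h; apply/h0/h => hS.
by have := jmax j.+1 (asboolT hS); rewrite ltnn.
Qed.
End Family.

(** At most one factor has exact rank [j]: the later of two would have the earlier as predecessor,
    hence rank [j + 1]. *)
Lemma requirement_necessary j : (forall x, requirement j x) \/
  exists s e, level_factor s e /\ forall x, hit w s e x -> requirement j x.
Proof.
case: (EM (exists s e, rank_ge j s e /\ ~ rank_ge j.+1 s e)) => [[s [e [h n]]]|nex]; last first.
  by left=> x s e h n; case: nex; exists s, e.
right; exists s, e; split.
  by case: (rank_canonical h) => -[].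
move=> x hx s' e' h' n'.
suff [-> ->] : s' = s /\ e' = e by [].
case: (EM (lexlt s e s' e')) => l1; first by case: n'; split=> //; exists s, e.
case: (EM (lexlt s' e' s e)) => l2; first by case: n; split=> //; exists s', e'.
by case: (lexlt_total l1 l2) => -> ->.
Qed.
End Level.

(** * Pumping *)

Lemma collision (T : finType) (f : nat -> T) n : #|T| < n ->
  exists i j, [/\ i < j, j < n & f i = f j].
Proof.
move=> Tn; have ninj : ~~ injectiveb (fun i : 'I_n => f i).
  by apply/negP => /injectiveP /leq_card; rewrite card_ord leqNgt Tn.
case/injectivePn: ninj => i [j ij hij].
case: (ltngtP i j) => [l|l|/val_inj e]; [by exists i, j; split|by exists j, i; split|].
by rewrite e eqxx in ij.
Qed.

(* A marked word is a base-[k] expansion with some digits marked; the state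
   [(c, Z)] of [run] records the class [c] of the number read so far and the set
   [Z] of classes of the pairs [(k ^ i, number)] for the marked positions [i]. *)
Section Pump.
Variables (k : nat) (k1 : 1 < k) (T : finType).
Variables (f : nat -> nat -> T) (g : T -> nat -> nat -> T) (acc : pred T).
Hypothesis fg : forall u x d a, d < k -> a < k -> f (k * u + d) (k * x + a) = g (f u x) d a.

Let St : finType := (T * {set T})%type.
(** A mark starts a copy of the automaton with [u = 1]; all later digits of [u] are 0, so a mark at
    position [i] becomes [u = k ^ i]. *)
Definition mstep (s : T * {set T}) (p : nat * bool) : T * {set T} :=
  (g s.1 0 p.1, [set g z 0 p.1 | z in s.2] :|: (if p.2 then [set g s.1 1 p.1] else set0)).
Definition run := foldl mstep.
Definition mval (W : seq (nat * bool)) := foldl (fun x p => k * x + p.1) 0 W.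
Definition digits_ok (W : seq (nat * bool)) := all (fun p => p.1 < k) W.
Definition mark (W : seq (nat * bool)) i := (nth (0, false) (rev W) i).2.
Definition start : T * {set T} := (f 0 0, set0).

Lemma run_cat s V W : run s (V ++ W) = run (run s V) W.
Proof. exact: foldl_cat. Qed.

Lemma mval_foldl y W : foldl (fun x p => k * x + p.1) y W = y * k ^ size W + mval W.
Proof.
rewrite /mval; elim: W y => [|p W IH] y /=; first by rewrite expn0 addn0 muln1.
by rewrite IH [in RHS]IH muln0 add0n expnS mulnDl addnA; lia.
Qed.

Lemma mval_cons p W : mval (p :: W) = p.1 * k ^ size W + mval W.
Proof. by rewrite {1}/mval /= mval_foldl muln0. Qed.

Lemma mval_lt W : digits_ok W -> mval W < k ^ size W.
Proof.
elim: W => [|p W IH] /=; first by rewrite expn0.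
move=> /andP[pk /IH lt]; rewrite mval_cons expnS.
have : p.1.+1 * k ^ size W <= k * k ^ size W by rewrite leq_mul2r pk orbT.
by rewrite mulSn; clear -lt; lia.
Qed.

Lemma run_val W : digits_ok W -> run start W =
  (f 0 (mval W), [set z | `[< exists i, [/\ i < size W, mark W i & z = f (k ^ i) (mval W)] >]]).
Proof.
have k0 : 0 < k by apply: ltnW.
elim/last_ind: W => [|W [a m] IH].
  move=> _; congr pair; apply/setP => z; rewrite !inE; apply/esym/asboolP.
  by case=> i [].
rewrite /digits_ok all_rcons /= => /andP[ak dW].
rewrite /run foldl_rcons -/run IH // /mstep /=.
have vE : mval (rcons W (a, m)) = k * mval W + a by rewrite /mval foldl_rcons.
have f0 d : d < k -> f d (k * mval W + a) = g (f 0 (mval W)) d a.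
  by move=> dk; rewrite -fg // muln0.
congr pair; first by rewrite vE -(fg _ _ k0 ak) muln0.
have fS i : f (k ^ i.+1) (mval (rcons W (a, m))) = g (f (k ^ i) (mval W)) 0 a.
  by rewrite vE -fg // addn0 expnS.
have markS i : mark (rcons W (a, m)) i.+1 = mark W i by rewrite /mark rev_rcons.
have mark0 : mark (rcons W (a, m)) 0 = m by rewrite /mark rev_rcons.
apply/setP => z; rewrite !inE; apply/orP/asboolP => [[/imsetP[z']|]|[[|i] []]].
- rewrite inE => /asboolP[i [iW mi ->]] ->; exists i.+1; split; rewrite ?fS //.
    by rewrite size_rcons ltnS.
  by rewrite markS.
- case: m mark0 vE {fS markS} => m0 vE; last by rewrite inE.
  by rewrite inE => /eqP->; exists 0; split; rewrite ?size_rcons ?m0 ?vE ?expn0 ?f0.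
- rewrite mark0 vE => _ mm ->; right; rewrite mm inE expn0 f0 //.
- rewrite size_rcons ltnS markS fS => iW mi ->; left; apply/imsetP.
  by exists (f (k ^ i) (mval W)) => //; rewrite inE; apply/asboolP; exists i.
Qed.

Lemma mark_cat V W i : mark (V ++ W) (size W + i) = mark V i.
Proof.
by rewrite /mark rev_cat nth_cat size_rev ltnNge leq_addr /= addKn.
Qed.

Lemma shorten s V : digits_ok V -> exists V', [/\ digits_ok V', size V' < #|St| & run s V' = run s V].
Proof.
have [n] := ubnP (size V); elim: n V => // n IH V sV dV.
case: (ltnP (size V) #|St|) => h; first by exists V.
have [i [j [ij jV e]]] := @collision _ (fun i => run s (take i V)) (size V).+1 h.
pose V' := take i V ++ drop j V.
have sV' : size V' < size V by rewrite size_cat size_take size_drop; case: ifP; lia.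
have [|V1 [h1 h2 h3]] := IH V' (leq_trans sV' sV).
  have td r : digits_ok (take r V) && digits_ok (drop r V).
    by rewrite /digits_ok -all_cat cat_take_drop.
  have /andP[h1 _] := td i; have /andP[_ h2] := td j.
  by rewrite /digits_ok all_cat; apply/andP.
by exists V1; split=> //; rewrite h3 /V' run_cat e -run_cat cat_take_drop.
Qed.

Definition good (s : T * {set T}) := [forall z in s.2, acc z].

Definition tail_ok b (s : T * {set T}) := exists V,
  [/\ digits_ok V, size V = b, forall i, ~~ mark V i & good (run s V)].

Lemma tail_okS b s : tail_ok b.+1 s <-> exists2 a, a < k & tail_ok b (mstep s (a, false)).
Proof.
split=> [[[|[a m] V] [//= /andP[ak dV] [sV] nm gV]]|[a ak [V [dV sV nm gV]]]].
  have m0 : m = false.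
    by have := nm b; rewrite -sV -[size V]addn0 -cat1s mark_cat /mark /=; exact: negbTE.
  exists a => //; exists V; split=> //; last by rewrite m0 in gV.
  move=> i; case: (ltnP i (size V)) => h; last by rewrite /mark nth_default ?size_rev.
  by have := nm i; rewrite -cat1s /mark rev_cat nth_cat size_rev h.
exists ((a, false) :: V); split=> //=; rewrite ?ak ?sV //.
move=> i; rewrite -cat1s; case: (ltnP i (size V)) => h.
  by have := nm i; rewrite /mark rev_cat nth_cat size_rev h.
by rewrite -(subnKC h) mark_cat /mark; case: (i - size V) => [|[]].
Qed.

Let E := 2 ^ #|St|.

(** The set of states with a good tail of length [b + 1] is a function of the one for [b], so these
    sets are eventually periodic with preperiod and period at most [E]; the factorial is a multiple
    of the period. *)
Lemma tail_ok_periodic N b t s : E <= N -> N <= b ->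
  tail_ok (b + N`! * t) s <-> tail_ok b s.
Proof.
move=> EN Nb.
pose A i : {set St} := [set s | `[< tail_ok i s >]].
have AS i : A i.+1 = [set s | `[< exists2 a, a < k & mstep s (a, false) \in A i >]].
  apply/setP => z; rewrite !inE; apply: asbool_equiv_eq; rewrite tail_okS.
  by split=> -[a ak h]; exists a => //; move: h; rewrite inE => /asboolP.
have cS : #|{set St}| < E.+1 by rewrite ltnS -(cardsT {set St}) -powersetT card_powerset cardsT.
have [i [j [ij jE e]]] := collision A cS.
have per r : A (i + r) = A (j + r).
  by elim: r => [|r IH]; rewrite ?addn0 // !addnS !AS IH.
have per1 r : i <= r -> A (r + (j - i)) = A r.
  by move=> ir; have := per (r - i); rewrite subnKC // => ->; congr A; lia.
have perm q r : i <= r -> A (r + q * (j - i)) = A r.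
  move=> ir; elim: q => [|q IH]; first by rewrite mul0n addn0.
  by rewrite mulSn addnCA addnC per1 // (leq_trans ir) // leq_addr.
have /dvdnP[q qE] : j - i %| N`!.
  by apply: dvdn_fact; lia.
have : A (b + N`! * t) = A b.
  by rewrite qE mulnAC perm //; lia.
by move/setP/(_ s); rewrite !inE => h; split=> /asboolP H; apply/asboolP; rewrite ?h // -h.
Qed.

Definition unmark (V : seq (nat * bool)) := [seq (p.1, false) | p <- V].

Lemma run_unmark V c (Z Z' : {set T}) : Z \subset Z' ->
  (run (c, Z) (unmark V)).2 \subset (run (c, Z') V).2.
Proof.
elim: V c Z Z' => //= p V IH c Z Z' ZZ'; apply: IH => /=.
by rewrite setU0 (subset_trans _ (subsetUl _ _)) // imsetS.
Qed.

Definition mword x (I : seq nat) m := [seq ((x %/ k ^ i) %% k, i \in I) | i <- rev (iota 0 m)].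

Lemma size_mword x I m : size (mword x I m) = m.
Proof. by rewrite size_map size_rev size_iota. Qed.

Lemma mword_ok x I m : digits_ok (mword x I m).
Proof. by apply/allP => p /mapP[i _ ->] /=; rewrite ltn_mod ltnW. Qed.

Lemma mark_mword x I m i : i < m -> mark (mword x I m) i = (i \in I).
Proof.
move=> im; rewrite /mark /mword -map_rev revK (nth_map 0) ?size_iota //.
by rewrite nth_iota.
Qed.

Lemma mval_mword x I m : x < k ^ m -> mval (mword x I m) = x.
Proof.
have k0 i : 0 < k ^ i by rewrite expk_gt0.
move=> xm; suff -> : mval (mword x I m) = x %% k ^ m by rewrite modn_small.
elim: m {xm} => [|m IH]; first by rewrite expn0 modn1.
rewrite /mword -addn1 iotaD rev_cat /= -/(mword x I m) mval_cons IH size_mword /= add0n addn1.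
have xE : x = x %/ k ^ m %/ k * (k ^ m * k) + (x %/ k ^ m %% k * k ^ m + x %% k ^ m).
  rewrite {1}(divn_eq x (k ^ m)) {1}(divn_eq (x %/ k ^ m) k) mulnDl -addnA; congr addn.
  by rewrite -mulnA [k * _]mulnC.
rewrite expnSr {3}xE modnMDl [in RHS]modn_small //.
apply: (@leq_trans (((x %/ k ^ m) %% k).+1 * k ^ m)).
  by rewrite mulSn addnC ltn_add2r ltn_mod.
by rewrite mulnC leq_mul2l ltn_mod (ltnW k1) orbT.
Qed.

(** [x] serves more levels than there are states, so two of these levels [b < a] are reached in the
    same state. The digits from [a - 1] down to [b] form a loop whose last digit is marked; the tail
    below [b] is exchanged for one of length [b0]. *)
Lemma pump_cycle x (I : seq nat) N b0 : E <= N -> N <= b0 -> uniq I ->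
  (forall i, i \in I -> acc (f (k ^ i) x) /\ exists t, i = b0 + N`! * t) -> #|St| < size I ->
  exists Y V Z, [/\ digits_ok Y /\ size Y <= #|St|, digits_ok V /\ 0 < size V <= #|St|,
    digits_ok Z /\ size Z = b0, mark V 0 &
    forall j, good (run start (Y ++ flatten (nseq j V) ++ Z))].
Proof.
move=> EN Nb0 uI hI sI.
have [m xm mI] : exists2 m, x < k ^ m & forall i, i \in I -> i < m.
  exists (x + sumn I).+1.
    apply: leq_trans (ltn_expl x k1) _; rewrite leq_exp2l //.
    exact: leqW (leq_addr _ _).
  move=> i iI; rewrite ltnS (leq_trans _ (leq_addl _ _)) //.
  by rewrite (perm_sumn (perm_to_rem iI)) leq_addr.
pose W := mword x I m.
have goodW : good (run start W).
  apply/forallP => z; apply/implyP; rewrite run_val ?mword_ok //= inE.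
  move/asboolP => [i [im]]; rewrite size_mword in im; rewrite mark_mword // mval_mword //.
  by move=> /hI[h _] ->.
(* The state after the digits at positions [i] and above. *)
pose st i := run start (take (m - i) W).
have [i [j [ij jI e]]] := collision (fun r => st (nth 0 I r)) sI.
have [a [b [aI bI ba sab]]] : exists a b, [/\ a \in I, b \in I, b < a & st a = st b].
  have h1 := mem_nth 0 (ltn_trans ij jI); have h2 := mem_nth 0 jI.
  case: (ltngtP (nth 0 I i) (nth 0 I j)) => h.
  - by exists (nth 0 I j), (nth 0 I i).
  - by exists (nth 0 I i), (nth 0 I j).
  - by move/eqP: h; rewrite nth_uniq ?(ltn_trans ij jI) // (ltn_eqF ij).
have am := mI _ aI; have bm := mI _ bI.
pose s := st b.
have dW := mword_ok x I m.
have dtd r : digits_ok (take r W) && digits_ok (drop r W).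
  by rewrite /digits_ok -all_cat cat_take_drop.
have dtake r : digits_ok (take r W) by case/andP: (dtd r).
have ddrop r : digits_ok (drop r W) by case/andP: (dtd r).
pose V0 := drop (m - a) (take (m - b) W).
have WV : take (m - b) W = take (m - a) W ++ V0.
  rewrite -{1}(cat_take_drop (m - a) (take (m - b) W)); congr cat.
  by rewrite take_takel //; lia.
have V0ok : digits_ok V0.
  by have := dtake (m - b); rewrite /digits_ok WV all_cat => /andP[].
have sV0 : size V0 = a - b.
  by rewrite size_drop size_take_min size_mword (minn_idPl (leq_subr _ _)); clear -ba am bm; lia.
have runV0 : run s V0 = s by rewrite {1}/s -sab -run_cat -WV.
have mV0 : mark V0 0.
  have sb : size (drop (m - b) W) = b by rewrite size_drop size_mword subKn // ltnW.
  have := mark_cat (take (m - b) W) (drop (m - b) W) 0.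
  rewrite cat_take_drop sb addn0 (mark_mword _ _ bm) bI WV.
  by rewrite /mark rev_cat nth_cat size_rev sV0 subn_gt0 ba => <-.
(* The marked last digit is set aside, so that shortening the rest of the loop keeps it. *)
case/lastP: V0 V0ok sV0 runV0 mV0 {WV} => [|V1 [d mk]]; first by rewrite /mark.
rewrite /mark rev_rcons /= {1}/digits_ok all_rcons => /andP[/= dk V1ok] _ + mk1; rewrite {}mk1.
rewrite -cats1 run_cat /= => runV1.
have [V' [V'ok sV' rV']] := shorten s V1ok.
have [Y [Yok sY rY]] := shorten start (dtake (m - b)).
have [[_ [t bE]]] := hI _ bI.
(* Without its marks the tail creates fewer classes to be accepted, so it stays good. *)
have tb : tail_ok b s.
  exists (unmark (drop (m - b) W)); split.
  - have := ddrop (m - b); rewrite /digits_ok /unmark all_map; exact: sub_all.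
  - by rewrite size_map size_drop size_mword subKn // ltnW.
  - move=> r; rewrite /mark /unmark -map_rev.
    case: (ltnP r (size (rev (drop (m - b) W)))) => h; first by rewrite (nth_map (0, false)).
    by rewrite nth_default // size_map.
  - apply/forallP => z; apply/implyP => zs; move/forallP/(_ z)/implyP: goodW; apply.
    rewrite -(cat_take_drop (m - b) W) run_cat -/(st b) -/s.
    by move: zs; case: (s) => c Z; exact/subsetP/run_unmark.
rewrite bE tail_ok_periodic // in tb.
have [Z [Zok sZ _ gZ]] := tb.
exists Y, (rcons V' (d, true)), Z; split=> //.
- by split=> //; apply: ltnW.
- by rewrite /digits_ok all_rcons /= dk size_rcons.
- by rewrite /mark rev_rcons.
move=> r; rewrite run_cat rY -/(st b) -/s run_cat.
suff -> : run s (flatten (nseq r (rcons V' (d, true)))) = s by [].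
have rV : run s (rcons V' (d, true)) = s by rewrite -cats1 run_cat rV'.
by elim: r => //= r IH; rewrite run_cat rV.
Qed.

End Pump.

Section Pumping.
Variables (k F : nat) (R : nat -> nat -> Prop).
Hypothesis k1 : 1 < k.
Hypothesis regR : reg k F (fun e => R (e 0) (e 1)).

(** Bounds the states of [run], pairs of a class and a set of classes. The factorial in
    [pump_period] is a common multiple of the loop lengths and of the period of [tail_ok]. *)
Definition pump_states F := F * 2 ^ F.
Definition pump_period F := (2 ^ pump_states F)`!.

(** In [Y V^j Z] the copies of [V] are marked every [size V] levels from [b0] on, and [size V]
    divides the period. [Y] and the rounding of [j] cost at most [pump_states F] levels each. *)
Lemma pumping b0 : 2 ^ pump_states F <= b0 ->
  (forall m, exists2 x, x < k ^ m & forall t, b0 + pump_period F * t + 2 * pump_states F <= m ->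
     R (k ^ (b0 + pump_period F * t)) x) \/
  (forall x (I : seq nat), uniq I -> (forall t, t \in I -> R (k ^ (b0 + pump_period F * t)) x) ->
     size I <= pump_states F).
Proof.
move=> Eb0; case: regR => T [cls [step [acc [TF cs ac]]]].
pose pe u x := scons u (scons x (fun _ => 0)).
pose f u x := cls (pe u x); pose g c d a := step c (pe d a).
have fg u x d a : d < k -> a < k -> f (k * u + d) (k * x + a) = g (f u x) d a.
  move=> dk ak; rewrite /f /g -cs; last by case=> [|[|i]] //=; apply: ltnW.
  by congr cls; apply/funext => -[|[|i]] //=; rewrite /shift /= muln0.
have Rf u x : R u x <-> acc (f u x) by exact: (ac (pe u x)).
pose St : finType := (T * {set T})%type.
have StF : #|St| <= pump_states F.
  rewrite card_prod -(cardsT {set T}) -powersetT card_powerset cardsT.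
  by rewrite /pump_states leq_mul // leq_exp2l.
set N := pump_states F in StF *; pose E := 2 ^ N.
have EN : 2 ^ #|St| <= E by rewrite leq_exp2l.
case: (EM (forall x (I : seq nat), uniq I ->
   (forall t, t \in I -> R (k ^ (b0 + pump_period F * t)) x) -> size I <= N)); first by right.
move=> /existsNP[x] /existsNP[I] /not_implyP[uI] /not_implyP[hI] /negP; rewrite -ltnNge => sI.
left; have E0 : 0 < E`! by apply: fact_gt0.
pose I' := [seq b0 + E`! * t | t <- I].
have uI' : uniq I'.
  by rewrite map_inj_uniq // => t t' /addnI/eqP; rewrite eqn_mul2l gtn_eqF //= => /eqP.
have hI' i : i \in I' -> acc (f (k ^ i) x) /\ exists t, i = b0 + E`! * t.
  by move=> /mapP[t tI ->]; split; [exact/Rf/hI|exists t].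
have sI' : #|St| < size I' by rewrite size_map; apply: leq_ltn_trans sI.
have [Y [V [Z [[Yok sY] [Vok /andP[V0 sV]] [Zok sZ] mV gj]]]] :=
  pump_cycle k1 fg EN Eb0 uI' hI' sI'.
move=> m; case: (ltnP m (b0 + 2 * N)) => mb.
  exists 0 => [|t]; first by rewrite expk_gt0.
  by clear -mb; lia.
pose j := (m - size Y - b0) %/ size V.
pose W := Y ++ flatten (nseq j V) ++ Z.
have sfl r : size (flatten (nseq r V)) = r * size V.
  by elim: r => //= r IH; rewrite size_cat IH mulSn.
have sW : size W = size Y + j * size V + b0 by rewrite !size_cat sfl sZ addnA.
have jle : j * size V <= m - size Y - b0 by exact: leq_trunc_div.
have jgt : m - size Y - b0 < j * size V + size V.
  by rewrite {1}(divn_eq (m - size Y - b0) (size V)) ltn_add2l ltn_mod.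
have YN : size Y <= N := leq_trans sY StF; have VN : size V <= N := leq_trans sV StF.
have Wok : digits_ok k W.
  rewrite /digits_ok !all_cat; apply/and3P; split=> //.
  by elim: (j) => //= r IH; rewrite all_cat IH andbT.
exists (mval k W).
  apply: leq_trans (mval_lt k1 Wok) _; rewrite leq_exp2l // sW.
  by clear -mb jle YN; lia.
move=> t tm; apply/Rf.
move/forallP/(_ (f (k ^ (b0 + E`! * t)) (mval k W)))/implyP: (gj j); apply.
rewrite (run_val k1 fg) //= inE; apply/asboolP; exists (b0 + E`! * t).
have /dvdnP[q qE] : size V %| E`!.
  apply: dvdn_fact; rewrite V0 (leq_trans VN) //.
  by rewrite ltnW // /E ltn_expl.
have tj : q * t < j.
  rewrite -(ltn_pmul2r V0) mulnAC -qE.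
  rewrite [pump_period F](_ : _ = E`!) // in tm.
  by move: (E`! * t) tm => r tm; clear -tm jgt YN VN mb; lia.
split=> //.
  rewrite sW qE mulnAC.
  have : q * t * size V < j * size V by rewrite ltn_pmul2r.
  by clear; lia.
(* Below this digit stand [Z] and [q * t] copies of [V], so it is the last digit of a copy. *)
rewrite qE mulnAC -sZ catA mark_cat.
have jE : j = j - (q * t).+1 + (q * t).+1 by rewrite subnK.
have -> : Y ++ flatten (nseq j V) =
    (Y ++ flatten (nseq (j - (q * t).+1) V) ++ V) ++ flatten (nseq (q * t) V).
  by rewrite {1}jE nseqD flatten_cat /= !catA.
rewrite -sfl -[X in mark _ X]addn0 mark_cat catA -[0]addn0.
by rewrite /mark rev_cat nth_cat size_rev V0.
Qed.
End Pumping.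

(** * Bounds on the size of attractors *)

(** Lists replace subsets: repetitions and positions outside the prefix do no harm, so upper bounds
    on [gamma] follow by listing points. *)
Definition attracts (w : nat -> nat) n (xs : seq nat) := forall p q, p <= q -> q < n ->
  exists p', [/\ p' + (q - p) < n, forall j, j <= q - p -> w (p + j) = w (p' + j) &
                 exists2 x, x \in xs & p' <= x <= p' + (q - p)].

Lemma attracts_set w n (S : {set 'I_n}) :
  reflect (attracts w n [seq val i | i <- enum S]) (attractor w n S).
Proof.
apply: (iffP idP) => [aS p q pq qn|aS].
  have pn := leq_ltn_trans pq qn.
  have := forallP (forallP aS (Ordinal pn)) (Ordinal qn); rewrite /= pq /=.
  move=> /existsP[p' /and3P[h1 /forallP h2 /existsP[i /andP[iS h3]]]].
  exists p'; split=> //; last by exists i => //; apply/mapP; exists i; rewrite ?mem_enum.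
  move=> j jq; have jn : j < n by lia.
  by move/implyP: (h2 (Ordinal jn)) => /= /(_ jq) /eqP.
apply/forallP => p; apply/forallP => q; apply/implyP => pq.
have [p' [h1 h2 [x /mapP[i]]]] := aS p q pq (ltn_ord q).
rewrite mem_enum => iS -> h3; have p'n : p' < n by lia.
apply/existsP; exists (Ordinal p'n); apply/and3P; split=> //=.
  by apply/forallP => j; apply/implyP => jq; apply/eqP/h2.
by apply/existsP; exists i; rewrite iS.
Qed.

Lemma gamma_leP w n c :
  reflect (exists2 xs, size xs <= c & attracts w n xs) (gamma w n <= c).
Proof.
rewrite /gamma; case: arg_minnP => [|S aS Smin].
  apply/attracts_set => p q pq qn; exists p; split=> //; first by lia.
  exists p; last by lia.
  by apply/mapP; exists (Ordinal (leq_ltn_trans pq qn)); rewrite ?mem_enum ?inE.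
apply: (iffP idP) => [Sc|[xs xc axs]].
  by exists [seq val i | i <- enum S]; [rewrite size_map -cardE|exact/attracts_set].
pose X : {set 'I_n} := [set i | val i \in xs].
have aX : attractor w n X.
  apply/attracts_set => p q pq qn; have [p' [h1 h2 [x xx h3]]] := axs p q pq qn.
  exists p'; split=> //; exists x => //; have xn : x < n by lia.
  by apply/mapP; exists (Ordinal xn); rewrite ?mem_enum ?inE.
apply: leq_trans (Smin X aX) (leq_trans _ xc).
rewrite cardE -(size_map val); apply: uniq_leq_size.
  by rewrite map_inj_uniq ?enum_uniq //; apply: val_inj.
by move=> x /mapP[i]; rewrite mem_enum inE => h ->.
Qed.

Lemma gamma_attained w n : exists2 xs, size xs = gamma w n & attracts w n xs.
Proof.
have /gamma_leP[xs le axs] := leqnn (gamma w n); exists xs => //.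
by apply/eqP; rewrite eqn_leq le /=; apply/gamma_leP; exists xs.
Qed.

Lemma gamma_gt0 w n : 0 < n -> 0 < gamma w n.
Proof.
move=> n0; have [[|x xs] <- // axs] := gamma_attained w n.
by have [p' [_ _ []]] := axs 0 0 (leqnn _) n0.
Qed.

Lemma eq_gamma w w' n : w =1 w' -> gamma w n = gamma w' n.
Proof.
move=> ww; suff le v v' : v =1 v' -> gamma v n <= gamma v' n.
  by apply: anti_leq; apply/andP; split; apply: le => // x; rewrite ww.
move=> vv; have [xs <- axs] := gamma_attained v' n.
apply/gamma_leP; exists xs => // p q pq qn; have [p' [h1 h2 h3]] := axs p q pq qn.
by exists p'; split=> // j jq; rewrite !vv h2.
Qed.

Lemma cover_count (Q : nat -> nat -> Prop) B (xs L : seq nat) : uniq L ->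
  (forall t, t \in L -> exists2 x, x \in xs & Q t x) ->
  (forall x I, uniq I -> (forall t, t \in I -> Q t x) -> size I <= B) ->
  size L <= size xs * B.
Proof.
move=> uL cL hB; elim: xs L uL cL => [|x xs IH] L uL cL.
  by case: L uL cL => // t L _ /(_ t (mem_head _ _))[].
rewrite -(count_predC (fun t => `[< Q t x >]) L) -!size_filter mulSn leq_add //.
  by apply: (hB x); rewrite ?filter_uniq // => t; rewrite mem_filter => /andP[/asboolP].
apply: IH; first by rewrite filter_uniq.
move=> t; rewrite mem_filter /= => /andP[/asboolP nq /cL[y]].
by rewrite inE => /orP[/eqP->|]; [move/nq|exists y].
Qed.

(** Number of states of an automaton that follows [n] and [n + 1] together: every pair of adjacent
    block states occurs at an index below [k] to this power. *)
Definition appear_exp a := (a.+1 * 2) * (a.+1 * 2).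
(** Lengths from [k ^ (i + 3)] up to but excluding [k ^ (i + 4)] belong to level [i], as
    [k ^ 3 >= 5]. *)
Definition level_width k := k ^ 4.
Definition level_keys k a := (a.+1 * 2) ^ (level_width k + 4).
Definition requirement_count k a := family_bound (level_width k) (level_keys k a).
(* The three terms count the points used for short factors, for factors of
   medium length (one pumped point per requirement and residue class of levels)
   and for factors of length comparable to that of the whole prefix. *)
Definition gamma_bound k a F :=
  k ^ (appear_exp a + (2 ^ pump_states F + 3)) +
  (requirement_count k a * pump_period F + k ^ (2 * pump_states F + 5)).

(* No factor has level [0]: the junk value [s %/ 0 = 0] rules it out. *)
Definition power_part k u := if `[< exists i, u = k ^ i >] then u else 0.

Lemma power_partE k i : power_part k (k ^ i) = k ^ i.
Proof. by rewrite /power_part; case: asboolP => // -[]; exists i. Qed.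

(** * Upper and lower bounds for an automatic word *)

Section AutomaticWord.
Variables (k : nat) (A : DFAO).
Hypothesis k1 : 1 < k.
Let w := aut_word k A.
Let N := (codeA A).+1.
Local Notation aexp := (appear_exp (codeA A)).
Local Notation width := (level_width k).
Local Notation keys := (level_keys k (codeA A)).
Local Notation nreq := (requirement_count k (codeA A)).

Definition block_type J a : {ffun 'I_J -> 'I_N * bool} := [ffun j => qstate k A (a + nat_of_ord j)].

Lemma block_typeP J i a b o : block_type J a = block_type J b -> o < J * k ^ i ->
  w (a * k ^ i + o) = w (b * k ^ i + o).
Proof.
have u0 := expk_gt0 k1 i; move=> ab oJ.
have jJ : o %/ k ^ i < J by rewrite ltn_divLR.
rewrite {1 2}(divn_eq o (k ^ i)) !addnA -!mulnDl; apply: aut_block => //.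
  by rewrite ltn_mod.
by move/ffunP/(_ (Ordinal jJ)): ab; rewrite !ffunE.
Qed.

Lemma card_block_type J : #|{ffun 'I_J -> 'I_N * bool}| = (N * 2) ^ J.
Proof. by rewrite card_ffun card_prod !card_ord card_bool. Qed.

(** A factor of length [k ^ i + 1] meets at most two adjacent blocks, and their pair of states
    recurs at a small index. *)
Lemma appearance p i : exists p', [/\ p' < k ^ (aexp + i), p' <= p &
  forall j, j <= k ^ i -> w (p + j) = w (p' + j)].
Proof.
have k0 := ltnW k1; have u0 := expk_gt0 k1 i.
case: (ltnP p (k ^ (aexp + i))) => pK; first by exists p.
pose Q : finType := ('I_N * bool)%type.
pose f x : Q * Q := (qstate k A x, qstate k A x.+1).
(* The successor of [k * x + d] ends in [d + 1], or in 0 after a carry into [x + 1]. *)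
pose g (c : Q * Q) d : Q * Q :=
  (qstep c.1 d, if d.+1 < k then qstep c.1 d.+1 else qstep c.2 0).
have fg x d : d < k -> f (k * x + d) = g (f x) d.
  move=> dk; rewrite /f /g /= qstate_shift // -addnS; congr pair.
  case: (ltnP d.+1 k) => h; first by rewrite qstate_shift.
  by rewrite -qstate_shift // mulnS addn0 addnC; congr (qstate k A (_ + _)); lia.
have [b bk fb] := aut_small_witness k1 fg (p %/ k ^ i).
rewrite !card_prod card_ord card_bool -/aexp in bk.
have fb1 : qstate k A (p %/ k ^ i) = qstate k A b := esym (congr1 fst fb).
have fb2 : qstate k A (p %/ k ^ i).+1 = qstate k A b.+1 := esym (congr1 snd fb).
have pu : p %% k ^ i < k ^ i by rewrite ltn_mod.
have p'K : b * k ^ i + p %% k ^ i < k ^ (aexp + i).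
  have : b.+1 * k ^ i <= k ^ aexp * k ^ i by rewrite leq_mul2r bk orbT.
  by rewrite mulSn -expnD; clear -pu; lia.
exists (b * k ^ i + p %% k ^ i); split=> // [|j ju].
  by apply: ltnW; apply: leq_trans p'K pK.
rewrite {1}(divn_eq p (k ^ i)) -!addnA.
case: (ltnP (p %% k ^ i + j) (k ^ i)) => h; first by apply: aut_block.
rewrite -(subnKC h) !addnA -!mulSnr; apply: aut_block => //.
by clear -h ju pu; lia.
Qed.

Lemma multiple_in_interval u p l : 0 < u -> u <= l ->
  exists2 y, p <= y * u < p + l & y * u < p + u.
Proof.
move=> u0 ul; have pE := divn_eq p u; have pu := ltn_pmod p u0.
case: (posnP (p %% u)) => h.
  by exists (p %/ u); move: pE; rewrite h; clear -u0 ul; lia.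
by exists (p %/ u).+1; rewrite mulSn; move: pE; clear -h u0 ul pu; lia.
Qed.

(** At each scale take the multiples of [k ^ i] up to [k ^ (aexp + i + 1)]: a factor of length
    between [k ^ i] and [k ^ (i + 1)] has an occurrence starting below this bound, and it contains a
    multiple. *)
Lemma gamma_log_upper n : 0 < n ->
  gamma w n <= (k ^ aexp * k).+1 * (trunc_log k n).+1.
Proof.
move=> n0; set m := trunc_log k n; set B := _.+1.
apply/gamma_leP; exists [seq j * k ^ i | j <- iota 0 B, i <- iota 0 m.+1].
  by rewrite size_allpairs !size_iota.
move=> p q pq qn; pose l := (q - p).+1; pose i := trunc_log k l.
have ln : l <= n by rewrite /l; lia.
have il : k ^ i <= l by apply: trunc_logP.
have li : l < k ^ i.+1 by apply: trunc_log_ltn.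
have im : i <= m by apply: leq_trunc_log.
have [p' [p'K p'p pp]] := appearance p i.+1.
exists p'; split; first by clear -pq qn p'p; lia.
  by move=> j jq; apply: pp; apply: ltnW; apply: leq_ltn_trans li; rewrite /l; clear -jq; lia.
have [y y1 y2] := multiple_in_interval p' (expk_gt0 k1 i) il.
exists (y * k ^ i); last by move: y1; rewrite /l; clear; lia.
apply/allpairsP; exists (y, i); split=> //; rewrite mem_iota add0n //.
rewrite -(ltn_pmul2r (expk_gt0 k1 i)); apply: leq_trans y2 _.
rewrite /B mulSn addnC leq_add2l -mulnA -expnS -expnD; exact: ltnW.
Qed.

Definition req i j x := requirement w (k ^ i) width j x.

Lemma req_sufficient i s e : level_factor (k ^ i) width s e ->
  exists2 j, j < nreq & forall x, req i j x -> hit w s e x.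
Proof.
rewrite /requirement_count /level_keys -card_block_type.
apply: requirement_sufficient; first exact: expk_gt0.
by move=> a b o; apply: block_typeP.
Qed.

Lemma level_factor_len i p l : 5 * k ^ i <= l -> l < k ^ (i + 4) ->
  level_factor (k ^ i) width p (p + l).
Proof.
move=> l1; rewrite addnC expnD -/width => l2; have u0 := expk_gt0 k1 i.
have dE a : p %/ k ^ i + a = (a * k ^ i + p) %/ k ^ i by rewrite divnMDl // addnC.
apply/andP; split; rewrite dE leq_div2r //; first by clear -l1; lia.
by move: (width * _) l2 => z; clear; lia.
Qed.

Lemma gamma_upper F :
  (forall j b0, j < nreq -> 2 ^ pump_states F <= b0 ->
   forall m, exists2 x, x < k ^ m &
     forall t, b0 + pump_period F * t + 2 * pump_states F <= m ->
       req (b0 + pump_period F * t) j x) ->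
  forall n, gamma w n <= gamma_bound k (codeA A) F.
Proof.
move=> hx [|n'].
  by apply: leq_trans (leq0n _); apply/gamma_leP; exists [::] => // p q _.
have k0 := ltnW k1; have := ltn0Sn n'; move: n'.+1 => n n0.
set E := 2 ^ pump_states F; set P := pump_period F.
(* The pumped points miss the top [2 * pump_states F] levels; the factors up there are met by
   multiples of [k ^ h]. *)
pose M1 := 2 * pump_states F + 5.
have P0 : 0 < P by apply: fact_gt0.
pose m := trunc_log k n; have mn : k ^ m <= n by apply: trunc_logP.
have nm : n < k ^ m.+1 by apply: trunc_log_ltn.
(* A point below [k ^ m.-1] hits factors of length at most [k ^ m.-1] inside the prefix, since
   [2 * k ^ m.-1 <= n]. *)
have [X XP] : {X : nat * nat -> nat & forall jr, jr.1 < nreq ->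
    X jr < k ^ m.-1 /\ forall t, E + jr.2 + P * t + 2 * pump_states F <= m.-1 ->
       req (E + jr.2 + P * t) jr.1 (X jr)}.
  apply: (@choice _ _ (fun jr x => jr.1 < nreq ->
    x < k ^ m.-1 /\ forall t, E + jr.2 + P * t + 2 * pump_states F <= m.-1 ->
       req (E + jr.2 + P * t) jr.1 x)) => -[j r] /=.
  case: (ltnP j nreq) => jD; last by exists 0.
  by have [x x1 x2] := hx j (E + r) jD (leq_addr _ _) m.-1; exists x.
pose h := m + 4 - M1.
pose xs1 := iota 0 (k ^ (aexp + (E + 3))).
pose xs2 := [seq X (j, r) | j <- iota 0 nreq, r <- iota 0 P].
pose xs3 := [seq j * k ^ h | j <- iota 0 (k ^ M1)].
apply/gamma_leP; exists (xs1 ++ xs2 ++ xs3).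
  by rewrite !size_cat size_allpairs size_map !size_iota.
move=> p q pq qn; pose l := (q - p).+1; pose i := trunc_log k l.
have ln : l <= n by rewrite /l; clear -pq qn; lia.
have il : k ^ i <= l by apply: trunc_logP.
have li : l < k ^ i.+1 by apply: trunc_log_ltn.
have qE : q = p + l - 1 by rewrite /l; clear -pq; lia.
have im : i <= m by apply: leq_trunc_log.
case: (leqP i (E + 2)) => iE.
  have [p' [p'K p'p pp]] := appearance p (E + 3).
  exists p'; split; first by clear -pq qn p'p; lia.
    move=> j jq; apply: pp; apply: (@leq_trans l); first by rewrite /l; clear -jq; lia.
    by apply: ltnW; apply: leq_trans li _; rewrite leq_exp2l //; clear -iE; lia.
  exists p'; last by clear; lia.
  by rewrite mem_cat mem_iota /= p'K.
case: (ltnP (m + 3) (i + M1)) => iM.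
  have hi : h <= i by rewrite /h; clear -iM; lia.
  have [y y1 _] := multiple_in_interval p (expk_gt0 k1 h)
    (leq_trans (leq_pexp2l k0 hi) il).
  exists p; split=> //; first by clear -pq qn; lia.
  exists (y * k ^ h); last by move: y1; rewrite /l; clear; lia.
  rewrite !mem_cat (map_f (fun j => j * k ^ h)) ?orbT // mem_iota /=.
  rewrite -(ltn_pmul2r (expk_gt0 k1 h)) -expnD.
  have : y * k ^ h < n by move: y1; rewrite /l; clear -pq qn; lia.
  move=> yn; apply: leq_trans yn (leq_trans (ltnW nm) _); rewrite leq_exp2l //.
  by rewrite /h; clear; lia.
pose lv := i - 3.
have lvE : lv + 3 = i by rewrite /lv; clear -iE; lia.
have fl : level_factor (k ^ lv) width p (p + l).
  apply: level_factor_len; last by rewrite (_ : lv + 4 = i.+1) //; clear -lvE; lia.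
  apply: leq_trans il; rewrite -lvE addnC expnD leq_mul2r; apply/orP; right.
  by apply: (@leq_trans (2 ^ 3)); rewrite // leq_exp2r.
have [j jD hit_j] := req_sufficient fl.
pose r := (lv - E) %% P.
have rP : r < P by rewrite ltn_mod.
have [x1 x2] := XP (j, r) jD; rewrite /= in x1 x2.
have lvt : lv = E + r + P * ((lv - E) %/ P).
  have := divn_eq (lv - E) P; rewrite -/r [P * _]mulnC.
  by move: (_ %/ _ * _) => z; clear -iE lvE; lia.
have mM : M1 <= m + 3 - i by clear -iM; lia.
have : hit w p (p + l) (X (j, r)).
  apply: hit_j; rewrite lvt; apply: x2; rewrite -lvt.
  by move: mM; rewrite /M1; clear -lvE; lia.
move=> [p' [p1 p2 p3]]; rewrite addKn in p2.
have m0 : m = m.-1.+1 by move: mM; rewrite /M1; clear -lvE; lia.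
exists p'; split.
- have l2 : l <= k ^ m.-1.
    apply: ltnW; apply: leq_trans li _; rewrite leq_exp2l //.
    by move: mM; rewrite /M1; clear -lvE m0; lia.
  have : 2 * k ^ m.-1 <= k ^ m by rewrite {2}m0 expnS leq_mul2r k1 orbT.
  by rewrite /l in l2; clear -p1 x1 l2 mn; lia.
- by move=> t tq; rewrite p3 // addKn.
exists (X (j, r)); last by move: p1 p2; rewrite /l; clear; lia.
rewrite !mem_cat; apply/orP; right; apply/orP; left.
by apply/allpairsP; exists (j, r); rewrite /= !mem_iota /= jD rP.
Qed.

(** Requirement [j] has to be met at every level of the progression that fits into the prefix, about
    [m / P] of them, and one point serves at most [pump_states F] of these levels. *)
Lemma gamma_lower F j b0 : 2 ^ pump_states F <= b0 ->
  (forall x (I : seq nat), uniq I ->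
     (forall t, t \in I -> req (b0 + pump_period F * t) j x) -> size I <= pump_states F) ->
  exists a b, forall n, 0 < n -> trunc_log k n <= a * gamma w n + b.
Proof.
move=> Eb0 hx; set P := pump_period F in hx.
have P0 : 0 < P by apply: fact_gt0.
(* A factor of level [i] has length at most [k ^ (i + 5)] and an occurrence starting below
   [k ^ (aexp + i + 5)], so it occurs in the prefix once [i + aexp + 6 <= m]. *)
pose c0 := b0 + (aexp + 6).
exists (P * pump_states F), (P + c0) => n n0.
set m := trunc_log k n; have mn : k ^ m <= n by apply: trunc_logP.
have [xs <- axs] := gamma_attained w n.
pose T := (m - c0) %/ P.
have hT : T <= size xs * pump_states F.
  rewrite -(size_iota 0 T).
  apply: (cover_count (Q := fun t x => req (b0 + P * t) j x)); rewrite ?iota_uniq //.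
  move=> t; rewrite mem_iota /= add0n => tT.
  set i := b0 + P * t.
  have im : i + (aexp + 6) <= m.
    have : P * t.+1 <= m - c0.
      by apply: leq_trans (leq_trunc_div (m - c0) P); rewrite mulnC leq_mul2r tT orbT.
    by rewrite mulnS /i /c0; move: (P * t) => z; clear -P0; lia.
  case: (requirement_necessary w (k ^ i) width j) => [all_x|[s [e [fse hse]]]].
    (* A void requirement is met by any point, and an attractor of a nonempty prefix has one. *)
    have [p' [_ _ [x xx _]]] := axs 0 0 (leqnn _) n0.
    by exists x => //; apply: all_x.
  have u0 := expk_gt0 k1 i; case/andP: fse => f1 f2.
  have sE := divn_eq s (k ^ i); have su := ltn_pmod s u0.
  have eE := divn_eq e (k ^ i); have eu := ltn_pmod e u0.
  have se : s < e.
    have : (s %/ k ^ i + 4) * k ^ i <= e %/ k ^ i * k ^ i by rewrite leq_mul2r f1 orbT.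
    by rewrite mulnDl {2}sE {2}eE; clear -su u0; lia.
  have el : e - s <= k ^ (i + 5).
    have : e %/ k ^ i * k ^ i <= (s %/ k ^ i + width) * k ^ i by rewrite leq_mul2r f2 orbT.
    have : width.+1 <= k ^ 5 by rewrite expnS ltn_Pmull // expk_gt0.
    rewrite -(leq_pmul2r u0) mulSn mulnDl [i + 5]addnC expnD.
    by rewrite {2}sE {2}eE; clear -su eu; lia.
  have [p' [p'K p'p pp]] := appearance s (i + 5).
  have small : k ^ (aexp + (i + 5)) + k ^ (i + 5) <= n.
    apply: leq_trans mn; apply: (@leq_trans (2 * k ^ (aexp + (i + 5)))).
      by rewrite mul2n -addnn leq_add2l leq_exp2l // leq_addl.
    apply: (@leq_trans (k ^ (aexp + (i + 5)).+1)).
      by rewrite expnS leq_mul2r k1 orbT.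
    by rewrite leq_exp2l //; clear -im; lia.
  have [|q1 [q2 q3 [x xx q4]]] := axs p' (p' + (e - s) - 1) (ltac:(clear -se; lia)).
    by clear -small p'K el se; lia.
  exists x => //; apply: hse; exists q1; split; try by clear -q4 se; lia.
  move=> z ze; rewrite -q3; last by clear -ze; lia.
  by rewrite pp //; clear -ze el; lia.
have mT : m - c0 < T.+1 * P by apply: ltn_ceil.
have hTP : T * P <= size xs * pump_states F * P by rewrite leq_mul2r hT orbT.
rewrite mulSn in mT; have -> : P * pump_states F * size xs = size xs * pump_states F * P.
  by rewrite -mulnA mulnC [pump_states F * _]mulnC.
by clear -hTP mT; lia.
Qed.

Lemma gamma_dichotomy F :
  (forall j, j < nreq ->
     reg k F (fun e => requirement w (power_part k (e 0)) width j (e 1))) ->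
  (forall n, gamma w n <= gamma_bound k (codeA A) F) \/
  exists a b, forall n, 0 < n -> trunc_log k n <= a * gamma w n + b.
Proof.
move=> rj; case: (EM (exists j b0, [/\ j < nreq, 2 ^ pump_states F <= b0 &
   forall x (I : seq nat), uniq I ->
     (forall t, t \in I -> req (b0 + pump_period F * t) j x) -> size I <= pump_states F])).
  by move=> [j [b0 [_ b0E h]]]; right; apply: gamma_lower b0E h.
move=> nex; left; apply: gamma_upper => j b0 jD b0E.
case: (pumping (R := fun u x => requirement w (power_part k u) width j x) k1 (rj j jD) b0E).
  move=> h m; have [x x1 x2] := h m; exists x => // t /x2.
  by rewrite power_partE.
move=> h; case: nex; exists j, b0; split=> // x I uI hI; apply: (h x I uI) => t tI.
by rewrite power_partE; apply: hI.
Qed.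
End AutomaticWord.

(** * Computable functions *)

Definition computable r (f : seq nat -> nat) := exists e, forall v, size v = r -> evalp e v (f v).
Notation computableb r p := (computable r (fun v => nat_of_bool (p v))).

Lemma comp_ext r f g : (forall v, size v = r -> f v = g v) -> computable r f -> computable r g.
Proof. by move=> fg [e he]; exists e => v vr; rewrite -fg //; apply: he. Qed.

Lemma comp_app r s g (fs : seq (seq nat -> nat)) : size fs = s -> computable s g ->
  foldr (fun f P => computable r f /\ P) True fs -> computable r (fun v => g [seq f v | f <- fs]).
Proof.
move=> sfs [e he] hfs.
have [gs hgs] : exists gs, forall v, size v = r -> evals gs v [seq f v | f <- fs].
  elim: fs hfs {sfs} => [_|f fs IH /= [[e' he'] /IH[gs hgs]]].
    by exists [::] => v _; constructor.
  by exists (e' :: gs) => v vr; constructor; [exact: he'|exact: hgs].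
exists (PComp e gs) => v vr; apply: ev_comp (hgs v vr) _.
by apply: he; rewrite size_map.
Qed.

Lemma comp_nth r i : computable r (fun v => nth 0 v i).
Proof. by exists (PProj i) => v _; constructor. Qed.

Lemma comp_proj r s (js : seq nat) f : size js = s -> computable s f ->
  computable r (fun v => f [seq nth 0 v j | j <- js]).
Proof.
move=> sj cf.
apply: (comp_ext (f := fun v => f [seq g v | g <- [seq (fun v => nth 0 v j) | j <- js]])).
  by move=> v _; rewrite -map_comp.
apply: comp_app cf _; first by rewrite size_map.
by elim: js {sj} => //= j js IH; split=> //; exact: comp_nth.
Qed.

Lemma comp_behead r f : computable r f -> computable r.+1 (fun v => f (behead v)).
Proof.
move=> cf; apply: comp_ext (comp_proj r.+1 (size_iota 1 r) cf).
move=> [|x v] //= [vr]; congr f; rewrite -vr.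
by rewrite (iotaDl 1 0) -map_comp -[RHS](mkseq_nth 0).
Qed.

Lemma comp_succ r a : computable r a -> computable r (fun v => (a v).+1).
Proof.
move=> ca; apply: (@comp_app r 1 (fun v => (head 0 v).+1) [:: a]) => //.
by exists PSucc => v _; constructor.
Qed.

Lemma comp_const r n : computable r (fun _ => n).
Proof.
by elim: n => [|n IH]; [exists PZero => v _; constructor|exact: comp_succ].
Qed.

Lemma comp_iteri r a b g : computable r a -> computable r b -> computable r.+2 g ->
  computable r (fun v => iteri (a v) (fun n y => g [:: n, y & v]) (b v)).
Proof.
move=> ca [eb hb] [eg hg].
have cr : computable r.+1 (fun v => iteri (head 0 v) (fun n y => g [:: n, y & behead v]) (b (behead v))).
  exists (PRec eb eg) => -[|n v] //= [vr].
  elim: n => [|n IH] /=; first by constructor; exact: hb.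
  by apply: ev_recS IH _; apply: hg; rewrite /= vr.
have := @comp_app r r.+1 _ (a :: [seq (fun v => nth 0 v i) | i <- iota 0 r]) _ cr.
rewrite /= size_map size_iota => /(_ (erefl _)) h.
apply: comp_ext (h _) => [v vr|].
  by rewrite -map_comp -vr (_ : [seq _ | i <- _] = v) // -[RHS](mkseq_nth 0).
split=> //; elim: (iota 0 r) => //= i l IH; split=> //; exact: comp_nth.
Qed.

Lemma comp_add r a b : computable r a -> computable r b -> computable r (fun v => a v + b v).
Proof.
move=> ca cb.
apply: comp_ext (comp_iteri ca cb (comp_succ (comp_nth r.+2 1))) => v _.
by elim: (a v) => //= n ->.
Qed.

Lemma comp_under2 r f : computable r f -> computable r.+2 (fun v => f (behead (behead v))).
Proof. by move/comp_behead/comp_behead. Qed.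

Lemma comp_mul r a b : computable r a -> computable r b -> computable r (fun v => a v * b v).
Proof.
move=> ca cb; apply: comp_ext (comp_iteri ca (comp_const r 0)
  (comp_add (comp_under2 cb) (comp_nth r.+2 1))) => v _ /=.
by elim: (a v) => //= n ->; rewrite mulSn.
Qed.

Lemma comp_exp r a b : computable r a -> computable r b -> computable r (fun v => a v ^ b v).
Proof.
move=> ca cb; apply: comp_ext (comp_iteri cb (comp_const r 1)
  (comp_mul (comp_under2 ca) (comp_nth r.+2 1))) => v _ /=.
by elim: (b v) => //= n ->; rewrite expnS.
Qed.

Lemma comp_fact r a : computable r a -> computable r (fun v => (a v)`!).
Proof.
move=> ca; apply: comp_ext (comp_iteri ca (comp_const r 1)
  (comp_mul (comp_succ (comp_nth r.+2 0)) (comp_nth r.+2 1))) => v _ /=.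
by elim: (a v) => //= n ->; rewrite factS.
Qed.

Lemma comp_pred r a : computable r a -> computable r (fun v => (a v).-1).
Proof.
move=> ca; apply: comp_ext (comp_iteri ca (comp_const r 0) (comp_nth r.+2 0)) => v _.
by case: (a v).
Qed.

Lemma comp_sub r a b : computable r a -> computable r b -> computable r (fun v => a v - b v).
Proof.
move=> ca cb; apply: comp_ext (comp_iteri cb ca (comp_pred (comp_nth r.+2 1))) => v _ /=.
by elim: (b v) => [|n IH] /=; rewrite ?subn0 // IH subnS.
Qed.

Lemma comp_leq r a b : computable r a -> computable r b -> computableb r (fun v => a v <= b v).
Proof.
move=> ca cb; apply: comp_ext (comp_sub (comp_const r 1) (comp_sub ca cb)) => v _.
by rewrite /leq; case: (a v - b v).
Qed.

Lemma comp_ltn r a b : computable r a -> computable r b -> computableb r (fun v => a v < b v).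
Proof. by move=> ca; apply: comp_leq; exact: comp_succ. Qed.

Lemma comp_not r p : computableb r p -> computableb r (fun v => ~~ p v).
Proof.
by move=> cp; apply: comp_ext (comp_sub (comp_const r 1) cp) => v _; case: (p v).
Qed.

Lemma comp_and r p q : computableb r p -> computableb r q -> computableb r (fun v => p v && q v).
Proof.
by move=> cp cq; apply: comp_ext (comp_mul cp cq) => v _; case: (p v); case: (q v).
Qed.

Lemma comp_imp r p q : computableb r p -> computableb r q -> computableb r (fun v => p v ==> q v).
Proof.
move=> cp cq; apply: comp_ext (comp_not (comp_and cp (comp_not cq))) => v _.
by case: (p v); case: (q v).
Qed.

Lemma comp_eq r a b : computable r a -> computable r b -> computableb r (fun v => a v == b v).
Proof.
move=> ca cb; apply: comp_ext (comp_and (comp_leq ca cb) (comp_leq cb ca)) => v _.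
by rewrite eqn_leq.
Qed.

Lemma comp_if r p a b : computableb r p -> computable r a -> computable r b ->
  computable r (fun v => if p v then a v else b v).
Proof.
move=> cp ca cb.
apply: comp_ext (comp_add (comp_mul cp ca) (comp_mul (comp_not cp) cb)) => v _.
by case: (p v); rewrite ?mul1n ?mul0n ?addn0.
Qed.

Lemma comp_head_under2 r f : computable r.+1 f ->
  computable r.+2 (fun v => f (nth 0 v 0 :: behead (behead v))).
Proof.
move=> cf; have js : size (0 :: iota 2 r) = r.+1 by rewrite /= size_iota.
apply: comp_ext (comp_proj r.+2 js cf) => -[|x [|y v]] //= [vr]; congr (f (_ :: _)).
by rewrite -vr (iotaDl 2 0) -map_comp -[RHS](mkseq_nth 0).
Qed.

Lemma comp_sum r a f : computable r a -> computable r.+1 f ->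
  computable r (fun v => \sum_(i < a v) f (nat_of_ord i :: v)).
Proof.
move=> ca cf; apply: comp_ext (comp_iteri ca (comp_const r 0)
  (comp_add (comp_nth r.+2 1) (comp_head_under2 cf))) => v _ /=.
by elim: (a v) => [|n IH]; rewrite ?big_ord0 ?big_ord_recr //= IH.
Qed.

Lemma comp_all r a p : computable r a -> computableb r.+1 p ->
  computableb r (fun v => all (fun i => p (i :: v)) (iota 0 (a v))).
Proof.
move=> ca cp; apply: comp_ext (comp_iteri ca (comp_const r 1)
  (comp_mul (comp_nth r.+2 1) (comp_head_under2 cp))) => v _ /=.
elim: (a v) => [//|n IH]; rewrite [LHS]/= IH.
have -> : iota 0 n.+1 = rcons (iota 0 n) n by rewrite -addn1 iotaD cats1.
by rewrite all_rcons; case: (all _ _); case: (p _).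
Qed.

Lemma comp_has r a p : computable r a -> computableb r.+1 p ->
  computableb r (fun v => has (fun i => p (i :: v)) (iota 0 (a v))).
Proof.
move=> ca cp; apply: comp_ext (comp_not (comp_all ca (comp_not cp))) => v _.
by rewrite -has_predC; congr nat_of_bool; apply: eq_has => i /=; rewrite negbK.
Qed.

(** The quotient counts the [i < a] with [(i + 1) * b <= a]; the guard [0 < b] gives 0 for a zero
    divisor. *)
Lemma comp_div r a b : computable r a -> computable r b -> computable r (fun v => a v %/ b v).
Proof.
move=> ca cb; apply: comp_ext (comp_sum ca (comp_and (comp_ltn (comp_const r.+1 0) (comp_behead cb))
  (comp_leq (comp_mul (comp_succ (comp_nth r.+1 0)) (comp_behead cb)) (comp_behead ca)))) => v _ /=.
case: (posnP (b v)) => [->|b0].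
  by rewrite divn0 big1.
have dE i : (i.+1 * b v <= a v) = (i < a v %/ b v) by rewrite leq_divRL.
rewrite (eq_bigr (fun i : 'I_(a v) => (i < a v %/ b v : nat))) => [|i _]; last by rewrite dE.
have : a v %/ b v <= a v by apply: leq_div.
move: (a v) (a v %/ b v) => m; clear.
elim: m => [|m IH] d dm; first by rewrite big_ord0; case: d dm.
rewrite big_ord_recr /=; case: (ltnP m d) => h.
  have -> : d = m.+1 by lia.
  rewrite (eq_bigr (fun _ => 1)) => [|i _]; last by rewrite ltnS ltnW.
  by rewrite sum1_card card_ord addn1.
by rewrite IH ?addn0.
Qed.

Lemma comp_mod r a b : computable r a -> computable r b -> computable r (fun v => a v %% b v).
Proof.
move=> ca cb; apply: comp_ext (comp_sub ca (comp_mul (comp_div ca cb) cb)) => v _.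
by rewrite {1}(divn_eq (a v) (b v)) addKn.
Qed.

Lemma comp_half r a : computable r a -> computable r (fun v => (a v)./2).
Proof.
by move=> ca; apply: comp_ext (comp_div ca (comp_const r 2)) => v _; rewrite divn2.
Qed.

Lemma comp_logn2 r a : computable r a -> computable r (fun v => logn 2 (a v)).
Proof.
move=> ca; apply: comp_ext (comp_sum ca (comp_and
  (comp_ltn (comp_const r.+1 0) (comp_behead ca))
  (comp_eq (comp_mod (comp_behead ca) (comp_exp (comp_const r.+1 2) (comp_succ (comp_nth r.+1 0))))
           (comp_const r.+1 0)))) => v _ /=.
case: (posnP (a v)) => [->|a0]; first by rewrite big1 ?logn0.
rewrite logn_count_dvd //.
case: (a v) a0 => // n _; rewrite big_ord_recr big_add1 big_mkord /=.
have n2 : n.+1 < 2 ^ n.+1 by exact: ltn_expl.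
rewrite (modn_small n2) /=.
by rewrite addn0; apply: eq_bigr => i _; rewrite /dvdn.
Qed.

(** * Codes of automata and a program deciding [gamma w n <= c] *)

(** The code of [x :: s] is [2 ^ x] times an odd number whose half is the code of [s]. The empty
    list has code 0, which yields 0 again, in line with the default of [nth 0]. *)
Definition code_hd c := logn 2 c.
Definition code_tl c := (c %/ 2 ^ logn 2 c)./2.
Definition code_nth c i := code_hd (iter i code_tl c).

Lemma code_hdE x s : code_hd (CodeSeq.code (x :: s)) = x.
Proof.
by rewrite /code_hd /= lognM ?expn_gt0 // pfactorK // logn_coprime ?addn0 // coprime2n /= odd_double.
Qed.

Lemma code_tlE s : code_tl (CodeSeq.code s) = CodeSeq.code (behead s).
Proof.
case: s => [|x s] //; rewrite /code_tl -/(code_hd _) code_hdE /=.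
by rewrite mulKn ?expn_gt0 //= uphalf_double.
Qed.

Lemma code_nthE s i : code_nth (CodeSeq.code s) i = nth 0 s i.
Proof.
have -> : nth 0 s i = head 0 (drop i s) by rewrite -nth0 nth_drop addn0.
rewrite /code_nth; have -> : iter i code_tl (CodeSeq.code s) = CodeSeq.code (drop i s).
  elim: i => [|i IH]; first by rewrite drop0.
  by rewrite iterS IH code_tlE -drop1 drop_drop add1n.
by case: (drop i s) => [|x l]; [|exact: code_hdE].
Qed.

Definition code_delta a q d := code_nth (code_nth (code_hd a) q) d.
Definition code_tau a q := code_nth (code_hd (code_tl a)) q.

Lemma code_deltaE A q d : code_delta (codeA A) q d = delta A q d.
Proof.
rewrite /code_delta /codeA code_hdE code_nthE.
have -> : nth 0 (map CodeSeq.code (trans A)) q = CodeSeq.code (nth [::] (trans A) q).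
  case: (ltnP q (size (trans A))) => h; first by rewrite (nth_map [::]).
  by rewrite !nth_default ?size_map.
exact: code_nthE.
Qed.

Lemma code_tauE A q : code_tau (codeA A) q = tau A q.
Proof. by rewrite /code_tau /codeA code_tlE [behead _]/= code_hdE code_nthE. Qed.

(** [n] is read as [n] digits, most significant first; the state stays 0 during the leading zeros,
    which [rep] omits. *)
Definition code_state k a n :=
  iteri n (fun t q => if n %/ k ^ (n - t.+1) == 0 then 0
                      else code_delta a q (n %/ k ^ (n - t.+1) %% k)) 0.

Lemma code_stateE k A n : 1 < k -> code_state k (codeA A) n = state k A n.
Proof.
move=> k1; rewrite /code_state.
suff h t : t <= n -> iteri t (fun t q => if n %/ k ^ (n - t.+1) == 0 then 0
    else code_delta (codeA A) q (n %/ k ^ (n - t.+1) %% k)) 0 = state k A (n %/ k ^ (n - t)).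
  by rewrite h // subnn expn0 divn1.
elim: t => [|t IH] tn; first by rewrite subn0 (divn_small (ltn_expl n k1)).
rewrite /= IH ?(ltnW tn) //; case: eqP => [->|/eqP h] //.
rewrite [RHS]state_rec ?lt0n // code_deltaE; congr (delta A (state k A _) _).
by rewrite -divnMA -expnSr subnSK.
Qed.

Definition code_word k a n := code_tau a (code_state k a n).

Lemma code_wordE k A n : 1 < k -> code_word k (codeA A) n = aut_word k A n.
Proof. by move=> k1; rewrite /code_word code_stateE // code_tauE. Qed.

Definition radix_digit B b j := b %/ B ^ j %% B.

Lemma radix_onto B (xs : seq nat) c : 0 < B -> size xs <= c -> all (fun x => x < B) xs ->
  exists2 b, b < B ^ c & forall j, j < size xs -> radix_digit B b j = nth 0 xs j.
Proof.
move=> B0; elim: xs c => [|x xs IH] [|c] //; try by exists 0; rewrite ?expn_gt0 ?B0.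
rewrite ltnS /= => sc /andP[xB axs]; have [b bB hb] := IH c sc axs.
exists (b * B + x).
  apply: (@leq_trans (b.+1 * B)); first by rewrite mulSn addnC ltn_add2r.
  by rewrite expnSr leq_mul2r bB orbT.
case=> [|j] /= js; rewrite /radix_digit.
  by rewrite expn0 divn1 modnMDl modn_small.
by rewrite expnS divnMA divnMDl // (divn_small xB) addn0; apply: hb.
Qed.

Definition code_attracts k a n c b :=
  all (fun p => all (fun q => (p <= q) ==>
    has (fun p' => (p' + (q - p) < n) &&
      (all (fun j => code_word k a (p + j) == code_word k a (p' + j)) (iota 0 (q - p).+1) &&
       has (fun j => (p' <= radix_digit n.+1 b j) && (radix_digit n.+1 b j <= p' + (q - p)))
         (iota 0 c))) (iota 0 n)) (iota 0 n)) (iota 0 n).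

(** A list of [c] positions is a number in base [n + 1], which makes the search for an attractor
    bounded. *)
Definition code_gamma_le k a n c := has (code_attracts k a n c) (iota 0 (n.+1 ^ c)).

Lemma code_attractsP k A n c b : 1 < k ->
  reflect (attracts (aut_word k A) n [seq radix_digit n.+1 b j | j <- iota 0 c])
    (code_attracts k (codeA A) n c b).
Proof.
move=> k1; have io x m : (x \in iota 0 m) = (x < m) by rewrite mem_iota.
apply: (iffP allP) => h.
  move=> p q pq qn; have pn : p < n := leq_ltn_trans pq qn.
  have /allP/(_ q) := h p (etrans (io _ _) pn); rewrite io pq => /(_ qn) /hasP[p' p'n].
  move=> /and3P[h1 /allP h2 /hasP[j jc h3]]; exists p'; split=> //.
    by move=> j' jq; have := h2 j'; rewrite io ltnS !code_wordE // => /(_ jq)/eqP.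
  by exists (radix_digit n.+1 b j) => //; apply: map_f.
move=> p; rewrite io => pn; apply/allP => q; rewrite io => qn; apply/implyP => pq.
have [p' [h1 h2 [x /mapP[j jc ->] h3]]] := h p q pq qn.
apply/hasP; exists p'; first by rewrite io; apply: leq_ltn_trans h1; apply: leq_addr.
apply/and3P; split=> //; last by apply/hasP; exists j.
by apply/allP => j'; rewrite io ltnS => jq; rewrite !code_wordE //; apply/eqP/h2.
Qed.

Lemma code_gamma_leE k A n c : 1 < k ->
  code_gamma_le k (codeA A) n c = (gamma (aut_word k A) n <= c).
Proof.
move=> k1; apply/hasP/gamma_leP => [[b _ /(code_attractsP _ _ _ _ k1) h]|[xs sc axs]].
  by exists [seq radix_digit n.+1 b j | j <- iota 0 c] => //; rewrite size_map size_iota.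
(* Positions beyond [n] are dropped to fit the base; occurrences inside the prefix cannot contain
   them. *)
pose ys := [seq x <- xs | x < n.+1].
have sy : size ys <= c by apply: leq_trans sc; rewrite size_filter count_size.
have ayn : all (fun x => x < n.+1) ys by apply: filter_all.
have [b bn hb] := radix_onto (ltn0Sn n) sy ayn.
exists b; first by rewrite mem_iota.
apply/code_attractsP => // p q pq qn; have [p' [h1 h2 [x xx h3]]] := axs p q pq qn.
exists p'; split=> //; exists x => //.
have xy : x \in ys by rewrite mem_filter xx andbT; clear -h1 h3; lia.
apply/mapP; exists (index x ys).
  by rewrite mem_iota /= (leq_trans _ sy) // index_mem.
by rewrite hb ?index_mem // nth_index.
Qed.

Lemma comp_code_hd r a : computable r a -> computable r (fun v => code_hd (a v)).
Proof. exact: comp_logn2. Qed.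

Lemma comp_code_tl r a : computable r a -> computable r (fun v => code_tl (a v)).
Proof.
by move=> ca; apply/comp_half/comp_div => //; apply: comp_exp; [exact: comp_const|exact: comp_logn2].
Qed.

Lemma comp_code_nth r a b : computable r a -> computable r b -> computable r (fun v => code_nth (a v) (b v)).
Proof.
move=> ca cb; apply: comp_code_hd.
apply: comp_ext (comp_iteri cb ca (comp_code_tl (comp_nth r.+2 1))) => v _ /=.
by elim: (b v) => //= n ->.
Qed.

Lemma comp_code_delta r a b c : computable r a -> computable r b -> computable r c ->
  computable r (fun v => code_delta (a v) (b v) (c v)).
Proof. by move=> ca cb cc; do 2 apply: comp_code_nth => //; apply: comp_code_hd. Qed.

Lemma comp_code_state r a b c : computable r a -> computable r b -> computable r c ->
  computable r (fun v => code_state (a v) (b v) (c v)).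
Proof.
move=> ca cb cc; have c2 := comp_under2 cc; have a2 := comp_under2 ca.
have cy : computable r.+2 (fun v => c (behead (behead v)) %/
    a (behead (behead v)) ^ (c (behead (behead v)) - (nth 0 v 0).+1)).
  apply: comp_div => //; apply: comp_exp => //; apply: comp_sub => //; apply: comp_succ.
  exact: comp_nth.
have cg := comp_if (comp_eq cy (comp_const r.+2 0)) (comp_const r.+2 0)
  (comp_code_delta (comp_under2 cb) (comp_nth r.+2 1) (comp_mod cy a2)).
exact: (comp_iteri cc (comp_const r 0) cg).
Qed.

Lemma comp_code_word r a b c : computable r a -> computable r b -> computable r c ->
  computable r (fun v => code_word (a v) (b v) (c v)).
Proof.
move=> ca cb cc; apply: comp_code_nth; last exact: comp_code_state.
exact/comp_code_hd/comp_code_tl.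
Qed.

Lemma comp_radix_digit r a b c : computable r a -> computable r b -> computable r c ->
  computable r (fun v => radix_digit (a v) (b v) (c v)).
Proof. by move=> ca cb cc; apply: comp_mod => //; apply: comp_div => //; apply: comp_exp. Qed.

Lemma comp_code_attracts r a b c d e : computable r a -> computable r b ->
  computable r c -> computable r d -> computable r e ->
  computableb r (fun v => code_attracts (a v) (b v) (c v) (d v) (e v)).
Proof.
move=> ca cb cc cd ce.
have ca1 := comp_behead ca; have ca2 := comp_behead ca1; have ca3 := comp_behead ca2.
have ca4 := comp_behead ca3; have cb1 := comp_behead cb; have cb2 := comp_behead cb1.
have cb3 := comp_behead cb2; have cb4 := comp_behead cb3.
have cc1 := comp_behead cc; have cc2 := comp_behead cc1; have cc3 := comp_behead cc2.
have cc4 := comp_behead cc3; have cd3 := comp_behead (comp_behead (comp_behead cd)).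
have ce4 := comp_behead (comp_behead (comp_behead (comp_behead ce))).
have qp3 := comp_sub (comp_nth r.+3 1) (comp_nth r.+3 2).
have qp4 := comp_sub (comp_nth r.+4 2) (comp_nth r.+4 3).
have dig := comp_radix_digit (comp_succ cc4) ce4 (comp_nth r.+4 0).
have H1 := comp_ltn (comp_add (comp_nth r.+3 0) qp3) cc3.
have H2 := comp_all (comp_succ qp3) (comp_eq
   (comp_code_word ca4 cb4 (comp_add (comp_nth r.+4 3) (comp_nth r.+4 0)))
   (comp_code_word ca4 cb4 (comp_add (comp_nth r.+4 1) (comp_nth r.+4 0)))).
have H3 := comp_has cd3 (comp_and (comp_leq (comp_nth r.+4 1) dig)
   (comp_leq dig (comp_add (comp_nth r.+4 1) qp4))).
exact: (comp_all cc (comp_all cc1 (comp_imp (comp_leq (comp_nth r.+2 1) (comp_nth r.+2 0))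
   (comp_has cc2 (comp_and H1 (comp_and H2 H3)))))).
Qed.

Lemma comp_code_gamma_le r a b c d : computable r a -> computable r b -> computable r c -> computable r d ->
  computableb r (fun v => code_gamma_le (a v) (b v) (c v) (d v)).
Proof.
move=> ca cb cc cd; apply: (comp_has (p := fun v =>
  code_attracts (a (behead v)) (b (behead v)) (c (behead v)) (d (behead v)) (nth 0 v 0))).
  by apply: comp_exp => //; exact: comp_succ.
by apply: comp_code_attracts; (try by apply: comp_behead); exact: comp_nth.
Qed.

(** * Recognizability with computable state bounds *)

(* The number of states has to be computable from the code of the index: [arg i]
   lists the base, the code of the automaton and possibly further parameters. *)
Section ComputablyRegular.
Variables (I : Type) (r : nat) (arg : I -> seq nat) (kk : I -> nat) (AA : I -> DFAO).
Hypothesis kk1 : forall i, 1 < kk i.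
Hypothesis argk : forall i, nth 0 (arg i) 0 = kk i.
Hypothesis argA : forall i, nth 0 (arg i) 1 = codeA (AA i).

Definition creg (P : I -> env -> Prop) :=
  exists b, computable r b /\ forall i, reg (kk i) (b (arg i)) (P i).

Lemma creg_ext P Q : (forall i e, P i e <-> Q i e) -> creg P -> creg Q.
Proof. by move=> PQ [b [cb hb]]; exists b; split=> // i; apply: reg_ext (hb i). Qed.

Lemma creg_const n P : (forall i, reg (kk i) n (P i)) -> creg P.
Proof. by move=> h; exists (fun _ => n); split=> //; exact: comp_const. Qed.

Lemma creg_not P : creg P -> creg (fun i e => ~ P i e).
Proof. by move=> [b [cb hb]]; exists b; split=> // i; apply: reg_not. Qed.

Lemma creg_and P Q : creg P -> creg Q -> creg (fun i e => P i e /\ Q i e).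
Proof.
move=> [b [cb hb]] [c [cc hc]]; exists (fun v => b v * c v); split; first exact: comp_mul.
by move=> i; apply: reg_and.
Qed.

Lemma creg_imp P Q : creg P -> creg Q -> creg (fun i e => P i e -> Q i e).
Proof.
move=> [b [cb hb]] [c [cc hc]]; exists (fun v => b v * c v); split; first exact: comp_mul.
by move=> i; apply: reg_imp.
Qed.

Lemma creg_or P Q : creg P -> creg Q -> creg (fun i e => P i e \/ Q i e).
Proof.
move=> [b [cb hb]] [c [cc hc]]; exists (fun v => b v * c v); split; first exact: comp_mul.
by move=> i; apply: reg_or.
Qed.

Lemma creg_ex P : creg P -> creg (fun i e => exists y, P i (scons y e)).
Proof.
move=> [b [cb hb]]; exists (fun v => 2 ^ b v); split.
  by apply: comp_exp => //; exact: comp_const.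
by move=> i; apply: reg_ex (hb i); exact: ltnW.
Qed.

Lemma creg_all P : creg P -> creg (fun i e => forall y, P i (scons y e)).
Proof.
move=> [b [cb hb]]; exists (fun v => 2 ^ b v); split.
  by apply: comp_exp => //; exact: comp_const.
by move=> i; apply: reg_all (hb i); exact: ltnW.
Qed.

Lemma creg_leq (a b : I -> nat) : creg (fun i e => e (a i) <= e (b i)).
Proof. by apply: creg_const => i; exact: reg_leq. Qed.

Lemma creg_ltn (a b : I -> nat) : creg (fun i e => e (a i) < e (b i)).
Proof. by apply: creg_const => i; exact: reg_ltn. Qed.

Lemma creg_eq (a b : I -> nat) : creg (fun i e => e (a i) = e (b i)).
Proof. by apply: creg_const => i; exact: reg_eq. Qed.

Lemma creg_add (a b c : I -> nat) : creg (fun i e => e (a i) + e (b i) = e (c i)).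
Proof. by apply: creg_const => i; exact: reg_add. Qed.

Lemma creg_floor (a b c : I -> nat) :
  creg (fun i e => is_floor (kk i) (e (a i)) (e (b i)) (e (c i))).
Proof. by apply: creg_const => i; exact: reg_floor. Qed.

Lemma creg_mulk (a b : I -> nat) : creg (fun i e => e (b i) = kk i * e (a i)).
Proof.
exists (fun v => (nth 0 v 0).+1); split; first by apply: comp_succ; exact: comp_nth.
by move=> i; rewrite argk; exact: reg_mulk.
Qed.

Lemma creg_word (a b : I -> nat) :
  creg (fun i e => aut_word (kk i) (AA i) (e (a i)) = aut_word (kk i) (AA i) (e (b i))).
Proof.
pose n v := (nth 0 v 1).+1 * 2; have cn : computable r n.
  by apply: comp_mul; [apply: comp_succ; exact: comp_nth|exact: comp_const].
exists (fun v => n v * n v); split; first exact: comp_mul.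
by move=> i; rewrite /n argA; exact: reg_word.
Qed.

Lemma creg_rename P rho : creg P -> creg (fun i e => P i (fun j => e (rho j))).
Proof. by move=> [b [cb hb]]; exists b; split=> // i; apply: reg_rename. Qed.

Lemma creg_ltn_add (a b c d : I -> nat) :
  creg (fun i e => e (a i) + e (b i) < e (c i) + e (d i)).
Proof.
have h1 := creg_add (fun i => (a i).+2) (fun i => (b i).+2) (fun _ => 1).
have h2 := creg_add (fun i => (c i).+2) (fun i => (d i).+2) (fun _ => 0).
have h3 := creg_ltn (fun _ => 1) (fun _ => 0).
apply: creg_ext (creg_ex (creg_ex (creg_and h1 (creg_and h2 h3)))) => i e /=.
by split=> [[x [y [-> [-> ]]]]|h] //; exists (e (a i) + e (b i)), (e (c i) + e (d i)).
Qed.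

Let w i := aut_word (kk i) (AA i).

Lemma creg_occ (s t p : I -> nat) : creg (fun i e => occ (w i) (e (s i)) (e (t i)) (e (p i))).
Proof.
have h1 := creg_add (fun i => (p i).+3) (fun _ => 2) (fun _ => 1).
have h2 := creg_add (fun i => (s i).+3) (fun _ => 2) (fun _ => 0).
have h3 := creg_ltn (fun _ => 0) (fun i => (t i).+3).
have h4 := creg_word (fun _ => 1) (fun _ => 0).
apply: creg_ext (creg_all (creg_all (creg_all (creg_imp h1 (creg_imp h2 (creg_imp h3 h4))))))
  => i e /=.
split=> [h j jt|h j x y <- <- lt]; last by apply: h; rewrite ltn_subRL.
by apply: (h j _ _ (erefl _) (erefl _)); rewrite -ltn_subRL.
Qed.

Lemma creg_hit (s t x : I -> nat) : creg (fun i e => hit (w i) (e (s i)) (e (t i)) (e (x i))).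
Proof.
have h1 := creg_leq (fun _ => 0) (fun i => (x i).+1).
have h2 := creg_ltn_add (fun i => (s i).+1) (fun i => (x i).+1) (fun _ => 0) (fun i => (t i).+1).
have h3 := creg_occ (fun i => (s i).+1) (fun i => (t i).+1) (fun _ => 0).
apply: creg_ext (creg_ex (creg_and h1 (creg_and h2 h3))) => i e /=.
split=> [[p [p1 [p2 p3]]]|[p [p1 p2 p3]]]; exists p; split=> //.
  by clear -p1 p2; lia.
by split=> //; clear -p1 p2; lia.
Qed.

Lemma creg_hit_sub (s t s' t' : I -> nat) :
  creg (fun i e => hit_sub (w i) (e (s i)) (e (t i)) (e (s' i)) (e (t' i))).
Proof.
exact: (creg_all (creg_imp (creg_hit (fun i => (s i).+1) (fun i => (t i).+1) (fun _ => 0))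
  (creg_hit (fun i => (s' i).+1) (fun i => (t' i).+1) (fun _ => 0)))).
Qed.

Let u i (e : env) a := power_part (kk i) (e a).
Let c i := level_width (kk i).

(** Multiplying block indices by [u] turns them into floors, and the distances into sums and
    repeated multiples. If [x] is not a power of [k], both sides are false. *)
Lemma level_factorP k x s t : 1 < k ->
  level_factor (power_part k x) (level_width k) s t <->
  exists fs ft, [/\ is_floor k x s fs, is_floor k x t ft, fs + (x + x + (x + x)) <= ft &
                    ft <= fs + k * (k * (k * (k * x)))].
Proof.
move=> k1; rewrite /power_part /level_factor; case: asboolP => [[i ->]|nx]; last first.
  by rewrite !divn0; split=> // -[fs [ft [[i xE _] _ _ _]]]; case: nx; exists i.
have u0 := expk_gt0 k1 i; set z := k ^ i in u0 *.
have flE y f : is_floor k z y f <-> f = y %/ z * z.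
  by split=> [[j _ ->]|->] //; exists i.
have e4 : z + z + (z + z) = 4 * z by clear; lia.
have ek : k * (k * (k * (k * z))) = k ^ 4 * z by rewrite !expnS expn0 muln1 -!mulnA.
split=> [/andP[h1 h2]|[fs [ft [/flE-> /flE->]]]].
  exists (s %/ z * z), (t %/ z * z).
  by split; rewrite ?flE // ?e4 ?ek -mulnDl leq_pmul2r.
by rewrite e4 ek -!mulnDl !leq_pmul2r // => -> ->.
Qed.

Lemma creg_level_factor (a s t : I -> nat) :
  creg (fun i e => level_factor (u i e (a i)) (c i) (e (s i)) (e (t i))).
Proof.
(* Ten auxiliary variables name the terms: 9 to 6 hold [k * x] to [k ^ 4 * x], 5 and 4 hold [2 * x]
   and [4 * x], 3 and 2 the floors, 1 and 0 the two sums. *)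
pose up (f : I -> nat) i := (f i).+4.+4.+2.
pose K (n : nat) (_ : I) := n.
have h1 := creg_floor (up a) (up s) (K 3).
have h2 := creg_floor (up a) (up t) (K 2).
have m1 := creg_mulk (up a) (K 9); have m2 := creg_mulk (K 9) (K 8).
have m3 := creg_mulk (K 8) (K 7); have m4 := creg_mulk (K 7) (K 6).
have d1 := creg_add (up a) (up a) (K 5); have d2 := creg_add (K 5) (K 5) (K 4).
have d3 := creg_add (K 3) (K 4) (K 1); have d4 := creg_add (K 3) (K 6) (K 0).
have l1 := creg_leq (K 1) (K 2); have l2 := creg_leq (K 2) (K 0).
have b1 := creg_and m1 (creg_and m2 (creg_and m3 (creg_and m4 (creg_and d1 d2)))).
have b2 := creg_and d3 (creg_and d4 (creg_and l1 l2)).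
have b := creg_and h1 (creg_and h2 (creg_and b1 b2)).
apply: creg_ext (creg_ex (creg_ex (creg_ex (creg_ex (creg_ex
  (creg_ex (creg_ex (creg_ex (creg_ex (creg_ex b)))))))))) => i e.
rewrite level_factorP // /K /up /=; split.
  move=> [v1 [v2 [v3 [v4 [x2 [x4 [fs [ft [z [y [f1 [f2 [hb1 [z1 [y1 [z2 y2]]]]]]]]]]]]]]]].
  move: hb1 => [e1 [e2 [e3 [e4 [e5 e6]]]]].
  by exists fs, ft; split=> //; rewrite -?e1 -?e2 -?e3 -?e4 ?e5 ?e6 ?z1 ?y1.
move=> [fs [ft [f1 f2 g1 g2]]].
pose x := e (a i); pose k := kk i; pose x4 := x + x + (x + x).
exists (k * x), (k * (k * x)), (k * (k * (k * x))), (k * (k * (k * (k * x)))).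
by exists (x + x), x4, fs, ft, (fs + x4), (fs + k * (k * (k * (k * x)))).
Qed.

Lemma creg_minimal_factor (a s t : I -> nat) :
  creg (fun i e => minimal_factor (w i) (u i e (a i)) (c i) (e (s i)) (e (t i))).
Proof.
apply: creg_and; first exact: creg_level_factor.
pose up (f : I -> nat) i := (f i).+2; pose K (n : nat) (_ : I) := n.
exact: (creg_all (creg_all (creg_imp (creg_level_factor (up a) (K 1) (K 0))
  (creg_imp (creg_hit_sub (K 1) (K 0) (up s) (up t)) (creg_hit_sub (up s) (up t) (K 1) (K 0)))))).
Qed.

Lemma creg_lexlt (s' t' s t : I -> nat) :
  creg (fun i e => lexlt (e (s' i)) (e (t' i)) (e (s i)) (e (t i))).
Proof.
exact: (creg_or (creg_ltn s' s) (creg_and (creg_eq s' s) (creg_ltn t' t))).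
Qed.

Lemma creg_canonical (a s t : I -> nat) :
  creg (fun i e => canonical_factor (w i) (u i e (a i)) (c i) (e (s i)) (e (t i))).
Proof.
apply: creg_and; first exact: creg_minimal_factor.
pose up (f : I -> nat) i := (f i).+2; pose K (n : nat) (_ : I) := n.
exact: (creg_all (creg_all (creg_imp (creg_minimal_factor (up a) (K 1) (K 0))
  (creg_imp (creg_hit_sub (K 1) (K 0) (up s) (up t)) (creg_imp
   (creg_hit_sub (up s) (up t) (K 1) (K 0)) (creg_not (creg_lexlt (K 1) (K 0) (up s) (up t)))))))).
Qed.

(** [81 = 3 * (9 * 3)] bounds the states for [lexlt]; the two exponentials come from the two
    quantifiers. *)
Lemma reg_rank_step k F (X : nat -> nat -> nat -> Prop) : 1 < k ->
  reg k F (fun e => X (e 0) (e 1) (e 2)) ->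
  reg k (F * 2 ^ (2 ^ (81 * F))) (fun e => X (e 0) (e 1) (e 2) /\
    exists s' t', lexlt s' t' (e 1) (e 2) /\ X (e 0) s' t').
Proof.
move=> k1 rX; apply: reg_and => //; have k0 := ltnW k1.
have rlex : reg k 81 (fun e => lexlt (e 1) (e 0) (e 3) (e 4)).
  exact: (reg_or (reg_ltn k 1 3) (reg_and (reg_eq k 1 3) (reg_ltn k 0 4))).
exact: (reg_ex k0 (reg_ex k0 (reg_and rlex (reg_rename (nth 0 [:: 2; 1; 0]) rX)))).
Qed.

(** The formula grows with the rank, which depends on the instance, so its state bound iterates the
    cost of one step. *)
Lemma creg_rank (J : seq nat -> nat) (jj : I -> nat) : computable r J ->
  (forall i, J (arg i) = jj i) ->
  creg (fun i e => rank_ge (w i) (u i e 0) (c i) (jj i) (e 1) (e 2)).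
Proof.
move=> cJ hJ; have [b [cb hb]] := creg_canonical (fun _ => 0) (fun _ => 1) (fun _ => 2).
pose h F := F * 2 ^ (2 ^ (81 * F)).
exists (fun v => iteri (J v) (fun _ F => h F) (b v)); split.
  apply: (@comp_iteri r J b (fun v => h (nth 0 v 1))) => //.
  apply: comp_mul; first exact: comp_nth.
  do 2 (apply: comp_exp; first exact: comp_const).
  by apply: comp_mul; [exact: comp_const|exact: comp_nth].
move=> i; rewrite hJ; elim: (jj i) => [|j IH]; first exact: hb.
exact: (reg_rank_step (X := fun x s t => rank_ge (w i) (power_part (kk i) x) (c i) j s t)).
Qed.

Lemma creg_requirement (J : seq nat -> nat) (jj : I -> nat) : computable r J ->
  (forall i, J (arg i) = jj i) ->
  creg (fun i e => requirement (w i) (u i e 0) (c i) (jj i) (e 1)).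
Proof.
move=> cJ hJ; have r1 := creg_rank cJ hJ.
have r2 := @creg_rank (fun v => (J v).+1) (fun i => (jj i).+1) (comp_succ cJ)
  (fun i => congr1 S (hJ i)).
pose rho := nth 0 [:: 2; 1; 0].
exact: (creg_all (creg_all (creg_imp (creg_rename rho r1) (creg_imp (creg_not (creg_rename rho r2))
  (creg_hit (fun _ => 1) (fun _ => 0) (fun _ => 3)))))).
Qed.

Lemma reg_exists_list k F m Q : 0 < k -> reg k F Q ->
  reg k (iter m (expn 2) F) (fun e => exists2 xs, size xs = m & Q (foldr scons e xs)).
Proof.
move=> k0; elim: m F Q => [|m IH] F Q rQ.
  apply: reg_ext rQ => e; split=> [h|[[|//] _ //]]; by exists [::].
rewrite iterSr; apply: reg_ext (IH _ _ (reg_ex k0 rQ)) => e.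
split=> [[xs sx [y h]]|[xs sx h]].
  by exists (y :: xs); rewrite /= ?sx.
by case: xs sx h => // y xs [sx] h; exists xs => //; exists y.
Qed.

Lemma foldr_scons e (xs : seq nat) t : foldr scons e xs t =
  if t < size xs then nth 0 xs t else e (t - size xs).
Proof. by elim: xs t => [|x xs IH] [|t] //=; rewrite ?subn0 // IH. Qed.

Lemma reg_hits_list k m a : reg k (9 ^ m) (fun e => exists2 t, t < m & e 1 <= e (a + t) <= e 0).
Proof.
elim: m => [|m IH].
  by apply: reg_ext (reg_const k False) => e; split=> // -[].
have r1 := reg_and (reg_leq k 1 (a + m)) (reg_leq k (a + m) 0).
rewrite expnSr; apply: reg_ext (reg_or IH r1) => e; split.
  by case=> [[t tc h]|[h1 h2]]; [exists t => //; apply: ltnW|exists m; rewrite ?h1].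
move=> [t]; rewrite ltnS leq_eqVlt => /orP[/eqP->/andP[]|tc h]; [by right|by left; exists t].
Qed.

(** Padding with zeros makes the number of points exactly [m], to match a block of [m]
    quantifiers. *)
Lemma gamma_le_list v n m : gamma v n <= m <-> exists2 xs, size xs = m & attracts v n xs.
Proof.
split=> [/gamma_leP[xs sx axs]|[xs sx axs]]; last by apply/gamma_leP; exists xs; rewrite ?sx.
exists (xs ++ nseq (m - size xs) 0); first by rewrite size_cat size_nseq subnKC.
move=> p q pq qn; have [p' [h1 h2 [x xx h3]]] := axs p q pq qn.
by exists p'; split=> //; exists x; rewrite // mem_cat xx.
Qed.

Lemma creg_gamma_le (J : seq nat -> nat) (jj : I -> nat) : computable r J ->
  (forall i, J (arg i) = jj i) -> creg (fun i e => gamma (w i) (e 0) <= jj i).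
Proof.
move=> cJ hJ; pose K (n : nat) (_ : I) := n; pose n4 i := (jj i).+4.
(* The points are the variables below [jj i] and the prefix length is variable [jj i]; the end [r']
   of the occurrence, fixed by [p' + q = p + r'], avoids subtraction. *)
have body : creg (fun i e => forall p q, p <= q -> q < e (jj i) -> exists p' r',
  [/\ p' + q = p + r', r' < e (jj i),
     forall j x y, p + j = x -> x <= q -> p' + j = y -> w i x = w i y &
     exists2 t, t < jj i & p' <= e t <= r']).
  have g1 := creg_add (K 2) (K 3) (K 0); have g1' := creg_add (K 4) (K 1) (K 0).
  have e1 : creg (fun i e => e 1 + e 2 = e 3 + e 0).
    apply: creg_ext (creg_ex (creg_and g1 g1')) => i e /=.
    by split=> [[x [-> ->]]|->] //; exists (e 3 + e 0).
  have e2 := creg_ltn (K 0) n4.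
  have f1 := creg_add (K 6) (K 2) (K 1); have f2 := creg_leq (K 1) (K 5).
  have f3 := creg_add (K 4) (K 2) (K 0); have f4 := creg_word (K 1) (K 0).
  have e3 := creg_all (creg_all (creg_all (creg_imp f1 (creg_imp f2 (creg_imp f3 f4))))).
  have e4 : creg (fun i e => exists2 t, t < jj i & e 1 <= e (4 + t) <= e 0).
    exists (fun v => 9 ^ J v); split; first by apply: comp_exp => //; exact: comp_const.
    by move=> i; rewrite hJ; exact: reg_hits_list.
  have ee := creg_ex (creg_ex (creg_and e1 (creg_and e2 (creg_and e3 e4)))).
  have g2 := creg_leq (K 1) (K 0); have g3 := creg_ltn (K 0) (fun i => (jj i).+2).
  apply: creg_ext (creg_all (creg_all (creg_imp g2 (creg_imp g3 ee)))) => i e.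
  split=> h p q pq qn.
    by have [p' [r' [h1 [h2 [h3 h4]]]]] := h p q pq qn; exists p', r'; split.
  by have [p' [r' [h1 h2 h3 h4]]] := h p q pq qn; exists p', r'.
have [b [cb hb]] := body.
exists (fun v => iteri (J v) (fun _ F => 2 ^ F) (b v)); split.
  apply: (@comp_iteri r J b (fun v => 2 ^ nth 0 v 1)) => //.
  by apply: comp_exp; [exact: comp_const|exact: comp_nth].
move=> i; have k0 := ltnW (kk1 i); rewrite hJ.
have -> : iteri (jj i) (fun _ F => 2 ^ F) (b (arg i)) = iter (jj i) (expn 2) (b (arg i)).
  by elim: (jj i) => //= n ->.
apply: reg_ext (reg_exists_list (jj i) k0 (hb i)) => e; rewrite gamma_le_list.
have E xs p' r' : size xs = jj i -> (exists2 t, t < jj i & p' <= foldr scons e xs t <= r') <->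
    (exists2 x, x \in xs & p' <= x <= r').
  move=> sx; split=> [[t tj]|[x xx h]].
    by rewrite foldr_scons sx tj => h; exists (nth 0 xs t) => //; rewrite mem_nth ?sx.
  exists (index x xs); first by rewrite -sx index_mem.
  by rewrite foldr_scons index_mem xx nth_index.
have En xs : size xs = jj i -> foldr scons e xs (jj i) = e 0.
  by move=> sx; rewrite foldr_scons sx ltnn subnn.
split=> -[xs sx h]; exists xs => // p q pq qn.
  have [|p' [r' [h1 h2 h3 h4]]] := h p q pq; first by rewrite En.
  rewrite (En _ sx) in h2; have rE : r' = p' + (q - p) by clear -h1 pq; lia.
  rewrite rE in h2 h4; exists p'; split=> //; last exact/(E xs).
  by move=> j jq; apply: h3 (erefl _) _ (erefl _); clear -jq pq; lia.
rewrite (En _ sx) in qn *; have [p' [h1 h2 h3]] := h p q pq qn.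
exists p', (p' + (q - p)); split=> //; first by clear -pq; lia.
  by move=> j x y <- xq <-; apply: h2; clear -xq; lia.
exact/(E xs).
Qed.
End ComputablyRegular.

(** * The dichotomy and its decision *)

Definition instance := {p : nat * DFAO * nat | 1 < p.1.1}.
Definition iarg (i : instance) := [:: (val i).1.1; codeA (val i).1.2; (val i).2].

Definition inst k A j (k1 : 1 < k) : instance := exist (fun p => 1 < p.1.1) (k, A, j) k1.

Lemma requirement_states : exists b, computable 3 b /\ forall k A j, 1 < k ->
  reg k (b [:: k; codeA A; j]) (fun e =>
    requirement (aut_word k A) (power_part k (e 0)) (level_width k) j (e 1)).
Proof.
have [b [cb hb]] := @creg_requirement instance 3 iarg (fun i => (val i).1.1) (fun i => (val i).1.2)
  (fun i => valP i) (fun i => erefl _) (fun i => erefl _) (fun v => nth 0 v 2) (fun i => (val i).2)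
  (comp_nth 3 2) (fun i => erefl _).
exists b; split=> // k A j k1; exact: (hb (inst A j k1)).
Qed.

Lemma gamma_states : exists b, computable 3 b /\ forall k A c, 1 < k ->
  reg k (b [:: k; codeA A; c]) (fun e => gamma (aut_word k A) (e 0) <= c).
Proof.
have [b [cb hb]] := @creg_gamma_le instance 3 iarg (fun i => (val i).1.1) (fun i => (val i).1.2)
  (fun i => valP i) (fun i => erefl _) (fun v => nth 0 v 2) (fun i => (val i).2)
  (comp_nth 3 2) (fun i => erefl _).
exists b; split=> // k A j k1; exact: (hb (inst A j k1)).
Qed.

Lemma comp_gamma_bound r a b c : computable r a -> computable r b -> computable r c ->
  computable r (fun v => gamma_bound (a v) (b v) (c v)).
Proof.
move=> ca cb cc; have N n := comp_const r n.
have cN := comp_mul (comp_succ cb) (N 2).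
have cP := comp_mul cc (comp_exp (N 2) cc); have cE := comp_exp (N 2) cP.
have cw := comp_exp ca (N 4); have ck := comp_exp cN (comp_add cw (N 4)).
have cf := comp_mul (comp_mul ck (comp_succ cw))
  (comp_mul (N 3) (comp_mul (comp_succ (comp_mul (N 2) ck)) (comp_succ ck))).
exact: (comp_add (comp_exp ca (comp_add (comp_mul cN cN) (comp_add cE (N 3))))
  (comp_add (comp_mul cf (comp_fact cE)) (comp_exp ca (comp_add (comp_mul (N 2) cP) (N 5))))).
Qed.

Lemma comp_requirement_count r a b : computable r a -> computable r b ->
  computable r (fun v => requirement_count (a v) (b v)).
Proof.
move=> ca cb; have N n := comp_const r n.
have cN := comp_mul (comp_succ cb) (N 2).
have cw := comp_exp ca (N 4); have ck := comp_exp cN (comp_add cw (N 4)).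
exact: (comp_mul (comp_mul ck (comp_succ cw))
  (comp_mul (N 3) (comp_mul (comp_succ (comp_mul (N 2) ck)) (comp_succ ck)))).
Qed.

Lemma computable_dichotomy : exists C, computable 2 (fun v => C (nth 0 v 0) (nth 0 v 1)) /\
  forall k A, 1 < k -> (forall n, gamma (aut_word k A) n <= C k (codeA A)) \/
  exists a b, forall n, 0 < n -> trunc_log k n <= a * gamma (aut_word k A) n + b.
Proof.
have [b [cb hb]] := requirement_states.
(* The sum is a common bound on the numbers of states of all requirements. *)
pose F k a := \sum_(j < requirement_count k a) b [:: k; a; nat_of_ord j].
exists (fun k a => gamma_bound k a (F k a)); split.
  apply: comp_gamma_bound; try exact: comp_nth.
  have cr := comp_requirement_count (comp_nth 2 0) (comp_nth 2 1).
  exact: (comp_sum cr (comp_proj 3 (erefl (size [:: 1; 2; 0])) cb)).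
move=> k A k1; apply: gamma_dichotomy => // j jD; apply: reg_le (hb k A j k1).
by rewrite /F (bigD1 (Ordinal jD)) //= leq_addr.
Qed.

(** * Finite checks and construction of automata *)

Section SmallCheck.
Variables (k : nat) (k1 : 1 < k).

Lemma reg_automaton F (P : nat -> Prop) : reg k F (fun e => P (e 0)) ->
  exists (T : finType) (f : nat -> T) (g : T -> nat -> T) (acc : T -> bool),
    [/\ #|T| <= F, forall x d, d < k -> f (k * x + d) = g (f x) d & forall x, P x <-> acc (f x)].
Proof.
move=> [T [cls [step [acc [TF cs ac]]]]].
exists T, (fun x => cls (scons x (fun _ => 0))), (fun t d => step t (scons d (fun _ => 0))), acc.
split=> // [x d dk|x]; last exact: (ac (scons x _)).
rewrite -cs; last by case=> //= _; apply: ltnW.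
by congr cls; apply/funext => -[|i] //=; rewrite /shift /= muln0.
Qed.

Lemma reg_small_check F (P : nat -> Prop) : reg k F (fun e => P (e 0)) ->
  (forall n, n < k ^ F -> P n) -> forall n, P n.
Proof.
move=> /reg_automaton[T [f [g [acc [TF fg fP]]]]] h n.
have [y yk fy] := aut_small_witness k1 fg n.
by rewrite fP -fy -fP; apply: h; apply: leq_trans yk _; rewrite leq_exp2l.
Qed.

(** The sequence in (iii) starts with the value at 1, so its automaton has to follow [n + 1] while
    reading [n]. *)
Lemma succ_automaton (T : finType) (f : nat -> T) (g : T -> nat -> T) :
  (forall x d, d < k -> f (k * x + d) = g (f x) d) ->
  exists g' : T * T -> nat -> T * T,
    forall x d, d < k -> (f (k * x + d), f (k * x + d).+1) = g' (f x, f x.+1) d.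
Proof.
move=> fg; exists (fun c d => (g c.1 d, if d.+1 < k then g c.1 d.+1 else g c.2 0)).
move=> x d dk; rewrite /= fg // -addnS; congr pair.
case: (ltnP d.+1 k) => h; first by rewrite fg.
by rewrite -fg ?(ltnW k1) // mulnS addn0 addnC; congr (f (_ + _)); lia.
Qed.

Lemma dfao_of_automaton (T : finType) (f : nat -> T) (g : T -> nat -> T) (out : T -> nat) :
  (forall x d, d < k -> f (k * x + d) = g (f x) d) ->
  exists B, forall n, aut_word k B n = out (f n).
Proof.
(* [f 0] comes first since the start state of a [DFAO] is 0; its repetition is harmless because
   [index] finds the first entry. *)
move=> fg; pose s := f 0 :: enum T.
have sT t : t \in s by rewrite inE mem_enum orbT.
pose B := MkDFAO [seq [seq index (g t d) s | d <- iota 0 k] | t <- s] (map out s).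
have dB t d : d < k -> delta B (index t s) d = index (g t d) s.
  move=> dk; rewrite /delta (nth_map (f 0)) ?index_mem // nth_index //.
  by rewrite (nth_map 0) ?size_iota // nth_iota.
have stB n : state k B n = index (f n) s.
  elim/ltn_ind: n => -[_|n IH]; first by rewrite /state /= eqxx.
  rewrite state_rec // IH ?ltn_Pdiv // dB ?ltn_mod ?(ltnW k1) //.
  by rewrite -fg ?ltn_mod ?(ltnW k1) // mulnC -divn_eq.
exists B => n; rewrite /aut_word -/(state k B n) stB /tau.
by rewrite (nth_map (f 0)) ?index_mem // nth_index.
Qed.

(** Thresholds are added one at a time: [minn h C.+1] is [minn h C] if [h <= C], and [C.+1]
    otherwise. *)
Lemma shifted_bounded_automatic (h : nat -> nat) (F : nat -> nat) C :
  (forall c, reg k (F c) (fun e => h (e 0) <= c)) -> (forall n, h n <= C) ->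
  exists B, forall n, aut_word k B n = h n.+1.
Proof.
move=> rh hC.
suff [T [f [g [out [fg fo]]]]] : exists (T : finType) (f : nat -> T) (g : T -> nat -> T)
    (out : T -> nat), (forall x d, d < k -> f (k * x + d) = g (f x) d) /\
    forall n, out (f n) = minn (h n.+1) C.
  have [B hB] := dfao_of_automaton out fg; exists B => n; rewrite hB fo.
  exact/minn_idPl.
elim: C {hC} => [|C [T [f [g [out [fg fo]]]]]].
  by exists unit, (fun _ => tt), (fun _ _ => tt), (fun _ => 0); split=> // n; rewrite minn0.
have [T1 [f1 [g1 [acc [_ fg1 f1P]]]]] :=
  @reg_automaton _ (fun x => h x <= C) (rh C).
have [g2 fg2] := succ_automaton fg1.
exists (T * (T1 * T1))%type, (fun n => (f n, (f1 n, f1 n.+1))),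
  (fun c d => (g c.1 d, g2 c.2 d)), (fun c => if acc c.2.2 then out c.1 else C.+1); split.
  by move=> x d dk; rewrite fg // fg2.
move=> n /=; rewrite fo; case: ifP => a.
  have hC : h n.+1 <= C by apply/f1P.
  by rewrite (minn_idPl hC) (minn_idPl (leqW hC)).
have hC : C < h n.+1 by rewrite ltnNge; apply/negP => /f1P; rewrite a.
by rewrite (minn_idPr hC).
Qed.

(** Both sides are functions of the state of [B] at [n] and the class of [n + 1], so a product
    automaton reduces the comparison to small [n]. *)
Lemma compare_small_check F c (h : nat -> nat) B :
  reg k F (fun e => h (e 0) <= c) ->
  (forall n, n < k ^ ((codeA B).+1 * 2 * (F * F)) -> (aut_word k B n <= c) = (h n.+1 <= c)) ->
  forall n, (aut_word k B n <= c) = (h n.+1 <= c).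
Proof.
move=> /(@reg_automaton _ (fun x => h x <= c))[T [f [g [acc [TF fg fP]]]]] hs n.
have [g2 fg2] := succ_automaton fg.
pose Q : finType := ('I_(codeA B).+1 * bool)%type.
pose f3 x : Q * (T * T) := (qstate k B x, (f x, f x.+1)).
pose g3 (t : Q * (T * T)) d : Q * (T * T) := (qstep t.1 d, g2 t.2 d).
have fg3 x d : d < k -> f3 (k * x + d) = g3 (f3 x) d.
  by move=> dk; rewrite /f3 /g3 qstate_shift // fg2.
have [y yk fy] := aut_small_witness k1 fg3 n.
have e1 : aut_word k B y = aut_word k B n.
  by rewrite !aut_word_qstate // (congr1 fst fy : qstate k B y = qstate k B n).
have e2 : (h y.+1 <= c) = (h n.+1 <= c).
  have e : f y.+1 = f n.+1 by exact: (congr1 (fun t => t.2.2) fy).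
  by apply/idP/idP => /fP; [rewrite e|rewrite -e] => /fP.
rewrite -e1 -e2; apply: hs; apply: leq_trans yk _; rewrite leq_exp2l //.
by rewrite !card_prod card_ord card_bool leq_mul // leq_mul.
Qed.
End SmallCheck.

(** * Passage to real logarithms and the classes [Theta1] and [ThetaLog] *)

Lemma INR_expn k m : INR (k ^ m) = pow (INR k) m.
Proof. by elim: m => //= m IH; rewrite expnS -multE mult_INR IH. Qed.

Lemma ln_le x y : Rlt 0 x -> Rle x y -> Rle (ln x) (ln y).
Proof. by move=> x0 [lt|->]; [left; apply: ln_increasing|right]. Qed.

Lemma ln_trunc_log k n : 1 < k -> 0 < n ->
  Rle (INR (trunc_log k n) * ln (INR k)) (ln (INR n)) /\
  Rle (ln (INR n)) (INR (trunc_log k n).+1 * ln (INR k)).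
Proof.
move=> k1 n0; have k0 : Rlt 0 (INR k) by apply/lt_0_INR/ltP/ltnW.
have N0 : Rlt 0 (INR n) by apply/lt_0_INR/ltP.
rewrite -!ln_pow // -!INR_expn; split; apply: ln_le => //.
- by apply/lt_0_INR/ltP; rewrite expk_gt0.
- by apply/le_INR/leP/trunc_logP.
- by apply/le_INR/leP/ltnW/trunc_log_ltn.
Qed.

Lemma bounded_Theta1 w C : (forall n, gamma w n <= C) -> Theta1 (gamma w).
Proof.
move=> h; exists R1, (INR C), 1; split; first exact: Rlt_0_1.
move=> n n0; rewrite !Rmult_1_r; split; last by apply/le_INR/leP.
by rewrite -[R1]/(INR 1); apply/le_INR/leP/gamma_gt0.
Qed.

Lemma log_lower_not_Theta1 k w a b : 1 < k ->
  (forall n, 0 < n -> trunc_log k n <= a * gamma w n + b) -> ~ Theta1 (gamma w).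
Proof.
move=> k1 h [c [C [N [_ hN]]]].
have [M CM] := INR_unbounded C.
pose m := N + (a * M + b).+1; have m0 : 0 < k ^ m by rewrite expk_gt0.
have Nm : N <= k ^ m by rewrite ltnW // (leq_ltn_trans _ (ltn_expl m k1)) // leq_addr.
have := h _ m0; rewrite trunc_expnK // => hm.
have [_ hC] := hN _ Nm; rewrite Rmult_1_r in hC.
have gM : gamma w (k ^ m) <= M.
  by apply/leP/INR_le; lra.
have : a * gamma w (k ^ m) <= a * M by rewrite leq_mul2l gM orbT.
by move: hm; rewrite /m; clear; lia.
Qed.

Lemma log_lower_ThetaLog k A a b : 1 < k ->
  (forall n, 0 < n -> trunc_log k n <= a * gamma (aut_word k A) n + b) ->
  ThetaLog (gamma (aut_word k A)).
Proof.
move=> k1 h; set w := aut_word k A in h *; pose B := (k ^ appear_exp (codeA A) * k).+1.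
pose L := ln (INR k); have L0 : Rlt 0 L.
  by rewrite -ln_1; apply: ln_increasing; [lra|apply/(lt_INR 1)/ltP].
pose S := INR (a + b + 1); have S0 : Rlt 0 S by apply/lt_0_INR/ltP; rewrite addn1.
(* Lower bound: [m + 1 <= (a + b + 1) * gamma w n] because [gamma w n >= 1]. Upper bound:
   [(m + 1) * L <= 2 * ln n] because [n >= k]. *)
exists (Rinv (Rmult S L)), (Rdiv (Rmult 2 (INR B)) L), k; split.
  by apply: Rinv_0_lt_compat; apply: Rmult_lt_0_compat.
move=> n kn; have n0 : 0 < n by apply: leq_trans kn; apply: ltnW.
have [l1 l2] := ln_trunc_log k1 n0; rewrite -/L in l1 l2; set m := trunc_log k n in l1 l2.
split.
  apply: (Rmult_le_reg_l (Rmult S L)); first exact: Rmult_lt_0_compat.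
  rewrite -Rmult_assoc Rinv_r; last by apply: Rgt_not_eq; apply: Rmult_lt_0_compat.
  rewrite Rmult_1_l; apply: Rle_trans l2 _.
  rewrite (Rmult_comm S) Rmult_assoc Rmult_comm; apply: Rmult_le_compat_l; first lra.
  rewrite -mult_INR; apply/le_INR/leP; rewrite multE.
  have g1 := gamma_gt0 w n0; have := h n n0; rewrite -/m => hm.
  have : b.+1 * 1 <= b.+1 * gamma w n by rewrite leq_mul2l g1 orbT.
  by rewrite -addnA addn1 mulnDl; move: hm; clear; lia.
have hg := gamma_log_upper A k1 n0; rewrite -/w -/m -/B in hg.
have hgR : Rle (INR (gamma w n)) (INR B * INR m.+1).
  by rewrite -mult_INR; apply/le_INR/leP.
apply: Rle_trans hgR _; have B0 : Rle 0 (INR B) by exact: pos_INR.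
have Ln : Rle L (ln (INR n)).
  by apply: ln_le; [apply/lt_0_INR/ltP/ltnW|apply/le_INR/leP].
have -> : Rmult (Rdiv (Rmult 2 (INR B)) L) (ln (INR n)) =
    Rmult (INR B) (Rdiv (Rmult 2 (ln (INR n))) L) by field; lra.
apply: Rmult_le_compat_l => //; apply: (Rmult_le_reg_r L) => //.
have -> : Rmult (Rdiv (Rmult 2 (ln (INR n))) L) L = Rmult 2 (ln (INR n)) by field; lra.
by rewrite S_INR; lra.
Qed.

(** * Search for the automaton, and the theorem *)

Definition code_pair a b := CodeSeq.code [:: a; b].

Lemma codeA_pair B : exists a b, codeA B = code_pair a b.
Proof. by eexists; eexists; reflexivity. Qed.

(** [CodeSeq] is a bijection, so every pair codes an automaton, and being such a code is decided by
    a bounded search for the pair. *)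
Lemma code_pairA a b : exists B, codeA B = code_pair a b.
Proof.
exists (MkDFAO (map CodeSeq.decode (CodeSeq.decode a)) (CodeSeq.decode b)).
by rewrite /codeA [trans _]/= [outp _]/= (mapK CodeSeq.decodeK) !CodeSeq.decodeK.
Qed.

Lemma comp_code_pair r a b : computable r a -> computable r b ->
  computable r (fun v => code_pair (a v) (b v)).
Proof.
move=> ca cb; have N n := comp_const r n.
apply: comp_ext (comp_mul (comp_exp (N 2) ca) (comp_succ (comp_mul (N 2) (comp_exp (N 2) cb))))
  => v _.
by rewrite /code_pair /= muln1 mul2n.
Qed.

Lemma mu_computable r (p : seq nat -> bool) : computableb r.+1 p ->
  exists e, forall v z, size v = r -> p (z :: v) -> (forall y, y < z -> ~~ p (y :: v)) ->
    evalp e v z.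
Proof.
move=> /comp_not[e he]; exists (PMu e) => v z vr pz pmin; apply: ev_mu.
  by have := he (z :: v); rewrite /= vr pz => /(_ (erefl _)).
by move=> y yz; exists 0; have := he (y :: v); rewrite /= vr (pmin y yz) => /(_ (erefl _)).
Qed.

Theorem theorem18 :
  (* (i) *)
  (forall (k : nat) (w : nat -> nat), 2 <= k -> automatic k w ->
     Theta1 (gamma w) \/ ThetaLog (gamma w)) /\
  (* (ii) decidability, uniformly in k and the automaton *)
  (exists e : prog, forall (k : nat) (A : DFAO), 2 <= k ->
     (Theta1 (gamma (aut_word k A)) -> evalp e [:: k; codeA A] 1) /\
     (~ Theta1 (gamma (aut_word k A)) -> evalp e [:: k; codeA A] 0)) /\
  (* (iii) in the bounded case, gamma(1)gamma(2)... is k-automatic and an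
     automaton for it is computable *)
  (exists e : prog, forall (k : nat) (A : DFAO), 2 <= k ->
     Theta1 (gamma (aut_word k A)) ->
     exists B : DFAO, evalp e [:: k; codeA A] (codeA B) /\
       forall n, aut_word k B n = gamma (aut_word k A) n.+1).
Proof.
have [C [cC dich]] := computable_dichotomy.
have [b [cb rb]] := gamma_states.
(* [Theta1] excludes the logarithmic alternative, so the computable [C] bounds [gamma]. *)
have bounded k A : 1 < k -> Theta1 (gamma (aut_word k A)) ->
    forall n, gamma (aut_word k A) n <= C k (codeA A).
  move=> k1 th; case: (dich k A k1) => // -[x [y h]].
  by case: (log_lower_not_Theta1 k1 h).
split; [|split].
- move=> k w k1 [A wA]; have -> : gamma w = gamma (aut_word k A).
    by apply/funext => n; apply: eq_gamma.
  case: (dich k A k1) => [h|[x [y h]]]; first by left; apply: bounded_Theta1 h.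
  by right; apply: log_lower_ThetaLog h.
- pose p (v : seq nat) := all (fun n => code_gamma_le (nth 0 v 0) (nth 0 v 1) n
      (C (nth 0 v 0) (nth 0 v 1)))
    (iota 0 (nth 0 v 0 ^ b [:: nth 0 v 0; nth 0 v 1; C (nth 0 v 0) (nth 0 v 1)])).
  have [e he] : computableb 2 p.
    have x0 := comp_nth 2 0; have x1 := comp_nth 2 1.
    apply: (comp_all (p := fun v => code_gamma_le (nth 0 v 1) (nth 0 v 2) (nth 0 v 0)
      (C (nth 0 v 1) (nth 0 v 2)))).
      apply: comp_exp => //.
      by apply: (@comp_app 2 3 b [:: _; _; fun v => C (nth 0 v 0) (nth 0 v 1)]).
    apply: comp_code_gamma_le; try exact: comp_nth.
    exact: (comp_proj 3 (erefl (size [:: 1; 2])) cC).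
  exists e => k A k1; have := he [:: k; codeA A] (erefl _).
  have pP : p [:: k; codeA A] <-> Theta1 (gamma (aut_word k A)).
    split=> [/allP h|th].
      apply: (bounded_Theta1 (C := C k (codeA A))).
      apply: (@reg_small_check k k1 _ (fun n => gamma (aut_word k A) n <= C k (codeA A))
        (rb k A _ k1)) => n nk.
      by rewrite -code_gamma_leE //; apply: h; rewrite mem_iota.
    by apply/allP => n _; rewrite code_gamma_leE //; apply: bounded.
  by case: (boolP (p _)) => [/pP th|/negP np] /= ev; split=> // h; case: np; apply/pP.
(* On [[:: z; k; codeA A]] this tests that [z] codes an automaton agreeing with [gamma] at every
   threshold [c <= C], on the finite range of [compare_small_check]. *)
pose p (v : seq nat) := [&& has (fun x => has (fun y => code_pair x y == nth 0 v 0)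
      (iota 0 (nth 0 v 0))) (iota 0 (nth 0 v 0)) &
  all (fun c => all (fun n => (code_word (nth 0 v 1) (nth 0 v 0) n <= c) ==
                       code_gamma_le (nth 0 v 1) (nth 0 v 2) n.+1 c :> nat)
    (iota 0 (nth 0 v 1 ^ ((nth 0 v 0).+1 * 2 *
      (b [:: nth 0 v 1; nth 0 v 2; c] * b [:: nth 0 v 1; nth 0 v 2; c])))))
    (iota 0 (C (nth 0 v 1) (nth 0 v 2)).+1)].
have cp : computableb 3 p.
  apply: comp_and.
    apply: (comp_has (p := fun v => has (fun y => code_pair (nth 0 v 0) y == nth 0 v 1)
      (iota 0 (nth 0 v 1)))); first exact: comp_nth.
    apply: (comp_has (p := fun v => code_pair (nth 0 v 1) (nth 0 v 0) == nth 0 v 2)).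
      exact: comp_nth.
    by apply: comp_eq; [apply: comp_code_pair|]; exact: comp_nth.
  apply: (comp_all (p := fun v => all (fun n => (code_word (nth 0 v 2) (nth 0 v 1) n <= nth 0 v 0)
        == code_gamma_le (nth 0 v 2) (nth 0 v 3) n.+1 (nth 0 v 0) :> nat)
      (iota 0 (nth 0 v 2 ^ ((nth 0 v 1).+1 * 2 * (b [:: nth 0 v 2; nth 0 v 3; nth 0 v 0] *
         b [:: nth 0 v 2; nth 0 v 3; nth 0 v 0])))))).
    exact/comp_succ/(comp_proj 3 (erefl (size [:: 1; 2])) cC).
  have cb4 := comp_proj 4 (erefl (size [:: 2; 3; 0])) cb.
  apply: (comp_all (p := fun v => (code_word (nth 0 v 3) (nth 0 v 2) (nth 0 v 0) <= nth 0 v 1)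
     == code_gamma_le (nth 0 v 3) (nth 0 v 4) (nth 0 v 0).+1 (nth 0 v 1) :> nat)).
    apply: comp_exp; first exact: comp_nth; apply: comp_mul; last exact: comp_mul.
    by apply: comp_mul; [apply: comp_succ; exact: comp_nth|exact: comp_const].
  apply: comp_eq.
    by apply: comp_leq; [apply: comp_code_word|]; exact: comp_nth.
  by apply: comp_code_gamma_le; try apply: comp_succ; exact: comp_nth.
have [e he] := mu_computable cp; exists e => k A k1 th.
have hC := bounded k A k1 th; set w := aut_word k A in th hC *.
have pP z : p [:: z; k; codeA A] <->
    exists B, codeA B = z /\ forall n, aut_word k B n = gamma w n.+1.
  split=> [/andP[/hasP[x _ /hasP[y _ /eqP xy]] /allP hc]|[B [<- hB]]].
    have [B BE] := code_pairA x y; rewrite -BE in xy.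
    have {}xy : codeA B = z := xy; exists B; split=> //.
    have cmp c : c <= C k (codeA A) -> forall n, (aut_word k B n <= c) = (gamma w n.+1 <= c).
      move=> cC'; apply: compare_small_check (rb k A c k1) _ => // n nk.
      have cI : c \in iota 0 (C k (codeA A)).+1 by rewrite mem_iota.
      have /allP/(_ n) := hc c cI.
      rewrite mem_iota /= add0n -xy => /(_ nk)/eqP.
      rewrite code_wordE // code_gamma_leE // -/w.
      by case: (_ <= c); case: (_ <= c).
    (* Agreement at the thresholds [C], [gamma w n.+1] and the output of [B] forces equality. *)
    move=> n; have bC := cmp _ (leqnn _) n; rewrite hC in bC.
    apply/eqP; rewrite eqn_leq cmp // leqnn /=.
    by rewrite -cmp //.
  apply/andP; split.
    have [x [y xy]] := codeA_pair B.
    have h m : m \in [:: x; y] -> m \in iota 0 (codeA B).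
      by rewrite mem_iota xy; exact: leq_code_mem.
    apply/hasP; exists x; first by apply: h; rewrite inE eqxx.
    apply/hasP; exists y; first by apply: h; rewrite !inE eqxx orbT.
    by rewrite /= xy.
  apply/allP => c _; apply/allP => n _.
  by rewrite /= code_wordE // code_gamma_leE // hB.
have [B hB] := shifted_bounded_automatic k1 (fun c => rb k A c k1) hC.
(* The automaton [B], obtained without computing it, shows that the search ends; the program returns
   the least valid code. *)
have ex : exists z, p [:: z; k; codeA A] by exists (codeA B); apply/pP; exists B.
case: (ex_minnP ex) => z /[dup] pz /pP[B' [zE hB']] zmin.
exists B'; split=> //; rewrite zE; apply: he => // y yz.
by apply/negP => /zmin; rewrite leqNgt yz.
Qed.
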